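(* Let $Q=-\Delta_{S^2}(I-\Delta_{S^2})^{-1}$ and let $F\in C_0^\infty(Z^3)$, where $Z^3=\mathbb{R}\times S^2$. Then $$QF=F\ast_{S^2}h,$$ where $h$ is the distribution on $S^2$ defined by $$h(\theta)=\sum_{l\in\mathbb{N}}h_l\sum_{|m|\le l}Y_l^m(\theta),\qquad h_l=\frac{l(l+1)a_l}{l(l+1)+1},\qquad a_l=\frac{1}{2\pi}\sqrt{\frac{2l+1}{4\pi}}.$$
   Context: $\Delta_{S^2}$ is the Laplacian on $S^2$ (so $\Delta_{S^2}Y_l^m=-l(l+1)Y_l^m$) and $I$ the identity; $Q$ acts in the $S^2$ variable $\theta$ only, for each fixed value of the first variable $s\in\mathbb{R}$. Here $\mathbb{N}$ includes $0$. For integers $l\ge0$, $|m|\le l$, the spherical harmonics are $$Y_l^m(\alpha,\beta)=(-1)^m\sqrt{\frac{(2l+1)(l-m)!}{4\pi(l+m)!}}\,P_l^m(\cos\beta)e^{im\alpha},\qquad P_l^m(x)=(-1)^m(1-x^2)^{m/2}\frac{d^m}{dx^m}P_l(x),$$ with $P_l$ the Legendre polynomial of degree $l$, $\alpha$ the azimuth and $\beta$ the polar angle (standard extension to negative $m$; the $Y_l^m$ are orthonormal in $L^2(S^2)$ with respect to surface measure). The series for $h$ converges in the sense of distributions on $S^2$. For $f$ on $S^2$ and a distribution $h$ on $S^2$, the spherical convolution is $$(f\ast_{S^2}h)(\theta)=\int_{g\in SO(3)}f(g\omega)\,h(g^{-1}\theta)\,dg,$$ where $\omega$ is the north pole and $dg$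 is the Haar measure normalized so that $SO(3)$ has total mass $8\pi^2$ (equivalently, so that for $f,h\in L^2(S^2)$, $(f\ast_{S^2}h)_{lm}=2\pi\sqrt{\frac{4\pi}{2l+1}}\,f_{lm}h_{l0}$, where $f_{lm}=\int_{S^2}f\,\overline{Y_l^m}\,d\Omega$); for $h$ a distribution and $f$ smooth the integral is understood in the distributional sense. For $F$ on $Z^3$, the convolution $F\ast_{S^2}h$ is taken in the $S^2$ variable for each fixed $s$. *)

(* Defs.v *)
(* MathComp-Analysis world; complex numbers are R[i] from mathcomp-real-closed. *)
From HB Require Import structures.
From mathcomp Require Import all_boot all_order all_algebra.
From mathcomp Require Import all_classical all_reals all_analysis.
From mathcomp Require Import complex.

Set Implicit Arguments.
Unset Strict Implicit.
Unset Printing Implicit Defensive.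

Import Order.TTheory GRing.Theory Num.Theory.
Import numFieldNormedType.Exports.

Local Open Scope classical_set_scope.
Local Open Scope ring_scope.
Local Open Scope complex_scope.

Section ComplexValued.
Context {R : realType}.

(* MathComp-Analysis has no topology, derivative or integral for R[i]-valued
   functions over R: these are taken on real and imaginary parts. *)
Definition reals_of T (f : T -> R[i]) : T -> R := fun x => complex.Re (f x).
Definition imags_of T (f : T -> R[i]) : T -> R := fun x => complex.Im (f x).

Definition ccvg (u : nat -> R[i]) (z : R[i]) : Prop :=
  (reals_of u @ \oo --> complex.Re z) /\ (imags_of u @ \oo --> complex.Im z).

Definition clim (u : nat -> R[i]) : R[i] :=
  limn (reals_of u) +i* limn (imags_of u).

Definition cintegral d (T : measurableType d) (mu : {measure set T -> \bar R})
    (D : set T) (f : T -> R[i]) : R[i] :=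
  (\int[mu]_(x in D) reals_of f x) +i* (\int[mu]_(x in D) imags_of f x).

(* [iterD [:: v1; ...; vk] f] is D_v1 (... (D_vk f)). *)
Definition iterD (V : normedModType R) (vs : seq V) (f : V -> R) : V -> R :=
  foldr (fun v g x => 'D_v g x) f vs.

Definition citerD (V : normedModType R) (vs : seq V) (f : V -> R[i])
    : V -> R[i] :=
  fun x => iterD vs (reals_of f) x +i* iterD vs (imags_of f) x.

(* C^oo on U, for V finite-dimensional and U open: every iterated directional
   derivative is Frechet differentiable (hence continuous) at each point of U. *)
Definition smooth_on (V : normedModType R) (U : set V) (f : V -> R[i]) : Prop :=
  forall (vs : seq V) (x : V), U x ->
    differentiable (iterD vs (reals_of f)) x /\
    differentiable (iterD vs (imags_of f)) x.

End ComplexValued.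

Section Sphere.
Variable R : realType.

(* The library norm on matrices is the sup norm. *)
Definition enorm (x : 'cV[R]_3) : R := Num.sqrt (\sum_i x i 0 ^+ 2).

Record S2 : Type := MkS2 { S2val :> 'cV[R]_3 ; S2P : enorm S2val == 1 }.

HB.instance Definition _ := [isSub for S2val].
HB.instance Definition _ := [Choice of S2 by <:].

Definition sph_vec (a b : R) : 'cV[R]_3 :=
  \col_i nth 0 [:: sin b * cos a; sin b * sin a; cos b] i.

Lemma sph_vec_proof (a b : R) : enorm (sph_vec a b) == 1.
Proof.
rewrite /enorm !big_ord_recl big_ord0 !mxE /= addr0 addrA !exprMn -mulrDr.
by rewrite cos2Dsin2 mulr1 addrC cos2Dsin2 sqrtr1.
Qed.

(* The point of azimuth a and polar angle b. *)
Definition sph (a b : R) : S2 := MkS2 (sph_vec_proof a b).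

Definition north : S2 := sph 0 0.

(* f(x/|x|); the value at x = 0 is irrelevant. *)
Definition ext0 (f : S2 -> R[i]) (x : 'cV[R]_3) : R[i] :=
  f (insubd north ((enorm x)^-1 *: x)).

Definition smoothS2 (f : S2 -> R[i]) : Prop :=
  smooth_on [set x | x != 0] (ext0 f).

Definition basis3 (i : 'I_3) : 'cV[R]_3 := delta_mx i 0.

(* Laplace-Beltrami operator of the unit sphere: the Euclidean Laplacian of
   f(x/|x|), restricted to |x| = 1. *)
Definition laplS2 (f : S2 -> R[i]) : S2 -> R[i] :=
  fun t => \sum_(i < 3) citerD [:: basis3 i; basis3 i] (ext0 f) (S2val t).

(* (I - Delta)^-1 on C^oo(S^2). *)
Definition resolventS2 (f : S2 -> R[i]) : S2 -> R[i] :=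
  xget (cst 0) [set u | smoothS2 u /\ forall t, u t - laplS2 u t = f t].

Definition opQ (f : S2 -> R[i]) : S2 -> R[i] :=
  fun t => - laplS2 (resolventS2 f) t.

Definition integralS2 (f : S2 -> R[i]) : R[i] :=
  cintegral lebesgue_measure `[0, 2 * pi] (fun a : R =>
    cintegral lebesgue_measure `[0, pi] (fun b : R =>
      (sin b)%:C * f (sph a b))).

(* C_0^oo(R x S^2); F s t stands for F(s, t). *)
Definition smoothZ3 (F : R -> S2 -> R[i]) : Prop :=
  smooth_on [set p : (R^o * 'cV[R]_3)%type | p.2 != 0]
            (fun p => ext0 (F p.1) p.2).

Definition suppZ3 (F : R -> S2 -> R[i]) : set (R^o * 'cV[R]_3)%type :=
  closure [set p | exists t : S2, p.2 = S2val t /\ F p.1 t != 0].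

Definition CcooZ3 (F : R -> S2 -> R[i]) : Prop :=
  smoothZ3 F /\ compact (suppZ3 F).

(* A distribution acts on C^oo(S^2), topologized by the sup norms over S^2 of
   the partial derivatives of f(x/|x|); a function g acts bilinearly, by
   phi |-> integral of g phi. *)
Definition is_distribution (T : (S2 -> R[i]) -> R[i]) : Prop :=
  (forall (c : R[i]) (phi psi : S2 -> R[i]), smoothS2 phi -> smoothS2 psi ->
     T (fun t => c * phi t + psi t) = c * T phi + T psi) /\
  (exists (N : nat) (C : R), forall (phi : S2 -> R[i]) (M : R), smoothS2 phi ->
     (forall (s : seq 'I_3) (t : S2), (size s <= N)%N ->
        `|citerD (map basis3 s) (ext0 phi) (S2val t)| <= M%:C) ->
     `|T phi| <= (C * M)%:C).

Definition dist_of_fun (g : S2 -> R[i]) : (S2 -> R[i]) -> R[i] :=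
  fun phi => integralS2 (fun t => g t * phi t).

Definition eq_dist (T1 T2 : (S2 -> R[i]) -> R[i]) : Prop :=
  forall phi, smoothS2 phi -> T1 phi = T2 phi.

End Sphere.

Arguments north {R}.
Arguments basis3 {R}.

Section Rotations.
Variable R : realType.

Record SO3 : Type := MkSO3 {
  SO3val :> 'M[R]_3 ;
  SO3P : (SO3val^T *m SO3val == 1%:M) && (\det SO3val == 1) }.

HB.instance Definition _ := [isSub for SO3val].
HB.instance Definition _ := [Choice of SO3 by <:].

Lemma SO3_one_proof :
  ((1%:M : 'M[R]_3)^T *m 1%:M == 1%:M :> 'M[R]_3) && (\det (1%:M : 'M[R]_3) == 1).
Proof. by rewrite trmx1 mulmx1 det1 !eqxx. Qed.

HB.instance Definition _ := isPointed.Build SO3 (MkSO3 SO3_one_proof).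

Lemma SO3_mul_proof (g k : SO3) :
  ((SO3val g *m SO3val k)^T *m (SO3val g *m SO3val k) == 1%:M) &&
  (\det (SO3val g *m SO3val k) == 1).
Proof.
case: g k => [g /andP[/eqP gO /eqP g1]] [k /andP[/eqP kO /eqP k1]] /=.
by rewrite det_mulmx g1 k1 mulr1 trmx_mul -mulmxA (mulmxA g^T) gO mul1mx kO !eqxx.
Qed.

Definition SO3mul (g k : SO3) : SO3 := MkSO3 (SO3_mul_proof g k).

Lemma enormE (x : 'cV[R]_3) : enorm x = Num.sqrt ((x^T *m x) 0 0).
Proof.
by rewrite /enorm mxE; congr Num.sqrt; apply: eq_bigr => i _; rewrite mxE expr2.
Qed.

Lemma rot_proof (g : SO3) (t : S2 R) : enorm (SO3val g *m S2val t) == 1.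
Proof.
case: g t => [g /andP[/eqP gO _]] [t tP] /=.
by rewrite enormE trmx_mul -mulmxA (mulmxA g^T) gO mul1mx -enormE.
Qed.

Definition rot (g : SO3) (t : S2 R) : S2 R := MkS2 (rot_proof g t).

Definition SO3open : set (set SO3) :=
  [set SO3val @^-1` U | U in [set U : set 'M[R]_3 | open U]].

Definition SO3borel := g_sigma_algebraType SO3open.

Definition haar_SO3 (mu : {measure set SO3borel -> \bar R}) : Prop :=
  mu setT = (8 * pi ^+ 2)%:E /\
  forall (g : SO3) (A : set SO3borel), measurable A ->
    mu [set SO3mul g k | k in A] = mu A.

(* The SO(3)-integral of f(g north) h(g^-1 .) dg, as an integral of
   distributions: the rotated distribution h(g^-1 .) maps phi to h(phi(g .)). *)
Definition convS2 (mu : {measure set SO3borel -> \bar R})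
    (f : S2 R -> R[i]) (h : (S2 R -> R[i]) -> R[i]) : (S2 R -> R[i]) -> R[i] :=
  fun phi => cintegral mu setT
    (fun g => f (rot g north) * h (fun t => phi (rot g t))).

End Rotations.

Section Harmonics.
Variable R : realType.

(* Rodrigues' formula. *)
Definition legendre (l : nat) : {poly R} :=
  (2 ^+ l * l`!%:R)^-1 *: (('X^2 - 1) ^+ l)^`(l).

Definition assoc_legendre_nat (l m : nat) (x : R) : R :=
  (-1) ^+ m * Num.sqrt (1 - x ^+ 2) ^+ m * ((legendre l)^`(m)).[x].

(* P_l^(-m) = (-1)^m (l-m)!/(l+m)! P_l^m. *)
Definition assoc_legendre (l : nat) (m : int) (x : R) : R :=
  match m with
  | Posz k => assoc_legendre_nat l k x
  | Negz k => (-1) ^+ k.+1 * (l - k.+1)%N`!%:R / (l + k.+1)%N`!%:R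
              * assoc_legendre_nat l k.+1 x
  end.

Definition harmonic_angles (l : nat) (m : int) (a b : R) : R[i] :=
  ((-1) ^ m
   * Num.sqrt (((2 * l + 1)%N%:R * (absz (l%:Z - m))`!%:R)
               / (4 * pi * (absz (l%:Z + m))`!%:R))
   * assoc_legendre l m (cos b))%:C
  * (cos (m%:~R * a) +i* sin (m%:~R * a)).

(* At the poles, where the azimuth is not unique, harmonic_angles does not
   depend on it. *)
Definition angles (t : S2 R) : R * R :=
  xget (0, 0) [set ab | [/\ 0 <= ab.1 < 2 * pi, 0 <= ab.2 <= pi
                          & sph ab.1 ab.2 = t]].

Definition harmonic (l : nat) (m : int) (t : S2 R) : R[i] :=
  harmonic_angles l m (angles t).1 (angles t).2.

Definition coef_a (l : nat) : R :=
  (2 * pi)^-1 * Num.sqrt ((2 * l + 1)%N%:R / (4 * pi)).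

Definition coef_h (l : nat) : R :=
  (l * (l + 1))%N%:R * coef_a l / (l * (l + 1) + 1)%N%:R.

(* The sum over |m| <= l is indexed by m = k - l with k < 2l+1. *)
Definition h_partial (n : nat) : S2 R -> R[i] := fun t =>
  \sum_(l < n) (coef_h l)%:C
    * \sum_(k < (2 * l)%N.+1) harmonic l (k%:Z - l%:Z) t.

Definition h_dist : (S2 R -> R[i]) -> R[i] :=
  fun phi => clim (fun n => dist_of_fun (h_partial n) phi).

End Harmonics.

(* Main.v *)
(* Functions on the sphere are treated as functions on R^3 \ 0, and the Laplacian as
   the sum of the squares of the rotation fields L_jk.  Let proj_l be the convolution
   with the zonal kernel (2l+1)/(4 pi) P_l(t . x).  It commutes with rotations, satisfies
   proj_l (Delta W) = - l(l+1) proj_l W, and sums to the identity, since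
   sum_(l <= n) (2l+1) P_l = P_n' + P_(n+1)' concentrates at the pole.  Hence
   T = sum_l proj_l / (1 + l(l+1)) inverts I - Delta; as T commutes with rotations, L_jk
   passes through T and T W is smooth, so that Q acts on proj_l as multiplication by
   l(l+1)/(l(l+1)+1).

   In F * h, moving k rotz(c) across the group variable by left invariance, where
   t = k e3, and averaging over c leaves of Y_l^m only the zonal case m = 0; there the
   group integral is 2 pi times an integral over the sphere and gives a multiple of
   proj_l F(t).  The a_l are such that h_l times this multiple is l(l+1)/(l(l+1)+1).
   The series for h converges, since moving the Laplacian twice from Y_l^m to the test
   function makes its terms O(l^(-5/2)), uniformly over the rotates of the test function. *)
Require Import Defs.
From HB Require Import structures.
From mathcomp Require Import all_boot all_order all_algebra.
From mathcomp Require Import all_classical all_reals all_analysis.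
From mathcomp Require Import measurable_realfun complex ring lra.

Set Implicit Arguments.
Unset Strict Implicit.
Unset Printing Implicit Defensive.

Import Order.TTheory GRing.Theory Num.Theory.
Import numFieldNormedType.Exports.

Local Open Scope classical_set_scope.
Local Open Scope ring_scope.

(** The obstacle is the smoothness of T W: the bounds for the projections grow like sqrt(2l+1), and
    the series for T W is not differentiated term by term. For a rotation M the increment T W (M t)
    - T W t equals T (W o M - W) t, and a Taylor expansion of W inside T needs only the bound |T U|
    <= 16 sup |U|. The derivatives of T W are then combinations of functions T (L_jk W), and the
    argument repeats. Soft estimates suffice elsewhere too. The L^1 norm of P_l is bounded through
    its L^2 norm, which already makes the series for T converge absolutely. The Laplace series is
    first summed pointwise, at the pole; its convergence becomes uniform once W is written as T (W -
    lap W). The Haar integral is exchanged with the spherical one through Riemann sums, with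
    Lipschitz bounds uniform over the group. The resolvent is a choice by [xget]. Every solution u
    of u - lap u = f has its projections fixed by f, and the Laplace series recovers -lap u from its
    projections, so the outcome is the same for each choice. *)

Section Frechet.
Context {R : realType} {V W : normedModType R}.

(** The little-o of the library in epsilon form: [Text_diff] verifies it with explicit constants and
    needs the value of the differential as well. *)
Lemma differentiable_epsP (f : V -> W) (x : V) (df : {linear V -> W}) :
  continuous df ->
  (forall e : R, 0 < e ->
     \forall h \near (0 : V), `|f (h + x) - f x - df h| <= e * `|h|) ->
  differentiable f x /\ 'd f x = df :> (V -> W).
Proof.
move=> dfc H.
have E : f \o shift x = cst (f x) + df +o_ 0 id.
  apply: eqaddoE; apply/eqaddoP => e e0; near=> h.
  have -> : (f \o shift x - (cst (f x) + (df : V -> W))) h = f (h + x) - f x - df h.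
    by rewrite /= !fctE /= opprD addrA.
  by near: h; exact: H.
have D := diff_unique dfc E; split => //.
by apply/diff_locallyP; split; rewrite D.
Unshelve. all: by end_near. Qed.

Lemma differentiable_eps (f : V -> W) (x : V) : differentiable f x ->
  forall e : R, 0 < e ->
     \forall h \near (0 : V), `|f (h + x) - f x - 'd f x h| <= e * `|h|.
Proof.
move=> /diff_locallyP [_ E] e e0.
have /eqaddoP/(_ e e0) H : f \o shift x = (cst (f x) + 'd f x) +o_ (0 : V) id by exact: E.
near=> h.
have <- : (f \o shift x - (cst (f x) + 'd f x)) h = f (h + x) - f x - 'd f x h.
  by rewrite /= !fctE /= opprD addrA.
by near: h; exact: H.
Unshelve. all: by end_near. Qed.

Lemma near_eq_differentiable (f g : V -> W) (x : V) :
  (\near x, f x = g x) -> differentiable f x -> differentiable g x.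
Proof.
move=> fg df.
have fgx : f x = g x by exact: nbhs_singleton fg.
have [] // := @differentiable_epsP g x ('d f x); first exact: diff_continuous.
move=> e e0; near=> h.
rewrite -fgx -(_ : f (h + x) = g (h + x)).
  by near: h; exact: differentiable_eps.
near: h; have := fg; rewrite (near_shift 0 x) subr0.
by apply: filterS => h.
Unshelve. all: by end_near. Qed.

End Frechet.

(** * Smooth functions away from the origin *)

Definition o0 : 'I_3 := @Ordinal 3 0 isT.
Definition o1 : 'I_3 := @Ordinal 3 1 isT.
Definition o2 : 'I_3 := @Ordinal 3 2 isT.

Lemma ord3P (i : 'I_3) : [\/ i = o0, i = o1 | i = o2].
Proof.
by case: i => [[|[|[|//]]] p]; [constructor 1|constructor 2|constructor 3]; apply/val_inj.
Qed.

Lemma sum_ord3 (A : nmodType) (F : 'I_3 -> A) : \sum_i F i = F o0 + F o1 + F o2.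
Proof.
rewrite !big_ord_recl big_ord0 addr0 addrA.
by congr (F _ + F _ + F _); apply/val_inj.
Qed.

(* The derivative along the rotation field in the (j, k) coordinate plane. *)
HB.lock Definition L (R : realType) (j k : 'I_3) (U : 'cV[R]_3 -> R) : 'cV[R]_3 -> R :=
  fun x => x j 0 * 'D_(basis3 k) U x - x k 0 * 'D_(basis3 j) U x.

(** The Casimir operator of the rotation group. On functions homogeneous of degree 0 it is nsq x
    times the Euclidean Laplacian ([lap_hom0]), which links it to [laplS2]. *)
HB.lock Definition lap (R : realType) (U : 'cV[R]_3 -> R) : 'cV[R]_3 -> R := fun x =>
  L o0 o1 (L o0 o1 U) x + L o1 o2 (L o1 o2 U) x + L o2 o0 (L o2 o0 U) x.

Section SmoothPunctured.
Variable R : realType.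
Local Notation V := 'cV[R]_3.
Implicit Types (U W : V -> R) (v x : V).

(** The condition [smooth_on] off the origin, for one real component. *)
Definition sm U := forall (vs : seq V) x, x != 0 -> differentiable (Defs.iterD vs U) x.

Lemma near_neq0 x : x != 0 -> \near x, x != 0.
Proof.
move=> x0; have n0 : 0 < `|x| by rewrite normr_gt0.
near=> y; apply/eqP => y0.
have : `|x - y| < `|x| by near: y; exact: cvgr_dist_lt.
by rewrite y0 subr0 ltxx.
Unshelve. all: by end_near. Qed.

Lemma near_punctured (P : V -> Prop) x : (forall y, y != 0 -> P y) -> x != 0 ->
  \near x, P x.
Proof. by move=> H x0; near=> y; apply: H; near: y; exact: near_neq0.
Unshelve. all: by end_near. Qed.

Lemma eq_derive_punctured U W v x : (forall y, y != 0 -> U y = W y) -> x != 0 ->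
  'D_v U x = 'D_v W x.
Proof. by move=> H x0; apply: near_eq_derive; exact: near_punctured. Qed.

Lemma eq_differentiable_punctured U W x : (forall y, y != 0 -> U y = W y) -> x != 0 ->
  differentiable U x -> differentiable W x.
Proof. by move=> H x0; apply: near_eq_differentiable; exact: near_punctured. Qed.

(** The ring generated by S and the constants; [alg_eq] is included because formulas for derivatives
    hold only off the origin. *)
Inductive alg (S : (V -> R) -> Prop) : (V -> R) -> Prop :=
| alg_gen U : S U -> alg S U
| alg_cst c : alg S (cst c)
| alg_add U W : alg S U -> alg S W -> alg S (U + W)
| alg_mul U W : alg S U -> alg S W -> alg S (U * W)
| alg_eq U W : alg S U -> (forall x, x != 0 -> U x = W x) -> alg S W.

(** By the Leibniz rule the whole ring is stable under derivation, so smoothness is reduced to first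
    derivatives of the generators. *)
Lemma alg_sm (S : (V -> R) -> Prop) :
  (forall U, S U -> forall x, x != 0 -> differentiable U x) ->
  (forall U v, S U -> exists2 W, alg S W & forall x, x != 0 -> 'D_v U x = W x) ->
  forall U, alg S U -> sm U.
Proof.
move=> Sd SD.
have Ad U : alg S U -> forall x, x != 0 -> differentiable U x.
  elim=> [{}U /Sd // |c x _|U1 W _ IU _ IW x x0|U1 W _ IU _ IW x x0|U1 W _ IU E x x0].
  - exact: differentiable_cst.
  - by apply: differentiableD; [exact: IU|exact: IW].
  - by apply: differentiableM; [exact: IU|exact: IW].
  - exact: (eq_differentiable_punctured E x0 (IU x x0)).
have AD v U : alg S U -> exists2 W, alg S W & forall x, x != 0 -> 'D_v U x = W x.
  elim=> [{}U /(SD _ v) // |c|U1 W aU [U' aU' HU] aW [W' aW' HW]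
    |U1 W aU [U' aU' HU] aW [W' aW' HW]|U1 W _ [U' aU' HU] E].
  - by exists (cst 0); [exact: alg_cst|move=> x _; rewrite derive_cst].
  - exists (U' + W'); first exact: alg_add.
    move=> x x0; rewrite deriveD ?HU ?HW //; exact/diff_derivable/Ad.
  - exists (U1 * W' + W * U'); first by apply: alg_add; exact: alg_mul.
    move=> x x0; rewrite deriveM ?HU ?HW //; exact/diff_derivable/Ad.
  - exists U' => // x x0; rewrite -HU //; apply/esym; exact: eq_derive_punctured.
move=> U aU.
have H vs : exists2 W, alg S W & forall x, x != 0 -> Defs.iterD vs U x = W x.
  elim: vs => [|v vs [W aW HW]]; first by exists U.
  have [W' aW' HW'] := AD v W aW; exists W' => // x x0.
  by rewrite -HW' //= ; exact: eq_derive_punctured.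
move=> vs x x0; have [W aW HW] := H vs.
apply: (@eq_differentiable_punctured W); [by move=> y y0; rewrite HW|by []|exact: Ad].
Qed.

Lemma sm_diff U x : sm U -> x != 0 -> differentiable U x.
Proof. by move=> sU; exact: (sU [::]). Qed.

Lemma sm_derivable U x v : sm U -> x != 0 -> derivable U x v.
Proof. by move=> sU x0; exact/diff_derivable/sm_diff. Qed.

Lemma sm_continuous U x : sm U -> x != 0 -> {for x, continuous U}.
Proof. by move=> sU x0; exact/differentiable_continuous/sm_diff. Qed.

Lemma sm_derive U v : sm U -> sm (fun x => 'D_v U x).
Proof. by move=> sU vs x x0; have := sU (rcons vs v) x x0; rewrite /Defs.iterD foldr_rcons. Qed.

Lemma alg_sm_sm U : alg sm U -> sm U.
Proof.
apply: alg_sm => [W sW x x0|W v sW]; first exact: sm_diff.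
by exists (fun x => 'D_v W x) => //; apply: alg_gen; exact: sm_derive.
Qed.

Lemma sm_eq U W : sm U -> (forall x, x != 0 -> U x = W x) -> sm W.
Proof. by move=> sU E; apply/alg_sm_sm; apply: alg_eq E; exact: alg_gen. Qed.

Lemma sm_cst c : sm (cst c).
Proof. exact/alg_sm_sm/alg_cst. Qed.

Lemma sm_add U W : sm U -> sm W -> sm (fun x => U x + W x).
Proof. by move=> sU sW; apply/alg_sm_sm/(@alg_add _ U W); exact: alg_gen. Qed.

Lemma sm_mul U W : sm U -> sm W -> sm (fun x => U x * W x).
Proof. by move=> sU sW; apply/alg_sm_sm/(@alg_mul _ U W); exact: alg_gen. Qed.

Lemma sm_scale c U : sm U -> sm (fun x => c * U x).
Proof. by move=> sU; apply: sm_mul => //; exact: sm_cst. Qed.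

Lemma sm_opp U : sm U -> sm (fun x => - U x).
Proof. by move=> /(sm_scale (-1)) /sm_eq; apply => x _; rewrite mulN1r. Qed.

Lemma sm_sub U W : sm U -> sm W -> sm (fun x => U x - W x).
Proof. by move=> sU sW; apply: sm_add => //; exact: sm_opp. Qed.

Lemma sm_sum (I : Type) (r : seq I) (P : pred I) (U : I -> V -> R) :
  (forall i, sm (U i)) -> sm (fun x => \sum_(i <- r | P i) U i x).
Proof.
move=> sU; elim: r => [|i r IH].
  by apply: (sm_eq (sm_cst 0)) => x _; rewrite big_nil.
case Pi : (P i); last by apply: (sm_eq IH) => x _; rewrite big_cons Pi.
by apply: (sm_eq (sm_add (sU i) IH)) => x _; rewrite big_cons Pi.
Qed.

Lemma sm_exp U n : sm U -> sm (fun x => U x ^+ n).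
Proof.
move=> sU; elim: n => [|n IH]; first by apply: (sm_eq (sm_cst 1)) => x _; rewrite expr0.
by apply: (sm_eq (sm_mul sU IH)) => x _; rewrite exprS.
Qed.

Lemma sm_horner (p : {poly R}) U : sm U -> sm (fun x => p.[U x]).
Proof.
move=> sU; apply: (@sm_eq (fun x => \sum_(i < size p) p`_i * U x ^+ i)).
  by apply: sm_sum => i; apply: sm_scale; exact: sm_exp.
by move=> x _; rewrite horner_coef.
Qed.

Lemma derive_coord i x v : 'D_v (fun y : V => y i 0) x = v i 0.
Proof.
have @f : {linear V -> R}.
  by exists (fun N : V => N i 0); do 2![eexists]; do ?[constructor];
     rewrite ?mxE// => ? *; rewrite ?mxE//; move=> ?; rewrite !mxE.
rewrite (_ : (fun _ => _) = f) // deriveE; last exact: differentiable_coord.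
rewrite diff_lin //; exact: coord_continuous.
Qed.

Lemma sm_coord i : sm (fun x => x i 0).
Proof.
apply: (@alg_sm (fun U => exists i, U = fun x => x i 0)).
- by move=> _ [k ->] x _; exact: differentiable_coord.
- move=> _ v [k ->]; exists (cst (v k 0)); first exact: alg_cst.
  by move=> x _; rewrite derive_coord.
- by apply: alg_gen; exists i.
Qed.

Definition nsq x : R := \sum_i x i 0 ^+ 2.

Lemma sm_nsq : sm nsq.
Proof. by apply: sm_sum => i; apply: sm_exp; exact: sm_coord. Qed.

Lemma nsq_ge0 x : 0 <= nsq x.
Proof. by apply: sumr_ge0 => i _; exact: sqr_ge0. Qed.

Lemma nsq_eq0 x : (nsq x == 0) = (x == 0).
Proof.
apply/eqP/eqP => [|->]; last by rewrite /nsq big1 // => i _; rewrite mxE expr0n.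
move=> /eqP; rewrite /nsq psumr_eq0 => [/allP H|i _]; last exact: sqr_ge0.
apply/matrixP => i j; rewrite ord1 mxE; apply/eqP.
by rewrite -sqrf_eq0; exact: (H i (mem_index_enum i)).
Qed.

Lemma nsq_gt0 x : x != 0 -> 0 < nsq x.
Proof. by move=> x0; rewrite lt_def nsq_eq0 x0 nsq_ge0. Qed.

(** The derivative of N = 1/U is -N^2 times that of U, so the smooth functions and N generate a ring
    stable under derivation. *)
Lemma sm_inv U : sm U -> (forall x, x != 0 -> U x != 0) -> sm (fun x => (U x)^-1).
Proof.
move=> sU U0; set N := fun x => _.
apply: (@alg_sm (fun W => sm W \/ W = N)).
- move=> W [sW|->] x x0; first exact: sm_diff.
  by apply: (@differentiableV _ _ U) => //; [exact: sm_diff|exact: U0].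
- move=> W v [sW|->].
    exists (fun x => 'D_v W x) => //; apply: alg_gen; left; exact: sm_derive.
  exists (cst (- 1) * ((N * N) * (fun x => 'D_v U x))).
    apply: alg_mul; first exact: alg_cst.
    apply: alg_mul; first by apply: alg_mul; apply: alg_gen; right.
    by apply: alg_gen; left; exact: sm_derive.
  move=> x x0; have E := @deriveV _ _ U x v (U0 x x0) (sm_derivable sU x0).
  rewrite [LHS]E !fctE /N /cst; move: ('D_v U x) (U0 x x0) => d Ux0.
  by rewrite mulN1r /GRing.scale /= mulNr -expr2 exprVn.
- by apply: alg_gen; right.
Qed.

Lemma derive_mulmx (M : 'M[R]_3) U v x : differentiable U (M *m x) ->
  'D_v (fun y => U (M *m y)) x = 'D_(M *m v) U (M *m x).
Proof.
move=> dU; rewrite /derive.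
set f := (X in lim (fmap X _) = _); set g := (X in _ = lim (fmap X _)).
by have -> : f = g by apply/funext => h; rewrite /f /g /= mulmxDr -scalemxAr.
Qed.

Lemma mulmx_continuous (M : 'M[R]_3) : continuous (fun x : V => M *m x).
Proof.
move=> x; apply: differentiable_continuous.
rewrite (_ : (fun y : V => M *m y) = \sum_j (fun y : V => y j 0 *: col j M)).
  apply: differentiable_sum => j.
  exact/differentiableZl/differentiable_coord.
apply/funext => y; rewrite fct_sumE; apply/matrixP => i k; rewrite ord1 !mxE summxE.
by apply: eq_bigr => j _; rewrite !mxE mulrC.
Qed.

Lemma differentiable_mulmx (M : 'M[R]_3) U x : differentiable U (M *m x) ->
  differentiable (fun y => U (M *m y)) x.
Proof.
move=> dU; apply: (@differentiable_comp _ _ _ _ (fun y : V => M *m y) U) => //.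
apply: (@linear_differentiable _ _ _ (mulmx M)); exact: mulmx_continuous.
Qed.

Lemma sm_mulmx (M : 'M[R]_3) U : (forall x, x != 0 -> M *m x != 0) -> sm U ->
  sm (fun x => U (M *m x)).
Proof.
move=> M0 sU.
apply: (@alg_sm (fun W => exists2 W0, sm W0 & W = fun x => W0 (M *m x))).
- by move=> _ [W sW ->] x x0; apply: differentiable_mulmx; apply: sm_diff => //; exact: M0.
- move=> _ v [W sW ->]; exists (fun x => 'D_(M *m v) W (M *m x)).
    by apply: alg_gen; exists (fun x => 'D_(M *m v) W x) => //; exact: sm_derive.
  by move=> x x0; rewrite derive_mulmx //; apply: sm_diff => //; exact: M0.
- by apply: alg_gen; exists U.
Qed.

Lemma derive_lin U x a v w : differentiable U x ->
  'D_(a *: v + w) U x = a * 'D_v U x + 'D_w U x.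
Proof. by move=> dU; rewrite !deriveE // linearP. Qed.

Lemma derive_basis U x v : differentiable U x ->
  'D_v U x = \sum_i v i 0 * 'D_(basis3 i) U x.
Proof.
move=> dU; rewrite deriveE // {1}[v]matrix_sum_delta.
rewrite linear_sum; apply: eq_bigr => i _.
by rewrite big_ord1 linearZ /= deriveE.
Qed.

Lemma LE j k U x : L j k U x = x j 0 * 'D_(basis3 k) U x - x k 0 * 'D_(basis3 j) U x.
Proof. by rewrite L.unlock. Qed.

Lemma sm_L j k U : sm U -> sm (L j k U).
Proof.
move=> sU; have H p q : sm (fun x => x p 0 * 'D_(basis3 q) U x).
  by apply: sm_mul; [exact: sm_coord|exact: sm_derive].
by apply: (sm_eq (sm_sub (H j k) (H k j))) => x _; rewrite LE.
Qed.

Lemma L_mul j k U W x : sm U -> sm W -> x != 0 ->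
  L j k (fun y => U y * W y) x = L j k U x * W x + U x * L j k W x.
Proof.
move=> sU sW x0.
have E v : 'D_v (fun y => U y * W y) x = U x * 'D_v W x + W x * 'D_v U x.
  by rewrite (@deriveM _ _ U W) //; exact: sm_derivable.
rewrite !LE !E; move: ('D__ _ _) ('D__ _ _) ('D__ _ _) ('D__ _ _) => a b c d; ring.
Qed.

Lemma eq_L j k U W x : (forall y, y != 0 -> U y = W y) -> x != 0 ->
  L j k U x = L j k W x.
Proof. by move=> E x0; rewrite !LE !(eq_derive_punctured _ E). Qed.

Lemma lapE U x :
  lap U x = L o0 o1 (L o0 o1 U) x + L o1 o2 (L o1 o2 U) x + L o2 o0 (L o2 o0 U) x.
Proof. by rewrite lap.unlock. Qed.

Lemma sm_lap U : sm U -> sm (lap U).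
Proof.
move=> sU; have H p q : sm (L p q (L p q U)) by do 2 apply: sm_L.
by apply: (sm_eq (sm_add (sm_add (H o0 o1) (H o1 o2)) (H o2 o0))) => x _; rewrite lapE.
Qed.

End SmoothPunctured.

(** * Integration over the sphere *)

HB.lock Definition Int (R : realType) (a b : R) (f : R -> R) :=
  \int[lebesgue_measure]_(x in `[a, b]) f x.

Section RealIntegral.
Variable R : realType.
Implicit Types (f g F G : R -> R) (a b c x C : R).

Lemma IntE a b f : Int a b f = \int[lebesgue_measure]_(x in `[a, b]) f x.
Proof. by rewrite Int.unlock. Qed.

Lemma continuous_integrable a b f : continuous f ->
  lebesgue_measure.-integrable `[a, b] (EFin \o f).
Proof.
move=> cf; apply: continuous_compact_integrable; first exact: segment_compact.
exact: continuous_subspaceT.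
Qed.

Lemma continuousZ_real c f : continuous f -> continuous (fun x => c * f x).
Proof. by move=> cf x; apply: continuousM; [exact: cst_continuous|exact: cf]. Qed.

Lemma IntD a b f g : continuous f -> continuous g ->
  Int a b (fun x => f x + g x) = Int a b f + Int a b g.
Proof. by move=> cf cg; rewrite !IntE RintegralD //; exact: continuous_integrable. Qed.

Lemma IntZ a b c f : continuous f -> Int a b (fun x => c * f x) = c * Int a b f.
Proof. by move=> cf; rewrite !IntE RintegralZl //; exact: continuous_integrable. Qed.

Lemma eq_Int a b f g : (forall x, a <= x <= b -> f x = g x) -> Int a b f = Int a b g.
Proof. by move=> E; rewrite !IntE; apply: eq_Rintegral => x; rewrite inE /= in_itv /= => /E. Qed.

Lemma le_Int a b f g : continuous f -> continuous g ->
  (forall x, a <= x <= b -> f x <= g x) -> Int a b f <= Int a b g.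
Proof.
move=> cf cg E; rewrite !IntE; apply: le_Rintegral => //; try exact: continuous_integrable.
Qed.

Lemma le_normr_Int a b f g : continuous f -> continuous g ->
  (forall x, a <= x <= b -> `|f x| <= g x) -> `|Int a b f| <= Int a b g.
Proof.
move=> cf cg E.
rewrite IntE; apply: le_trans.
  by apply: le_normr_Rintegral => //; exact: continuous_integrable.
rewrite -IntE; apply: le_Int => // x; apply: continuous_comp; [exact: cf|exact: norm_continuous].
Qed.

Lemma Int_cst a b c : a <= b -> Int a b (cst c) = c * (b - a).
Proof.
move=> ab; rewrite !IntE Rintegral_cst //; congr (_ * _).
have E : fine (@lebesgue_measure R `[a, b]%classic) = b - a.
  rewrite lebesgue_measure_itv /= lte_fin.
  by move: ab; rewrite le_eqVlt => /orP[/eqP->|->//]; rewrite ltxx subrr.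
exact: E.
Qed.

Lemma is_derive_continuous F f : (forall x, is_derive x 1 F (f x)) -> continuous F.
Proof.
move=> H x; apply: differentiable_continuous; apply/derivable1_diffP.
by have [] := H x.
Qed.

Lemma is_derive_LRcontinuous F f a b : (forall x, is_derive x 1 F (f x)) ->
  derivable_oo_LRcontinuous F a b.
Proof.
move=> H; have cF := is_derive_continuous H; split.
- by move=> x _; have [] := H x.
- exact/cvg_at_right_filter/cF.
- exact/cvg_at_left_filter/cF.
Qed.

Lemma Int_FTC F f a b : a < b -> (forall x, is_derive x 1 F (f x)) -> continuous f ->
  Int a b f = F b - F a.
Proof.
move=> ab H cf; rewrite !IntE /Rintegral (@continuous_FTC2 _ _ F) //.
- exact: continuous_subspaceT.
- exact: is_derive_LRcontinuous H.
- by move=> x _; rewrite derive1E; have [_ ->] := H x.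
Qed.

Lemma Int_by_parts F f G g a b : a < b ->
  (forall x, is_derive x 1 F (f x)) -> continuous f ->
  (forall x, is_derive x 1 G (g x)) -> continuous g ->
  Int a b (fun x => F x * g x) = F b * G b - F a * G a - Int a b (fun x => f x * G x).
Proof.
move=> ab HF cf HG cg; rewrite !IntE; apply: Rintegration_by_parts => //.
- exact: continuous_subspaceT.
- exact: is_derive_LRcontinuous HF.
- by move=> x _; rewrite derive1E; have [_ ->] := HF x.
- exact: continuous_subspaceT.
- exact: is_derive_LRcontinuous HG.
- by move=> x _; rewrite derive1E; have [_ ->] := HG x.
Qed.

Lemma Int_continuous_param (f : R -> R -> R) (a b C : R) :
  (forall x, continuous (f x)) -> (forall y, continuous (f^~ y)) ->
  (forall x y, `|f x y| <= C) -> continuous (fun x => Int a b (f x)).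
Proof.
move=> cf cf' fC x; under eq_fun do rewrite IntE.
apply: (@continuity_under_integral _ _ _ lebesgue_measure f `[a, b]%classic _ (x - 1) (x + 1)
          _ _ (cst C)) => //.
- by move=> y _; apply: continuous_integrable.
- by near=> y => _ z _; exact: cf'.
- by apply: continuous_integrable => y; exact: cst_continuous.
- by move=> y _; near=> z => _; exact: fC.
- by rewrite inE /= in_itv /=; apply/andP; split; lra.
Unshelve. all: by end_near. Qed.

Lemma Int_derive_param (f f' : R -> R -> R) (a b C : R) :
  (forall x, continuous (f x)) ->
  (forall x y, is_derive x 1 (f^~ y) (f' x y)) ->
  (forall x y, `|f' x y| <= C) ->
  forall x, is_derive x 1 (fun x => Int a b (f x)) (Int a b (f' x)).
Proof.
move=> cf df fC x.
have I : `]x - 1, x + 1[%classic x by rewrite /= in_itv /=; apply/andP; split; lra.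
have i1 y : `]x - 1, x + 1[%classic y ->
    lebesgue_measure.-integrable `[a, b] (EFin \o f y).
  by move=> _; apply: continuous_integrable.
have i2 y z : `]x - 1, x + 1[%classic y -> `[a, b]%classic z -> derivable (f^~ z) y 1.
  by move=> _ _; have [] := df y z.
have E y z : partial1of2 f y z = f' y z by rewrite partial1of2E; have [_ ->] := df y z.
have i3 y z : `]x - 1, x + 1[%classic y -> `[a, b]%classic z ->
    `|partial1of2 f y z| <= cst C z by rewrite E.
have C0 (z : R) : 0 <= cst C z :> R by apply: le_trans (fC 0 0); exact: normr_ge0.
rewrite IntE (_ : (fun x => Int a b (f x)) = fun x => \int[lebesgue_measure]_(y in `[a, b]) f x y);
  last by apply/funext => y; rewrite IntE.
have i4 : lebesgue_measure.-integrable `[a, b] (EFin \o cst C).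
  by apply: continuous_integrable => y; exact: cst_continuous.
apply: DeriveDef.
  exact: (derivable_under_integral _ I i1 i2 C0 i4 i3).
rewrite -derive1E (differentiation_under_integral _ I i1 i2 C0 i4 i3) //.
by apply: eq_Rintegral => y _; exact: E.
Qed.

End RealIntegral.

(** * Polar coordinates and the rotation fields *)

Section SphereIntegral.
Variable R : realType.
Local Notation V := 'cV[R]_3.
Implicit Types (U W : V -> R) (v x : V) (a b c : R) (k : R -> R).

Definition cnz U := forall x, x != 0 -> {for x, continuous U}.

Lemma cnzD U W : cnz U -> cnz W -> cnz (fun x => U x + W x).
Proof. by move=> cU cW x x0; apply: (@continuousD _ _ _ U W); [exact: cU|exact: cW]. Qed.

Lemma cnzM U W : cnz U -> cnz W -> cnz (fun x => U x * W x).
Proof. by move=> cU cW x x0; apply: (@continuousM _ _ U W); [exact: cU|exact: cW]. Qed.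

Lemma cnz_cst c : cnz (cst c).
Proof. by move=> x _; exact: cst_continuous. Qed.

Lemma cnzZ c W : cnz W -> cnz (fun x => c * W x).
Proof. by move=> cW; exact: (cnzM (@cnz_cst c) cW). Qed.

Lemma cnz_norm U : cnz U -> cnz (fun x => `|U x|).
Proof. by move=> cU x x0; apply: continuous_comp; [exact: cU|exact: norm_continuous]. Qed.

Lemma sm_cnz U : sm U -> cnz U.
Proof. by move=> sU x; exact: sm_continuous. Qed.

Lemma coord_le_nsq x i : `|x i 0| ^+ 2 <= nsq x.
Proof.
rewrite real_normK ?num_real // /nsq (bigD1 i) //= lerDl.
by apply: sumr_ge0 => j _; exact: sqr_ge0.
Qed.

Lemma nsq_continuous : continuous (@nsq R).
Proof.
rewrite (_ : @nsq R = \sum_i (fun x : V => x i 0 ^+ 2)) => [x|].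
  apply: differentiable_continuous; apply: differentiable_sum => i.
  by apply: (@differentiableM _ _ (fun y : V => y i 0) (fun y : V => y i 0)); exact: differentiable_coord.
by apply/funext => x; rewrite fct_sumE.
Qed.

(** A shell around the sphere is taken because the chord between two nearby points, used in
    [taylor2], leaves the sphere but stays in the shell. *)
Lemma shell_bounded U : cnz U ->
  exists2 C : R, 0 <= C & forall x, 1 / 4 <= nsq x <= 4 -> `|U x| <= C.
Proof.
move=> cU.
(* The shell is transposed to row vectors, to which [bounded_closed_compact] applies. *)
pose A : set 'rV[R]_3 := [set y | 1 / 4 <= nsq y^T <= 4].
have ct : continuous (fun y : 'rV[R]_3 => y^T).
  move=> y; apply: differentiable_continuous.
  rewrite (_ : (fun y : 'rV[R]_3 => y^T) =
    \sum_j (fun y : 'rV[R]_3 => y 0 j *: (delta_mx j 0 : V))).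
    by apply: differentiable_sum => j; exact/differentiableZl/differentiable_coord.
  apply/funext => z; rewrite fct_sumE [LHS]matrix_sum_delta; apply: eq_bigr => j _.
  by rewrite big_ord1 mxE.
have cn : continuous (fun y : 'rV[R]_3 => nsq y^T).
  by move=> y; apply: (@continuous_comp _ _ _ (fun y : 'rV[R]_3 => y^T)); [exact: ct|exact: nsq_continuous].
have cA : compact A.
  apply: bounded_closed_compact.
    exists 2; split; first exact: num_real.
    move=> M M2 y /andP[_ y4].
    rewrite /= /Num.norm /= mx_normrE; apply: bigmax_le; first lra.
    move=> [i j] _; rewrite /= ord1.
    have := le_trans (coord_le_nsq y^T j) y4; rewrite mxE => H.
    have H2 : `|y 0 j| ^+ 2 <= 2 ^+ 2 by lra.
    have : `|y 0 j| <= 2 by rewrite -(@ler_pXn2r _ 2) // nnegrE; lra.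
    lra.
  have -> : A = (fun y : 'rV[R]_3 => nsq y^T) @^-1` [set r | 1 / 4 <= r <= 4] by [].
  apply: closed_comp => //.
  have -> : [set r : R | 1 / 4 <= r <= 4] = `[1 / 4, 4]%classic.
    by apply/seteqP; split => r /=; rewrite in_itv.
  exact: interval_closed.
have [A0|/set0P A0] := eqVneq A set0.
  exists 0 => // x Hx; exfalso.
  have : A x^T by rewrite /A /= trmxK.
  by rewrite A0.
have cf : {within A, continuous (fun y : 'rV[R]_3 => `|U y^T|)}.
  apply: continuous_in_subspaceT => y; rewrite inE => /andP[y1 _].
  apply: (@continuous_comp _ _ _ (fun y : 'rV[R]_3 => y^T) (fun x => `|U x|)); first exact: ct.
  apply: cnz_norm => //; rewrite -nsq_eq0; apply/eqP => y0; move: y1; rewrite y0; lra.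
have [m Am Hm] := compact_EVT_max A0 cA cf.
exists (`|U m^T|) => // x Hx.
by have := Hm x^T; rewrite trmxK; apply; rewrite inE /A /= trmxK.
Qed.

Lemma sphere_bounded U : cnz U ->
  exists2 C : R, 0 <= C & forall x, nsq x = 1 -> `|U x| <= C.
Proof.
by move=> /shell_bounded [C C0 H]; exists C => // x x1; apply: H; rewrite x1; apply/andP; split; lra.
Qed.

Lemma nsq1_neq0 x : nsq x = 1 -> x != 0.
Proof. by move=> x1; rewrite -nsq_eq0 x1 oner_eq0. Qed.

Lemma sph_vec0 a b : sph_vec a b o0 0 = sin b * cos a. Proof. by rewrite mxE. Qed.
Lemma sph_vec1 a b : sph_vec a b o1 0 = sin b * sin a. Proof. by rewrite mxE. Qed.
Lemma sph_vec2 a b : sph_vec a b o2 0 = cos b. Proof. by rewrite mxE. Qed.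

Lemma nsqE x : nsq x = x o0 0 ^+ 2 + x o1 0 ^+ 2 + x o2 0 ^+ 2.
Proof. by rewrite /nsq sum_ord3. Qed.

Lemma nsq_sph_vec a b : nsq (sph_vec a b) = 1.
Proof.
rewrite nsqE sph_vec0 sph_vec1 sph_vec2 !exprMn -mulrDr cos2Dsin2 mulr1 addrC.
exact: cos2Dsin2.
Qed.

Lemma sph_vec_neq0 a b : sph_vec a b != 0.
Proof. exact/nsq1_neq0/nsq_sph_vec. Qed.

Lemma vec3P x (y : V) : x o0 0 = y o0 0 -> x o1 0 = y o1 0 -> x o2 0 = y o2 0 -> x = y.
Proof.
by move=> h0 h1 h2; apply/matrixP => i j; rewrite ord1; case: (ord3P i) => ->.
Qed.

Lemma is_derive_path W (g : R -> V) (dg : V) (t : R) :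
  (forall i, is_derive t 1 (fun s => g s i 0) (dg i 0)) ->
  differentiable W (g t) -> is_derive t 1 (fun s => W (g s)) ('D_dg W (g t)).
Proof.
move=> Hg dW.
have dg1 : derivable g t 1.
  by apply/derivable_mxP => i j; rewrite ord1; have [] := Hg i.
have dg2 : differentiable g t by exact/derivable1_diffP.
have E : 'd g t 1 = dg.
  rewrite -deriveE // derive_mx //; apply/matrixP => i j; rewrite ord1 mxE.
  by have [_ ->] := Hg i.
apply: DeriveDef.
  by apply/derivable1_diffP; exact: (differentiable_comp dg2 dW).
rewrite deriveE; last exact: (differentiable_comp dg2 dW).
have := diff_comp dg2 dW => /(congr1 (fun f => f 1)) /= ->.
by rewrite E -deriveE.
Qed.

Lemma is_derive_azimuth W a b : differentiable W (sph_vec a b) ->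
  is_derive a 1 (fun s => W (sph_vec s b)) (L o0 o1 W (sph_vec a b)).
Proof.
move=> dW.
pose dg : V := \col_i nth 0 [:: - (sin b * sin a); sin b * cos a; 0] i.
have -> : L o0 o1 W (sph_vec a b) = 'D_dg W (sph_vec a b).
  rewrite [RHS]derive_basis // sum_ord3 LE sph_vec0 sph_vec1 !mxE /=.
  by rewrite mul0r addr0 mulNr addrC.
apply: is_derive_path => // i; case: (ord3P i) => ->; rewrite mxE /=.
- rewrite (_ : (fun s => _) = sin b \*: @cos R).
    by apply: is_derive_eq; rewrite /GRing.scale /= mulrN.
  by apply/funext => s; rewrite sph_vec0.
- rewrite (_ : (fun s => _) = sin b \*: @sin R); first by apply: is_derive_eq.
  by apply/funext => s; rewrite sph_vec1.
- rewrite (_ : (fun s => _) = cst (cos b)); first exact: is_derive_cst.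
  by apply/funext => s; rewrite sph_vec2.
Qed.

(** The derivative d/db on the meridian of azimuth a ([is_derive_polar]). With a frozen as a
    parameter it is a field on all of space, regular at the poles. *)
Definition Lpol a W x := cos a * L o2 o0 W x - sin a * L o1 o2 W x.

Lemma is_derive_polar W a b : differentiable W (sph_vec a b) ->
  is_derive b 1 (fun s => W (sph_vec a s)) (Lpol a W (sph_vec a b)).
Proof.
move=> dW.
pose dg : V := \col_i nth 0 [:: cos b * cos a; cos b * sin a; - sin b] i.
have -> : Lpol a W (sph_vec a b) = 'D_dg W (sph_vec a b).
  rewrite [RHS]derive_basis // sum_ord3 /Lpol !LE sph_vec0 sph_vec1 sph_vec2 !mxE /=.
  have : cos a ^+ 2 = 1 - sin a ^+ 2 by rewrite -(cos2Dsin2 a) addrK.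
  move: ('D__ _ _) ('D__ _ _) ('D__ _ _) (sin a) (cos a) (sin b) (cos b).
  move=> d0 d1 d2 sa ca sb cb E.
  rewrite [RHS](_ : _ = cb * ca * d2 + cb * sa * d0 - sb * (sa ^+ 2 + ca ^+ 2) * d1).
    ring.
  by rewrite E; ring.
apply: is_derive_path => // i; case: (ord3P i) => ->; rewrite mxE /=.
- rewrite (_ : (fun s => _) = cos a \*: @sin R).
    by apply: is_derive_eq; rewrite /GRing.scale /= mulrC.
  by apply/funext => s; rewrite sph_vec0 mulrC.
- rewrite (_ : (fun s => _) = sin a \*: @sin R).
    by apply: is_derive_eq; rewrite /GRing.scale /= mulrC.
  by apply/funext => s; rewrite sph_vec1 mulrC.
- rewrite (_ : (fun s => _) = @cos R); first exact: is_derive_cos.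
  by apply/funext => s; rewrite sph_vec2.
Qed.

End SphereIntegral.

(** The weight k is [sin] for the surface measure, and [cos] after an integration by parts in the
    polar angle. *)
Definition polint (R : realType) (k : R -> R) (W : 'cV[R]_3 -> R) (a : R) :=
  Int 0 pi (fun b => k b * W (sph_vec a b)).

HB.lock Definition Isph (R : realType) (W : 'cV[R]_3 -> R) : R :=
  Int 0 (2 * pi) (polint (@sin R) W).

(** * The surface integral and integration by parts for the rotation fields *)

Section SphereMean.
Variable R : realType.
Local Notation V := 'cV[R]_3.
Implicit Types (U W : V -> R) (v x : V) (a b c C : R) (F f : R -> R).

Lemma sph_vec_continuous_polar a : continuous (fun b => sph_vec a b : V).
Proof.
move=> b; apply: differentiable_continuous; apply/derivable1_diffP/derivable_mxP => i j.
rewrite ord1; have [+ _] := @is_derive_polar R (fun x : V => x i 0) a b (differentiable_coord _ _ _).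
exact.
Qed.

Lemma sph_vec_continuous_azimuth b : continuous (fun a => sph_vec a b : V).
Proof.
move=> a; apply: differentiable_continuous; apply/derivable1_diffP/derivable_mxP => i j.
rewrite ord1; have [+ _] := @is_derive_azimuth R (fun x : V => x i 0) a b (differentiable_coord _ _ _).
exact.
Qed.

Lemma cnz_polar W a : cnz W -> continuous (fun b => W (sph_vec a b)).
Proof.
move=> cW b; apply: (@continuous_comp _ _ _ (fun b => sph_vec a b : V) W).
  exact: sph_vec_continuous_polar.
by apply: cW; exact: sph_vec_neq0.
Qed.

Lemma cnz_azimuth W b : cnz W -> continuous (fun a => W (sph_vec a b)).
Proof.
move=> cW a; apply: (@continuous_comp _ _ _ (fun a => sph_vec a b : V) W).
  exact: sph_vec_continuous_azimuth.
by apply: cW; exact: sph_vec_neq0.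
Qed.

Lemma IsphE W : Isph W = Int 0 (2 * pi) (polint (@sin R) W).
Proof. by rewrite Isph.unlock. Qed.

Lemma polint_integrand (k : R -> R) W a : continuous k -> cnz W ->
  continuous (fun b => k b * W (sph_vec a b)).
Proof. by move=> ck cW b; apply: continuousM; [exact: ck|exact: cnz_polar]. Qed.

Lemma continuous_polint (k : R -> R) W : continuous k -> (forall b, `|k b| <= 1) -> cnz W ->
  continuous (polint k W).
Proof.
move=> ck k1 cW; have [C C0 HC] := sphere_bounded cW.
apply: (@Int_continuous_param _ (fun a b => k b * W (sph_vec a b)) _ _ C).
- by move=> a; exact: polint_integrand.
- move=> b a; apply: continuousM; first exact: cst_continuous.
  exact: cnz_azimuth.
- move=> a b; rewrite normrM -[C]mul1r; apply: ler_pM => //.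
  by apply: HC; exact: nsq_sph_vec.
Qed.

Lemma normr_sin_le1 b : `|sin b| <= 1 :> R.
Proof. by rewrite ler_norml sin_geN1 sin_le1. Qed.

Lemma normr_cos_le1 b : `|cos b| <= 1 :> R.
Proof. by rewrite ler_norml cos_geN1 cos_le1. Qed.

Lemma continuous_polint_sin W : cnz W -> continuous (polint (@sin R) W).
Proof. by apply: continuous_polint; [exact: continuous_sin|exact: normr_sin_le1]. Qed.

Lemma continuous_polint_cos W : cnz W -> continuous (polint (@cos R) W).
Proof. by apply: continuous_polint; [exact: continuous_cos|exact: normr_cos_le1]. Qed.

Let csin W a := @polint_integrand (@sin R) W a (@continuous_sin R).

Lemma polintD (k : R -> R) U W a : continuous k -> cnz U -> cnz W ->
  polint k (fun x => U x + W x) a = polint k U a + polint k W a.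
Proof.
move=> ck cU cW; rewrite /polint -IntD; try exact: polint_integrand.
by apply: eq_Int => b _; rewrite mulrDr.
Qed.

Lemma polintZ (k : R -> R) c W a : continuous k -> cnz W ->
  polint k (fun x => c * W x) a = c * polint k W a.
Proof.
move=> ck cW; rewrite /polint -IntZ; last exact: polint_integrand.
by apply: eq_Int => b _; rewrite mulrCA.
Qed.

Lemma eq_I U W : (forall x, nsq x = 1 -> U x = W x) -> Isph U = Isph W.
Proof.
move=> E; rewrite !IsphE; apply: eq_Int => a _; apply: eq_Int => b _.
by rewrite E // nsq_sph_vec.
Qed.

Lemma ID U W : cnz U -> cnz W -> Isph (fun x => U x + W x) = Isph U + Isph W.
Proof.
move=> cU cW; rewrite !IsphE -IntD; try exact: continuous_polint_sin.
by apply: eq_Int => a _; rewrite polintD //; exact: continuous_sin.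
Qed.

Lemma IZ c W : cnz W -> Isph (fun x => c * W x) = c * Isph W.
Proof.
move=> cW; rewrite !IsphE -IntZ; try exact: continuous_polint_sin.
by apply: eq_Int => a _; rewrite polintZ //; exact: continuous_sin.
Qed.

Lemma IB U W : cnz U -> cnz W -> Isph (fun x => U x - W x) = Isph U - Isph W.
Proof.
move=> cU cW; rewrite (@eq_I _ (fun x => U x + -1 * W x)) => [|x _].
  rewrite ID //; last exact: cnzZ.
  by rewrite (IZ _ cW) mulN1r.
by rewrite mulN1r.
Qed.

Lemma cnz_sum (J : Type) (r : seq J) (F : J -> V -> R) : (forall j, cnz (F j)) ->
  cnz (fun x => \sum_(j <- r) F j x).
Proof.
move=> cF; elim: r => [|j r IH].
  by rewrite (_ : (fun x => _) = cst 0) ?funeqE => [|x]; [exact: cnz_cst|rewrite big_nil].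
rewrite (_ : (fun x => _) = fun x => F j x + \sum_(i <- r) F i x); first exact: cnzD.
by apply/funext => x; rewrite big_cons.
Qed.

Lemma I_sum (J : Type) (r : seq J) (F : J -> V -> R) : (forall j, cnz (F j)) ->
  Isph (fun x => \sum_(j <- r) F j x) = \sum_(j <- r) Isph (F j).
Proof.
move=> cF; elim: r => [|j r IH].
  rewrite big_nil -[RHS](mul0r (Isph (cst 0))) -(IZ 0 (@cnz_cst _ 0)).
  by apply: eq_I => x _; rewrite big_nil mul0r.
rewrite (@eq_I _ (fun x => F j x + \sum_(i <- r) F i x)) => [|x _].
  by rewrite (ID (cF j)) ?IH ?big_cons //; exact: cnz_sum.
by rewrite big_cons.
Qed.

Lemma le_normr_I U W : cnz U -> cnz W -> (forall x, nsq x = 1 -> `|U x| <= W x) ->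
  `|Isph U| <= Isph W.
Proof.
move=> cU cW UW; rewrite !IsphE; apply: le_normr_Int; try exact: continuous_polint_sin.
move=> a _; apply: le_normr_Int; try exact: csin.
move=> b b0; rewrite normrM ger0_norm ?sin_ge0_pi //.
by apply: ler_wpM2l; [exact: sin_ge0_pi|apply: UW; exact: nsq_sph_vec].
Qed.

Lemma le_I U W : cnz U -> cnz W -> (forall x, nsq x = 1 -> U x <= W x) -> Isph U <= Isph W.
Proof.
move=> cU cW UW; rewrite !IsphE; apply: le_Int; try exact: continuous_polint_sin.
move=> a _; apply: le_Int; try exact: csin.
move=> b b0; apply: ler_wpM2l; first exact: sin_ge0_pi.
by apply: UW; exact: nsq_sph_vec.
Qed.

Lemma pi2_gt0 : 0 < 2 * pi :> R. Proof. by rewrite mulr_gt0 // pi_gt0. Qed.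

Lemma Int_sin : Int 0 pi (@sin R) = 2.
Proof.
have H (s : R) : is_derive s 1 (fun s => - cos s : R) (sin s).
  by have := is_deriveN (is_derive_cos s); rewrite opprK.
by rewrite (Int_FTC (@pi_gt0 R) H (@continuous_sin R)) cospi cos0; ring.
Qed.

Lemma I_separate W (u w : R -> R) : continuous u -> continuous w ->
  (forall a b, W (sph_vec a b) = u a * w b) ->
  Isph W = Int 0 (2 * pi) u * Int 0 pi (fun b => sin b * w b).
Proof.
move=> cu cw E; rewrite IsphE [RHS]mulrC -IntZ //; apply: eq_Int => a _.
rewrite mulrC /polint -IntZ.
  by apply: eq_Int => b _; rewrite E mulrCA.
by move=> b; apply: continuousM; [exact: continuous_sin|exact: cw].
Qed.

Lemma I_cst c : Isph (cst c) = 4 * pi * c.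
Proof.
rewrite (@I_separate _ (cst c) (cst 1)); try by move=> ?; exact: cst_continuous.
  rewrite Int_cst ?(ltW pi2_gt0) // subr0 (_ : Int 0 pi _ = 2); first ring.
  by rewrite -Int_sin; apply: eq_Int => b _; rewrite mulr1.
by move=> a b; rewrite mulr1.
Qed.

Lemma I_bound W C : cnz W -> (forall x, nsq x = 1 -> `|W x| <= C) ->
  `|Isph W| <= 4 * pi * C.
Proof. by move=> cW HC; rewrite -I_cst; apply: le_normr_I => //; exact: cnz_cst. Qed.

Lemma Lz_polint (k : R -> R) W a : continuous k -> (forall b, `|k b| <= 1) -> sm W ->
  is_derive a 1 (polint k W) (polint k (L o0 o1 W) a).
Proof.
move=> ck k1 sW; have cL := sm_cnz (sm_L o0 o1 sW).
have [C C0 HC] := sphere_bounded cL.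
apply: (@Int_derive_param _ (fun a b => k b * W (sph_vec a b))
         (fun a b => k b * L o0 o1 W (sph_vec a b)) _ _ C).
- by move=> {}a; apply: polint_integrand => //; exact: sm_cnz.
- move=> {}a b; have dW := @is_derive_azimuth _ W a b (sm_diff sW (sph_vec_neq0 _ _)).
  exact: (@is_deriveZ _ _ _ (fun s => W (sph_vec s b)) (k b) _ _ _ dW).
- move=> {}a b; rewrite normrM -[C]mul1r; apply: ler_pM => //.
  by apply: HC; exact: nsq_sph_vec.
Qed.

Lemma sph_vec_2pi b : sph_vec (2 * pi) b = sph_vec 0 b :> V.
Proof.
by apply: vec3P; rewrite ?(sph_vec0, sph_vec1, sph_vec2) // mulr_natl ?sin2pi ?cos2pi ?sin0 ?cos0.
Qed.

Lemma polint_2pi (k : R -> R) W : polint k W (2 * pi) = polint k W 0.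
Proof. by apply: eq_Int => b _; rewrite sph_vec_2pi. Qed.

(** Integration by parts in b, where [sin] removes the boundary terms at both poles. *)
Lemma polint_Lpol W a : sm W ->
  polint (@sin R) (Lpol a W) a = - polint (@cos R) W a.
Proof.
move=> sW.
have d b : is_derive b 1 (fun s => W (sph_vec a s)) (Lpol a W (sph_vec a b)).
  exact: is_derive_polar (sm_diff sW (sph_vec_neq0 _ _)).
have cL : cnz (Lpol a W).
  by apply: sm_cnz; apply: sm_sub; apply: sm_scale; exact: sm_L.
rewrite /polint (@Int_by_parts _ (@sin R) (@cos R) (fun s => W (sph_vec a s))) ?pi_gt0 //.
- by rewrite sinpi sin0 !mul0r subrr sub0r.
- exact: continuous_cos.
- exact: cnz_polar.
Qed.

Lemma Int_derive_periodic F f : (forall s : R, is_derive s 1 F (f s)) -> continuous f ->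
  F (2 * pi) = F 0 -> Int 0 (2 * pi) f = 0 :> R.
Proof. by move=> H cf E; rewrite (Int_FTC pi2_gt0 H cf) E subrr. Qed.

Lemma I_Lz W : sm W -> Isph (L o0 o1 W) = 0.
Proof.
move=> sW; rewrite IsphE; apply: (@Int_derive_periodic (polint (@sin R) W)).
- by move=> a; apply: Lz_polint => //; [exact: continuous_sin|exact: normr_sin_le1].
- by apply: continuous_polint_sin; exact/sm_cnz/sm_L.
- exact: polint_2pi.
Qed.

(* In polar coordinates, sin b L_12 and sin b L_20 are combinations of
   sin b d/db and cos b d/da; integrating by parts in b leaves an exact derivative in a. *)
Lemma sin_L12 W a b : sin b * L o1 o2 W (sph_vec a b) =
  - sin a * (sin b * Lpol a W (sph_vec a b)) - cos a * (cos b * L o0 o1 W (sph_vec a b)).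
Proof.
rewrite /Lpol !LE sph_vec0 sph_vec1 sph_vec2.
have : cos a ^+ 2 = 1 - sin a ^+ 2 by rewrite -(cos2Dsin2 a) addrK.
move: ('D__ _ _) ('D__ _ _) ('D__ _ _) (sin a) (cos a) (sin b) (cos b).
move=> d0 d1 d2 sa ca sb cb E.
ring: E.
Qed.

Lemma sin_L20 W a b : sin b * L o2 o0 W (sph_vec a b) =
  cos a * (sin b * Lpol a W (sph_vec a b)) - sin a * (cos b * L o0 o1 W (sph_vec a b)).
Proof.
rewrite /Lpol !LE sph_vec0 sph_vec1 sph_vec2.
have : cos a ^+ 2 = 1 - sin a ^+ 2 by rewrite -(cos2Dsin2 a) addrK.
move: ('D__ _ _) ('D__ _ _) ('D__ _ _) (sin a) (cos a) (sin b) (cos b).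
move=> d0 d1 d2 sa ca sb cb E.
ring: E.
Qed.

(** The common form of [sin_L12], with u = cos, and [sin_L20], with u = sin. If P is the
    cos-weighted meridian integral of W, the integrand in a becomes -(u P)', which integrates to
    zero over a period. *)
Lemma I_horizontal W M (u du : R -> R) : sm W -> cnz M ->
  continuous u -> continuous du ->
  (forall a, is_derive a 1 u (du a)) ->
  (forall a b, sin b * M (sph_vec a b) =
     du a * (sin b * Lpol a W (sph_vec a b)) - u a * (cos b * L o0 o1 W (sph_vec a b))) ->
  u (2 * pi) = u 0 -> Isph M = 0.
Proof.
move=> sW cM cu cdu hu E u2; rewrite !IsphE.
pose P := polint (@cos R) W.
have dP a : is_derive a 1 P (polint (@cos R) (L o0 o1 W) a).
  by apply: Lz_polint => //; [exact: continuous_cos|exact: normr_cos_le1].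
have E2 a : polint (@sin R) M a = - (u a * polint (@cos R) (L o0 o1 W) a + P a * du a).
  have cL : cnz (Lpol a W).
    by apply: sm_cnz; apply: sm_sub; apply: sm_scale; exact: sm_L.
  have cLz := sm_cnz (sm_L o0 o1 sW).
  have i1 := @polint_integrand _ _ a (@continuous_sin R) cL.
  have i2 := @polint_integrand _ _ a (@continuous_cos R) cLz.
  rewrite /polint (@eq_Int _ _ _ _ (fun b => du a * (sin b * Lpol a W (sph_vec a b))
     + - u a * (cos b * L o0 o1 W (sph_vec a b)))); last first.
    by move=> b _; rewrite E mulNr.
  rewrite IntD; first last.
  - exact: continuousZ_real.
  - exact: continuousZ_real.
  rewrite !IntZ //.
  have := polint_Lpol a sW; rewrite {1}/polint => ->.
  rewrite -/(polint (@cos R) (L o0 o1 W) a) -/(P a); ring.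
rewrite (@eq_Int _ _ _ _ _ (fun a _ => E2 a)).
apply: (@Int_derive_periodic (fun a => - (u a * P a))).
- have cP := is_derive_continuous dP.
  set g := fun s => u s * polint (@cos R) (L o0 o1 W) s + P s * du s.
  have cg : continuous g.
    move=> a; apply: (@continuousD _ _ _ (fun s => u s * polint (@cos R) (L o0 o1 W) s)
                        (fun s => P s * du s)).
      apply: continuousM; [exact: cu|].
      exact: (continuous_polint_cos (sm_cnz (sm_L o0 o1 sW))).
    by apply: continuousM; [exact: cP|exact: cdu].
  rewrite (_ : (fun a => _) = fun s => -1 * g s); first exact: continuousZ_real.
  by apply/funext => s; rewrite mulN1r.
- by rewrite u2 /P polint_2pi.
Qed.

Lemma I_L12 W : sm W -> Isph (L o1 o2 W) = 0.
Proof.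
move=> sW; apply: (@I_horizontal W _ (@cos R) (fun s => - sin s)) => //.
- exact/sm_cnz/sm_L.
- exact: continuous_cos.
- by move=> s; apply: continuousN; exact: continuous_sin.
- by move=> a b; rewrite sin_L12.
- by rewrite mulr_natl cos2pi cos0.
Qed.

Lemma I_L20 W : sm W -> Isph (L o2 o0 W) = 0.
Proof.
move=> sW; apply: (@I_horizontal W _ (@sin R) (@cos R)) => //.
- exact/sm_cnz/sm_L.
- exact: continuous_sin.
- exact: continuous_cos.
- by move=> a b; rewrite sin_L20.
- by rewrite mulr_natl sin2pi sin0.
Qed.

Lemma L_anti j k W x : L j k W x = - L k j W x.
Proof. by rewrite !LE opprB. Qed.

Lemma L_diag j W x : L j j W x = 0.
Proof. by rewrite LE subrr. Qed.

Lemma I_L j k W : sm W -> Isph (L j k W) = 0.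
Proof.
move=> sW.
have An p q : Isph (L p q W) = 0 -> Isph (L q p W) = 0.
  move=> E; rewrite (@eq_I _ (fun x => -1 * L p q W x)) => [|x _].
    by rewrite IZ ?E ?mulr0 //; exact/sm_cnz/sm_L.
  by rewrite L_anti mulN1r.
have D p : Isph (L p p W) = 0.
  rewrite (@eq_I _ (cst 0)) => [|x _]; last exact: L_diag.
  by rewrite I_cst mulr0.
have := I_Lz sW; have := I_L12 sW; have := I_L20 sW => h20 h12 h01.
case: (ord3P j) => ->; case: (ord3P k) => ->.
- exact: D.
- exact: h01.
- exact: (An _ _ h20).
- exact: (An _ _ h01).
- exact: D.
- exact: h12.
- exact: h20.
- exact: (An _ _ h12).
- exact: D.
Qed.

Lemma I_L_parts j k U W : sm U -> sm W ->
  Isph (fun x => L j k U x * W x) = - Isph (fun x => U x * L j k W x).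
Proof.
move=> sU sW; apply/eqP; rewrite -subr_eq0 opprK -ID.
- rewrite (@eq_I _ (L j k (fun x => U x * W x))) ?I_L //; first exact: sm_mul.
  by move=> x /nsq1_neq0 x0; rewrite L_mul.
- by apply: sm_cnz; apply: sm_mul => //; exact: sm_L.
- by apply: sm_cnz; apply: sm_mul => //; exact: sm_L.
Qed.

Lemma I_lap_sym U W : sm U -> sm W ->
  Isph (fun x => lap U x * W x) = Isph (fun x => U x * lap W x).
Proof.
move=> sU sW.
have E j k : Isph (fun x => L j k (L j k U) x * W x) = Isph (fun x => U x * L j k (L j k W) x).
  rewrite I_L_parts //; last exact: sm_L.
  by rewrite I_L_parts ?opprK //; exact: sm_L.
have c1 j k : cnz (fun x => L j k (L j k U) x * W x).
  by apply: sm_cnz; apply: sm_mul => //; do 2 apply: sm_L.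
have c2 j k : cnz (fun x => U x * L j k (L j k W) x).
  by apply: sm_cnz; apply: sm_mul => //; do 2 apply: sm_L.
transitivity (Isph (fun x => L o0 o1 (L o0 o1 U) x * W x + L o1 o2 (L o1 o2 U) x * W x +
                 L o2 o0 (L o2 o0 U) x * W x)).
  by apply: eq_I => x _; rewrite lapE !mulrDl.
rewrite !ID //; last exact: cnzD.
rewrite !E -!ID //; last exact: cnzD.
by apply: eq_I => x _; rewrite lapE !mulrDr.
Qed.

End SphereMean.

(** * Rotations *)

Section RotationInvariance.
Variable R : realType.
Local Notation V := 'cV[R]_3.
Implicit Types (U W : V -> R) (v x : V) (a b c t : R) (A M : 'M[R]_3).

Lemma nsq_mx x : nsq x = (x^T *m x) 0 0.
Proof. by rewrite mxE; apply: eq_bigr => i _; rewrite mxE expr2. Qed.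

Lemma nsq_orth M x : M^T *m M = 1%:M -> nsq (M *m x) = nsq x.
Proof. by move=> MO; rewrite !nsq_mx trmx_mul -mulmxA (mulmxA M^T) MO mul1mx. Qed.

Lemma orth_neq0 M x : M^T *m M = 1%:M -> x != 0 -> M *m x != 0.
Proof. by move=> MO x0; rewrite -nsq_eq0 nsq_orth // nsq_eq0. Qed.

Lemma sm_orth M U : M^T *m M = 1%:M -> sm U -> sm (fun x => U (M *m x)).
Proof. by move=> MO; apply: sm_mulmx => x; exact: orth_neq0. Qed.

(* Rodrigues' formula: the exponential of t A when A ^ 3 = - A. *)
Definition rodrigues A t : 'M[R]_3 := 1%:M + sin t *: A + (1 - cos t) *: (A *m A).

Lemma rodrigues_orth A t : A^T = - A -> A *m A *m A = - A ->
  (rodrigues A t)^T *m rodrigues A t = 1%:M.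
Proof.
move=> AT A3; rewrite /rodrigues !linearD /= !linearZ /= trmx1 trmx_mul AT mulNmx mulmxN opprK.
have A3' : A *m (A *m A) = - A by rewrite mulmxA.
have A4 : A *m A *m (A *m A) = - (A *m A) by rewrite mulmxA A3 mulNmx.
rewrite !(mulmxDl, mulmxDr) -!(scalemxAl, scalemxAr) !(mul1mx, mulmx1).
rewrite ?(mulNmx, mulmxN) A3 A3' A4 ?scalerN ?opprK.
move: (A *m A) => B.
apply/matrixP => i j; rewrite !mxE; move: (A i j) (B i j) ((i == j)%:R : R) => y z u.
have := cos2Dsin2 t; move: (sin t) (cos t) => s e E2.
have {}E2 : s ^+ 2 = 1 - e ^+ 2 by rewrite -E2; ring.
ring: E2.
Qed.

Lemma is_derive_rodrigues A t i j : A *m A *m A = - A ->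
  is_derive t 1 (fun s => rodrigues A s i j) ((A *m rodrigues A t) i j).
Proof.
move=> A3.
have -> : (A *m rodrigues A t) i j = cos t * A i j + sin t * (A *m A) i j.
  rewrite /rodrigues !mulmxDr mulmx1 -!scalemxAr mulmxA A3 !mxE; ring.
rewrite (_ : (fun s => _) = (fun s => (1%:M : 'M[R]_3) i j + sin s * A i j +
   (1 - cos s) * (A *m A) i j)); last first.
  by apply/funext => s; rewrite /rodrigues [LHS]mxE [X in X + _]mxE [X in _ + X + _]mxE [X in _ + X]mxE.
apply: is_derive_eq.
rewrite /GRing.scale /=; ring.
Qed.

(** The integral of W along the flow of A has derivative zero in t, by differentiation under both
    integrals; at t = 0 the flow is the identity. *)
Lemma I_flow A (W : V -> R) t : A^T = - A -> A *m A *m A = - A ->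
  (forall U, sm U -> Isph (fun x => 'D_(A *m x) U x) = 0) -> sm W ->
  Isph (fun x => W (rodrigues A t *m x)) = Isph W.
Proof.
move=> AT A3 IA sW.
pose M := rodrigues A; pose AW := fun x => 'D_(A *m x) W x.
have MO s : (M s)^T *m M s = 1%:M by exact: rodrigues_orth.
have sAW : sm AW.
  have H i : sm (fun x => (A *m x) i 0 * 'D_(basis3 i) W x).
    apply: sm_mul; last exact: sm_derive.
    apply: (@sm_eq _ (fun x => \sum_j A i j * x j 0)); last by move=> x _; rewrite mxE.
    by apply: sm_sum => j; apply: sm_scale; exact: sm_coord.
  apply: (sm_eq (sm_sum _ _ H)) => x x0; rewrite /AW derive_basis //.
  exact: sm_diff.
have [C C0 HC] := sphere_bounded (sm_cnz sAW).
have smM s U : sm U -> sm (fun x => U (M s *m x)) by apply: sm_orth.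
(* As A commutes with its exponential, the derivative along the flow is the field of A applied to
   the rotated function, to which [IA] applies. *)
have com s : A *m M s = M s *m A.
  rewrite /M /rodrigues !mulmxDr !mulmxDl mulmx1 mul1mx -!scalemxAr -!scalemxAl.
  by rewrite mulmxA.
have d (s : R) x : nsq x = 1 -> is_derive s 1 (fun s => W (M s *m x)) (AW (M s *m x)).
  move=> x1; apply: is_derive_path; last first.
    by apply: sm_diff => //; apply/nsq1_neq0; rewrite nsq_orth.
  move=> i; rewrite mulmxA mxE (_ : (fun s => _) = \sum_j (fun s => M s i j * x j 0)); last first.
    by apply/funext => r; rewrite fct_sumE mxE.
  have dj j : is_derive s 1 (fun s => M s i j * x j 0) ((A *m M s) i j * x j 0).
    have := is_derive_rodrigues s i j A3 => h.
    by apply: is_derive_eq; rewrite scaler0 add0r mulrC.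
  exact: (@is_derive_sum _ _ _ _ (fun j s => M s i j * x j 0)).
have d1 (a s : R) : is_derive s 1 (fun s => polint (@sin R) (fun x => W (M s *m x)) a)
    (polint (@sin R) (fun x => AW (M s *m x)) a).
  apply: (@Int_derive_param _ (fun s b => sin b * W (M s *m sph_vec a b))
     (fun s b => sin b * AW (M s *m sph_vec a b)) _ _ C).
  - move=> r; apply: (@polint_integrand _ _ (fun x => W (M r *m x))).
      exact: continuous_sin.
    by apply: sm_cnz; exact: smM.
  - move=> r b; have h := d r _ (nsq_sph_vec a b).
    exact: (@is_deriveZ _ _ _ (fun s => W (M s *m sph_vec a b)) (sin b) _ _ _ h).
  - move=> r b; rewrite normrM -[C]mul1r; apply: ler_pM => //; first exact: normr_sin_le1.
    by apply: HC; rewrite nsq_orth // nsq_sph_vec.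
have d2 (s : R) : is_derive s 1 (fun s => Isph (fun x => W (M s *m x))) 0.
  have <- : Int 0 (2 * pi) (fun a => polint (@sin R) (fun x => AW (M s *m x)) a) = 0.
    rewrite -[RHS](IA _ (smM s _ sW)) IsphE; apply: eq_Int => a _; apply: eq_Int => b _.
    rewrite derive_mulmx /AW ?mulmxA ?com //.
    by apply: sm_diff => //; apply/nsq1_neq0; rewrite nsq_orth // nsq_sph_vec.
  rewrite (_ : (fun s => Isph (fun x => W (M s *m x))) = fun s => Int 0 (2 * pi) (polint (@sin R) (fun x => W (M s *m x)))); last first.
    by apply/funext => r; rewrite IsphE.
  apply: (@Int_derive_param _ (fun s a => polint (@sin R) (fun x => W (M s *m x)) a)
     (fun s a => polint (@sin R) (fun x => AW (M s *m x)) a) _ _ (Int 0 pi (cst C))) => //.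
  - by move=> r; apply: continuous_polint_sin; apply: sm_cnz; exact: smM.
  - move=> r a; apply: le_normr_Int.
    + apply: (@polint_integrand _ _ (fun x => AW (M r *m x))); first exact: continuous_sin.
      by apply: sm_cnz; exact: smM.
    + by move=> b; exact: cst_continuous.
    + move=> b _; rewrite normrM -[C]mul1r; apply: ler_pM => //; first exact: normr_sin_le1.
      by apply: HC; rewrite nsq_orth // nsq_sph_vec.
rewrite (is_derive_0_is_cst t 0 d2); apply: eq_I => x _.
by rewrite /M /rodrigues sin0 cos0 subrr !scale0r !addr0 mul1mx.
Qed.

(** The infinitesimal rotation from e_j to e_k, so that derivation along [gen j k *m x] is
    [L j k]. *)
Definition gen (j k : 'I_3) : 'M[R]_3 := delta_mx k j - delta_mx j k.

Lemma gen_tr j k : (gen j k)^T = - gen j k.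
Proof. by rewrite /gen linearB /= !trmx_delta opprB. Qed.

Lemma gen3 j k : j != k -> gen j k *m gen j k *m gen j k = - gen j k.
Proof.
move=> jk; have kj : (k == j) = false by rewrite eq_sym (negbTE jk).
rewrite /gen !(mulmxBl, mulmxBr) !mul_delta_mx_cond !eqxx (negbTE jk) kj.
rewrite !mulr1n !mulr0n !(sub0r, subr0, mulNmx, mulmxN, opprK, mul0mx, mul_delta_mx_cond).
rewrite !eqxx (negbTE jk) kj !mulr1n !mulr0n !(subr0, oppr0, opprK, addr0, add0r, opprB).
by rewrite [LHS]addrC.
Qed.

Lemma gen_mul j k x : gen j k *m x = x j 0 *: basis3 k - x k 0 *: basis3 j.
Proof.
apply/matrixP => i l; rewrite ord1 /gen mulmxBl !mxE; congr (_ - _).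
- rewrite (bigD1 j) //= big1 ?addr0 => [|p pj]; rewrite !mxE.
    by rewrite eqxx andbT mulrC.
  by rewrite (negbTE pj) andbF mul0r.
- rewrite (bigD1 k) //= big1 ?addr0 => [|p pj]; rewrite !mxE.
    by rewrite eqxx andbT mulrC.
  by rewrite (negbTE pj) andbF mul0r.
Qed.

Lemma derive_gen j k U x : differentiable U x -> 'D_(gen j k *m x) U x = L j k U x.
Proof.
move=> dU; rewrite gen_mul LE !deriveE //.
by rewrite linearB /= !linearZ /=.
Qed.

Definition rot3 j k t := rodrigues (gen j k) t.

Lemma rot3_orth j k t : j != k -> (rot3 j k t)^T *m rot3 j k t = 1%:M.
Proof. by move=> jk; apply: rodrigues_orth; [exact: gen_tr|exact: gen3]. Qed.

Lemma I_rot3 j k t W : j != k -> sm W -> Isph (fun x => W (rot3 j k t *m x)) = Isph W.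
Proof.
move=> jk; apply: I_flow; [exact: gen_tr|exact: gen3|].
move=> U sU; rewrite -(I_L j k sU); apply: eq_I => x /nsq1_neq0 x0.
by rewrite derive_gen //; exact: sm_diff.
Qed.

End RotationInvariance.

Arguments gen {R}.
Arguments rot3 {R}.

(** * Euler angles and invariance under all rotations *)

Section EulerAngles.
Variable R : realType.
Local Notation V := 'cV[R]_3.
Implicit Types (U W : V -> R) (v x : V) (a b c t : R) (A M : 'M[R]_3).

Lemma circle_param (p q : R) : p ^+ 2 + q ^+ 2 = 1 ->
  exists t, [/\ 0 <= t < 2 * pi, cos t = p & sin t = q].
Proof.
move=> pq.
have p1 : -1 <= p <= 1 by apply/andP; split; nra.
have c := acosK p1; have s := sin_acos p1.
have q2 : 1 - p ^+ 2 = q ^+ 2 by rewrite -pq addrC addKr.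
have pi0 := @pi_gt0 R.
have [q0|q0] := leP 0 q.
  exists (acos p); split => //.
    by rewrite acos_ge0 //=; have := acos_lepi p1; lra.
  by rewrite s q2 sqrtr_sqr ger0_norm.
exists (2 * pi - acos p); split.
- have pn1 : p != 1 by apply/eqP => p1'; move: q2; rewrite p1' => /eqP; nra.
  have h : -1 <= p < 1 by move: p1 => /andP[-> ?] /=; rewrite lt_neqAle pn1.
  have := acos_gt0 h; have := acos_lepi p1 => h1 h2; apply/andP; split; lra.
- by rewrite mulr_natl cosB cos2pi sin2pi mul0r addr0 mul1r.
- by rewrite mulr_natl sinB cos2pi sin2pi mul0r sub0r mul1r s q2 sqrtr_sqr ltr0_norm ?opprK.
Qed.

Lemma sph_vec_surj x : nsq x = 1 ->
  exists a b, [/\ 0 <= a < 2 * pi, 0 <= b <= pi & sph_vec a b = x].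
Proof.
rewrite nsqE => x1; set x0 := x o0 0; set y0 := x o1 0; set z := x o2 0.
rewrite -/x0 -/y0 -/z in x1.
have z1 : -1 <= z <= 1 by apply/andP; split; nra.
have c := acosK z1; have s := sin_acos z1.
have s2 : sin (acos z) ^+ 2 = x0 ^+ 2 + y0 ^+ 2.
  by rewrite s sqr_sqrtr; [rewrite -x1; ring|nra].
have b01 : 0 <= acos z <= pi by rewrite acos_ge0 ?acos_lepi.
have [s0|s0] := eqVneq (sin (acos z)) 0.
  have h : x0 = 0 /\ y0 = 0 by rewrite s0 in s2; split; nra.
  exists 0, (acos z); split => //; first by rewrite lexx pi2_gt0.
  by apply: vec3P; rewrite ?sph_vec0 ?sph_vec1 ?sph_vec2 ?s0 ?mul0r //; case: h.
have [|t [t1 ct st]] := @circle_param (x0 / sin (acos z)) (y0 / sin (acos z)).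
  by rewrite !exprMn -mulrDl -s2 -exprMn divff // expr1n.
exists t, (acos z); split => //.
apply: vec3P; rewrite ?sph_vec0 ?sph_vec1 ?sph_vec2 ?ct ?st // mulrC divfK //.
Qed.

Definition e3 : V := basis3 o2.

Lemma e3E i : e3 i 0 = (i == o2)%:R.
Proof. by rewrite mxE andbT. Qed.

Lemma nsq_e3 : nsq e3 = 1.
Proof. by rewrite nsqE !e3E /= expr0n expr1n !add0r. Qed.

Lemma rot3E j k t x : rot3 j k t *m x = x + sin t *: (gen j k *m x)
   + (1 - cos t) *: (gen j k *m (gen j k *m x)).
Proof.
rewrite /rot3 /rodrigues; move: (gen j k) => A.
by rewrite !mulmxDl mul1mx -!scalemxAl -mulmxA.
Qed.

Definition rotz t := rot3 o0 o1 t.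
Definition roty t := rot3 o2 o0 t.

Lemma rotz_vec t x : [/\ (rotz t *m x) o0 0 = cos t * x o0 0 - sin t * x o1 0,
  (rotz t *m x) o1 0 = sin t * x o0 0 + cos t * x o1 0 & (rotz t *m x) o2 0 = x o2 0].
Proof. by rewrite /rotz rot3E !gen_mul; split; rewrite !mxE /=; ring. Qed.

Lemma roty_vec t x : [/\ (roty t *m x) o0 0 = cos t * x o0 0 + sin t * x o2 0,
  (roty t *m x) o1 0 = x o1 0 & (roty t *m x) o2 0 = cos t * x o2 0 - sin t * x o0 0].
Proof. by rewrite /roty rot3E !gen_mul; split; rewrite !mxE /=; ring. Qed.

Lemma rotz_orth t : (rotz t)^T *m rotz t = 1%:M. Proof. exact: rot3_orth. Qed.
Lemma roty_orth t : (roty t)^T *m roty t = 1%:M. Proof. exact: rot3_orth. Qed.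

Lemma sph_vec_rot a b : sph_vec a b = rotz a *m roty b *m e3.
Proof.
have [h1 h2 h3] := rotz_vec a (roty b *m e3); have [k1 k2 k3] := roty_vec b e3.
rewrite -mulmxA; apply: vec3P; rewrite ?h1 ?h2 ?h3 ?k1 ?k2 ?k3 !e3E /=
  ?sph_vec0 ?sph_vec1 ?sph_vec2; ring.
Qed.

Lemma det3 M : \det M = M o0 o0 * (M o1 o1 * M o2 o2 - M o1 o2 * M o2 o1)
  - M o0 o1 * (M o1 o0 * M o2 o2 - M o1 o2 * M o2 o0)
  + M o0 o2 * (M o1 o0 * M o2 o1 - M o1 o1 * M o2 o0).
Proof.
(* Indexing the entries by natural numbers lets the index shifts of the cofactors compute. *)
pose F m n : R := M (inord m) (inord n).
have E : M = \matrix_(i, j) F i j by apply/matrixP => i j; rewrite mxE /F !inord_val.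
rewrite E; move: F {E} => F.
rewrite (expand_det_row _ o0) sum_ord3 /cofactor.
rewrite !(expand_det_row _ ord0) !big_ord_recl !big_ord0 /cofactor !det_mx11 !mxE /=.
rewrite /bump /=; ring.
Qed.

(** The eigenvalues of A are 0 and plus or minus i sqrt n, so the determinant is the squared modulus
    of 1 - q n + i p sqrt n. *)
Lemma det_skew A (p q : R) : A^T = - A ->
  let n := A o0 o1 ^+ 2 + A o1 o2 ^+ 2 + A o2 o0 ^+ 2 in
  \det (1%:M + p *: A + q *: (A *m A)) = (1 - q * n) ^+ 2 + p ^+ 2 * n.
Proof.
move=> AT; have S i j : A j i = - A i j.
  by have := congr1 (fun B : 'M[R]_3 => B i j) AT; rewrite !mxE.
have D i : A i i = 0 by have := S i i; lra.
rewrite det3 !mxE !sum_ord3 !D (S o0 o1) (S o1 o2) (S o2 o0) /=.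
move: (A o0 o1) (A o1 o2) (A o2 o0) => x y z; ring.
Qed.

Lemma rot3_det j k t : j != k -> \det (rot3 j k t) = 1.
Proof.
move=> jk; rewrite /rot3 /rodrigues det_skew ?gen_tr //.
have -> : gen j k o0 o1 ^+ 2 + gen j k o1 o2 ^+ 2 + gen j k o2 o0 ^+ 2 = 1 :> R.
  by move: jk; case: (ord3P j) => ->; case: (ord3P k) => -> // _; rewrite !mxE /=; ring.
by rewrite !mulr1 opprB [1 + _]addrC subrK cos2Dsin2.
Qed.

Lemma orth_trmx M : M^T *m M = 1%:M -> M *m M^T = 1%:M.
Proof. exact: mulmx1C. Qed.

(** The transpose fixes e3 too, so the last row and column are trivial and a plane rotation
    remains. *)
Lemma rotz_fixing_e3 M : M^T *m M = 1%:M -> \det M = 1 -> M *m e3 = e3 ->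
  exists t, M = rotz t.
Proof.
move=> MO dM Me.
have Mt : M^T *m e3 = e3 by rewrite -{1}Me mulmxA MO mul1mx.
have c i : M i o2 = (i == o2)%:R.
  by rewrite -e3E -Me /e3 /basis3 -colE mxE.
have r j : M o2 j = (j == o2)%:R.
  by rewrite -e3E -Mt /e3 /basis3 -colE !mxE.
have O i j : \sum_k M k i * M k j = (i == j)%:R.
  have := congr1 (fun B : 'M[R]_3 => B i j) MO; rewrite !mxE => <-.
  by apply: eq_bigr => k _; rewrite mxE.
have := O o0 o0; have := O o0 o1; have := O o1 o1; move: dM.
rewrite det3 !sum_ord3 !c !r /=.
set p := M o0 o0; set q := M o0 o1; set s := M o1 o0; set u := M o1 o1.
rewrite !(mulr0, mul0r, mulr1, subr0, addr0) -!expr2 => d h11 h01 h00.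
have Eu : u = p.
  have : u * (p ^+ 2 + s ^+ 2) = p * (p * u - q * s) + s * (p * q + s * u) by ring.
  by rewrite h00 h01 d !mulr1 mulr0 addr0.
have Eq : q = - s.
  have : q * (p ^+ 2 + s ^+ 2) = p * (p * q + s * u) - s * (p * u - q * s) by ring.
  by rewrite h00 h01 d !mulr1 mulr0 sub0r.
have [t [_ ct st]] := circle_param h00.
exists t; apply/matrixP => i j.
have E : rotz t i j = (rotz t *m (delta_mx j 0 : V)) i 0 by rewrite -colE [RHS]mxE.
have [k0 k1 k2] := rotz_vec t (delta_mx j 0 : V).
case: (ord3P i) E k0 k1 k2 => ->; case: (ord3P j) => -> -> + + +; rewrite !mxE /= ct st => E0 E1 E2.
all: rewrite ?E0 ?E1 ?E2 ?c ?r /= -/p -/q -/s -/u ?Eu ?Eq; ring.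
Qed.

Definition isSO3 M := M^T *m M = 1%:M /\ \det M = 1.

Lemma SO3_mul M N : isSO3 M -> isSO3 N -> isSO3 (M *m N).
Proof.
move=> [MO dM] [NO dN]; split; last by rewrite det_mulmx dM dN mulr1.
by rewrite trmx_mul -mulmxA (mulmxA M^T) MO mul1mx.
Qed.

Lemma SO3_tr M : isSO3 M -> isSO3 M^T.
Proof. by move=> [MO dM]; split; rewrite ?trmxK ?det_tr //; exact: orth_trmx. Qed.

Lemma SO3_rot3 j k t : j != k -> isSO3 (rot3 j k t).
Proof. by move=> jk; split; [exact: rot3_orth|exact: rot3_det]. Qed.

Lemma SO3_transitive x : nsq x = 1 -> exists a b,
  x = rotz a *m roty b *m e3.
Proof. by move=> /sph_vec_surj [a [b [_ _ <-]]]; exists a, b; exact: sph_vec_rot. Qed.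

(** A product rotz a roty b sends e3 to M e3; composing M with its inverse gives a rotation that
    fixes e3. *)
Lemma euler_decomposition M : isSO3 M ->
  exists a b c, M = rotz a *m roty b *m rotz c.
Proof.
move=> [MO dM].
have /SO3_transitive [a [b E]] : nsq (M *m e3) = 1 by rewrite nsq_orth // nsq_e3.
have SK : isSO3 (rotz a *m roty b) by apply: SO3_mul; exact: SO3_rot3.
have [NO dN] := SO3_mul (SO3_tr SK) (conj MO dM).
have [|c Ec] := rotz_fixing_e3 NO dN.
  by rewrite -mulmxA E mulmxA; case: SK => -> _; rewrite mul1mx.
exists a, b, c; rewrite -Ec mulmxA.
by case: SK => /orth_trmx -> _; rewrite mul1mx.
Qed.

Lemma I_SO3 M W : isSO3 M -> sm W -> Isph (fun x => W (M *m x)) = Isph W.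
Proof.
move=> /euler_decomposition [a [b [c ->]]] sW.
have s1 : sm (fun x => W (rotz a *m x)) by apply: sm_orth => //; exact: rotz_orth.
have s2 : sm (fun x => W (rotz a *m (roty b *m x))).
  by apply: (@sm_orth _ _ (fun x => W (rotz a *m x))) => //; exact: roty_orth.
rewrite -[RHS](@I_rot3 _ o0 o1 a) // -[RHS](@I_rot3 _ o2 o0 b) // -[RHS](@I_rot3 _ o0 o1 c) //.
by apply: eq_I => x _; rewrite -!mulmxA.
Qed.

End EulerAngles.

(** * Legendre polynomials *)

Section Legendre.
Variable R : realType.
Implicit Types (p q : {poly R}) (n m k l : nat).

Definition wpoly n : {poly R} := ('X^2 - 1) ^+ n.

Lemma deriv_natr n : (n%:R : {poly R})^`() = 0.
Proof. by rewrite -polyC_natr derivC. Qed.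

Lemma horner_natr n (x : R) : (n%:R : {poly R}).[x] = n%:R.
Proof. by rewrite -polyC_natr hornerC. Qed.

Lemma deriv_w1 : ('X^2 - 1 : {poly R})^`() = 2 * 'X.
Proof. by rewrite derivB derivXn derivC subr0 mulr_natl. Qed.

Lemma wpolyS n : wpoly n.+1 = ('X^2 - 1) * wpoly n.
Proof. by rewrite /wpoly [LHS]exprS. Qed.

Lemma deriv_wpolyS n : (wpoly n.+1)^`() = 2 * n.+1%:R * 'X * wpoly n.
Proof. by rewrite /wpoly deriv_exp deriv_w1 /= -[LHS]mulr_natr -/(wpoly n); ring. Qed.

(** The equation (X^2 - 1) w' = 2 n X w for w = (X^2 - 1)^n, differentiated k + 1 times. *)
Lemma wpoly_ode n k :
  ('X^2 - 1) * (wpoly n)^`(k.+2) + 2 * (k.+1%:R - n%:R) * 'X * (wpoly n)^`(k.+1)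
  + (k.+1%:R * (k%:R - 2 * n%:R)) * (wpoly n)^`(k) = 0.
Proof.
elim: k => [|k IH].
  have E : ('X^2 - 1) * (wpoly n)^`() = 2 * n%:R * 'X * wpoly n.
    case: n => [|n]; first by rewrite /wpoly expr0 derivC; ring.
    by rewrite deriv_wpolyS wpolyS; ring.
  have := congr1 (@deriv R) E; rewrite !derivM deriv_w1 derivX !deriv_natr.
  rewrite derivn1 derivn0 derivnS derivn1 => /eqP; rewrite -subr_eq0 => /eqP <-.
  by rewrite -!natr1; ring.
have := congr1 (@deriv R) IH.
rewrite !(deriv_w1, deriv_natr, derivD, derivN, derivM, derivX, derivC) -!derivnS.
by move=> E; rewrite -[RHS]E -!natr1; ring.
Qed.

(* The factorization carries the values of the derivatives at the endpoints. *)
Lemma wpoly_factor n k : (k <= n)%N -> exists r : {poly R},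
  [/\ (wpoly n)^`(k) = wpoly (n - k) * r, r.[1] = (2 ^ k * n ^_ k)%:R
    & r.[-1] = (-1) ^+ k * (2 ^ k * n ^_ k)%:R].
Proof.
elim: k => [_|k IH kn].
  by exists 1; rewrite subn0 mulr1 ffactn0 expn0 !hornerC !mul1r.
have [r [E r1 rN1]] := IH (ltnW kn).
have e : (n - k = (n - k.+1).+1)%N by rewrite subnSK.
exists (2 * (n - k)%:R * 'X * r + ('X^2 - 1) * r^`()); split.
- by rewrite derivnS E e derivM deriv_wpolyS wpolyS; ring.
- rewrite [RHS](_ : _ = 2 * (n - k)%:R * (2 ^ k * n ^_ k)%:R).
    by rewrite !(hornerE, horner_natr) r1; ring.
  by rewrite ffactnSr expnS !natrM; ring.
- rewrite [RHS](_ : _ = 2 * (n - k)%:R * -1 * ((-1) ^+ k * (2 ^ k * n ^_ k)%:R)).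
    by rewrite !(hornerD, hornerM, hornerN, hornerX, hornerC, horner_natr) rN1; ring.
  by rewrite ffactnSr expnS !natrM exprS; ring.
Qed.

Lemma wpoly_horner0 n x : x ^+ 2 = 1 -> (wpoly n.+1).[x] = 0.
Proof. by move=> x2; rewrite wpolyS !hornerE /= x2 subrr mul0r. Qed.

Lemma wpoly_deriv_endpoint n k x : (k < n)%N -> x ^+ 2 = 1 -> ((wpoly n)^`(k)).[x] = 0.
Proof.
move=> kn x2; have [r [-> _ _]] := wpoly_factor (ltnW kn).
by rewrite hornerM -(subnSK kn) wpoly_horner0 ?mul0r.
Qed.

Let c n : R := (2 ^+ n * n`!%:R)^-1.

Lemma cden_neq0 n : 2 ^+ n * n`!%:R != 0 :> R.
Proof. by rewrite mulf_neq0 ?expf_neq0 // pnatr_eq0 -lt0n fact_gt0. Qed.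

Lemma legendreE n : legendre R n = c n *: (wpoly n)^`(n).
Proof. by []. Qed.

Lemma legendre1 n : (legendre R n).[1] = 1.
Proof.
have [r [E r1 _]] := wpoly_factor (leqnn n).
rewrite legendreE E subnn /wpoly expr0 mul1r hornerZ r1 ffactnn natrM natrX.
by rewrite mulVf // cden_neq0.
Qed.

Lemma legendreN1 n : (legendre R n).[-1] = (-1) ^+ n.
Proof.
have [r [E _ r1]] := wpoly_factor (leqnn n).
rewrite legendreE E subnn /wpoly expr0 mul1r hornerZ r1 ffactnn natrM natrX.
by rewrite mulrCA mulVf ?mulr1 // cden_neq0.
Qed.

Lemma derivn_comp n m p : (p^`(n))^`(m) = p^`(m + n).
Proof. by rewrite /derivn -iterD. Qed.

(** [wpoly_ode] at order m + n. The case m = 0 is Legendre's equation; general m serves the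
    associated functions. *)
Lemma legendre_ode n m (p := (legendre R n)^`(m)) :
  ('X^2 - 1) * p^`(2) + 2 * m.+1%:R * 'X * p^`() +
  (m%:R * m.+1%:R - n%:R * n.+1%:R) * p = 0.
Proof.
have H := wpoly_ode n (m + n).
rewrite {}/p legendreE !linearZ /= !derivn_comp -!derivnS.
move: H; rewrite -!mul_polyC.
move: ((c n)%:P) ((wpoly n)^`((m + n).+2)) ((wpoly n)^`((m + n).+1)) ((wpoly n)^`(m + n)).
move=> k a b d; rewrite -(natr1 (m + n)) -(natr1 m) -(natr1 n) !natrD => H.
rewrite [LHS](_ : _ = k * (('X^2 - 1) * a + 2 * (m%:R + n%:R + 1 - n%:R) * 'X * b +
    (m%:R + n%:R + 1) * (m%:R + n%:R - 2 * n%:R) * d)); last by ring.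
by rewrite H mulr0.
Qed.

Lemma derivn_Xmul k p : ('X * p)^`(k.+1) = 'X * p^`(k.+1) + k.+1%:R * p^`(k).
Proof.
elim: k => [|k IH]; first by rewrite derivn1 derivM derivX derivn1 derivn0; ring.
by rewrite derivnS IH derivD !derivM derivX deriv_natr -!derivnS -!natr1; ring.
Qed.

Lemma derivn_natmul k m p : (m%:R * p)^`(k) = m%:R * p^`(k).
Proof. by rewrite !mulr_natl derivnMn. Qed.

Lemma cS n : c n.+1 * (2 * n.+1%:R) = c n.
Proof.
rewrite /c factS natrM exprS.
have n0 : n.+1%:R != 0 :> R by rewrite pnatr_eq0.
have := cden_neq0 n; rewrite mulf_eq0 negb_or => /andP[h1 h2].
field.
by rewrite h1 h2 addrC natr1 n0.
Qed.

Lemma legendre_deriv_rec n :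
  (legendre R n.+1)^`() = 'X * (legendre R n)^`() + n.+1%:R * legendre R n.
Proof.
rewrite !legendreE -(cS n) !linearZ /= -!derivnS [X in _ *: X = _]derivSn deriv_wpolyS.
rewrite (_ : 2 * n.+1%:R * 'X * wpoly n = (2 * n.+1)%:R * ('X * wpoly n)); last first.
  by rewrite natrM mulrA.
rewrite derivn_natmul derivn_Xmul -!mul_polyC polyCM polyCM !polyC_natr natrM.
ring.
Qed.

Lemma deriv2_wpoly n : (wpoly n.+2)^`(2) =
  (2 * n.+2)%:R * ((2 * n.+1 + 1)%:R * wpoly n.+1 + (2 * n.+1)%:R * wpoly n).
Proof.
rewrite derivnS derivn1 deriv_wpolyS !derivM !deriv_natr derivX deriv_wpolyS wpolyS.
rewrite natrD !natrM -(natr1 n.+1); ring.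
Qed.

(** Read off from the second derivative of (X^2 - 1)^(n+2), in which X^2 is written as (X^2 - 1) +
    1. This is what makes [legendre_sum] telescope. *)
Lemma legendre_deriv_diff n :
  (legendre R n.+2)^`() = (2 * n.+1 + 1)%:R * legendre R n.+1 + (legendre R n)^`().
Proof.
rewrite !legendreE !linearZ /= -!derivnS.
have -> : (wpoly n.+2)^`(n.+3) = ((wpoly n.+2)^`(2))^`(n.+1) by rewrite derivn_comp addn2.
rewrite deriv2_wpoly derivn_natmul derivnD !derivn_natmul.
rewrite -(cS n) -(cS n.+1) -!mul_polyC !polyCM !polyC_natr !natrM; ring.
Qed.

Lemma legendre_mulX_deriv n :
  'X * (legendre R n.+1)^`() = n.+1%:R * legendre R n.+1 + (legendre R n)^`().
Proof.
have := legendre_deriv_rec n.+1; rewrite legendre_deriv_diff => /eqP.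
rewrite -subr_eq => /eqP <-; rewrite natrD natrM -!natr1; ring.
Qed.

Lemma legendre_derivn_eq0 n k : (n < k)%N -> (legendre R n)^`(k) = 0.
Proof.
move=> nk; rewrite legendreE linearZ /= derivn_comp derivn_poly0 ?scaler0 //.
apply: leq_trans (size_exp_leq _ _) _.
have -> : size ('X^2 - 1 : {poly R}) = 3 by rewrite size_XnsubC.
by rewrite /= mul2n -addnn; rewrite -addSn leq_add2r.
Qed.

Lemma legendre0 : legendre R 0 = 1.
Proof. by rewrite /legendre expr0 derivn0 fact0 mulr1 invr1 scale1r expr0. Qed.

Lemma legendre_1 : legendre R 1 = 'X.
Proof.
rewrite legendreE /wpoly [(_ - 1) ^+ 1]expr1 derivn1 deriv_w1 /c expr1 mulr1.
by rewrite -mul_polyC mulrA -polyC_natr -polyCM mulVf ?mul1r // pnatr_eq0.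
Qed.

Lemma legendre_sum n : \sum_(l < n.+1) (2 * l + 1)%:R * legendre R l =
  (legendre R n.+1)^`() + (legendre R n)^`().
Proof.
elim: n => [|n IH].
  by rewrite big_ord_recr big_ord0 /= legendre0 legendre_1 derivX derivC; ring.
by rewrite big_ord_recr /= IH legendre_deriv_diff; ring.
Qed.

(** The integral of p over [-1, 1], kept in the variable b with x = cos b, the form in which it
    occurs on the sphere. *)
Definition J p : R := Int 0 pi (fun b => sin b * p.[cos b]).

Lemma J_continuous p : continuous (fun b : R => sin b * p.[cos b]).
Proof.
move=> b; apply: (@continuousM _ _ (@sin R) (fun b => p.[cos b])).
  exact: continuous_sin.
by apply: continuous_comp; [exact: continuous_cos|exact: continuous_horner].
Qed.

Lemma JD p q : J (p + q) = J p + J q.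
Proof.
rewrite /J -IntD; try exact: J_continuous.
by apply: eq_Int => b _; rewrite hornerD mulrDr.
Qed.

Lemma JZ (k : R) p : J (k%:P * p) = k * J p.
Proof.
rewrite /J -IntZ; last exact: J_continuous.
by apply: eq_Int => b _; rewrite hornerM hornerC mulrCA.
Qed.

Lemma J_deriv p : J p^`() = p.[1] - p.[-1].
Proof.
have H (b : R) : is_derive b 1 (fun b => - p.[cos b]) (sin b * p^`().[cos b]).
  have := @is_derive1_comp _ (horner p) (@cos R) b _ _ (is_derive_poly p (cos b)) (is_derive_cos b).
  by move/is_deriveN => h; apply: is_derive_eq; rewrite mulrN opprK mulrC.
rewrite /J (Int_FTC (@pi_gt0 R) H) ?cospi ?cos0; first ring.
exact: J_continuous.
Qed.

Lemma J_parts p q : J (p^`() * q) = p.[1] * q.[1] - p.[-1] * q.[-1] - J (p * q^`()).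
Proof.
by have := J_deriv (p * q); rewrite derivM JD !hornerM => <-; rewrite addrK.
Qed.

(** The boundary terms vanish because derivatives of (X^2 - 1)^n of order below n have zeros at 1
    and -1. *)
Lemma J_wpoly_parts n k q : (k <= n)%N ->
  J ((wpoly n)^`(k) * q) = (-1) ^+ k * J (wpoly n * q^`(k)).
Proof.
elim: k q => [|k IH] q kn; first by rewrite mul1r.
rewrite derivnS J_parts !wpoly_deriv_endpoint ?expr1n ?sqrrN ?expr1n // !mul0r subrr sub0r.
by rewrite IH 1?ltnW // -derivSn exprS mulN1r mulNr.
Qed.

Lemma J_legendre_orth n q : q^`(n) = 0 -> J (legendre R n * q) = 0.
Proof.
move=> q0; rewrite legendreE -mul_polyC -mulrA JZ J_wpoly_parts // q0 mulr0.
by rewrite -(mulr0 (0 : {poly R})) -polyC0 JZ !(mul0r, mulr0).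
Qed.

(** Integrate (X P^2)' = P^2 + 2 X P' P, whose boundary values sum to 2. Since X P' is n P plus a
    derivative of lower degree, orthogonal to P, the result is (1 + 2 n) J (P^2) = 2. *)
Lemma J_legendre_sq n : J (legendre R n ^+ 2) = 2 / (2 * n + 1)%:R.
Proof.
set P := legendre R n.
have P1 : P.[1] ^+ 2 = 1 by rewrite legendre1 expr1n.
have PN : P.[-1] ^+ 2 = 1 by rewrite legendreN1 sqrr_sign.
have h : J ('X * P^`() * P) = n%:R * J (P ^+ 2).
  rewrite /P; case: n {P P1 PN} => [|n].
    by rewrite legendre0 derivC mulr0 mul0r -(mul0r (1 : {poly R})) -polyC0 JZ !mul0r.
  rewrite legendre_mulX_deriv mulrDl JD [X in _ + J X]mulrC J_legendre_orth.
    by rewrite addr0 -mulrA -polyC_natr JZ -expr2.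
  by rewrite -derivSn legendre_derivn_eq0.
have := J_deriv ('X * P ^+ 2).
rewrite derivM derivX deriv_exp /= expr1 mul1r JD !hornerM !hornerX -!expr2 P1 PN.
rewrite (_ : 'X * (P^`() * P *+ 2) = 2%:P * ('X * P^`() * P)); last first.
  by rewrite polyC_natr -mulr_natl; ring.
rewrite JZ h => E.
have n0 : (2 * n + 1)%:R != 0 :> R by rewrite pnatr_eq0 addn1.
apply: (mulIf n0); rewrite divfK // natrD natrM.
transitivity (J (P ^+ 2) + 2 * (n%:R * J (P ^+ 2))); [ring|rewrite E; ring].
Qed.

Lemma J1 : J 1 = 2.
Proof. by have := J_deriv 'X; rewrite derivX !hornerX => ->; ring. Qed.

Definition vpoly m : {poly R} := (1 - 'X^2) ^+ m.

Lemma vpolyS m : vpoly m.+1 = (1 - 'X^2) * vpoly m.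
Proof. by rewrite /vpoly [LHS]exprS. Qed.

Lemma deriv_vpolyS m : (vpoly m.+1)^`() = - (2 * m.+1%:R) * 'X * vpoly m.
Proof.
rewrite /vpoly deriv_exp derivB derivXn derivC sub0r /= -[LHS]mulr_natr -/(vpoly m).
by rewrite -mulr_natr; ring.
Qed.

(** In self-adjoint form the equation of p says that (v p')' is a multiple of (1 - X^2)^m p, for v =
    (1 - X^2)^(m+1). One integration by parts remains, and v vanishes at both endpoints. *)
Lemma assoc_norm_rec l m (p := (legendre R l)^`(m)) :
  J (vpoly m.+1 * p^`() ^+ 2) = (l%:R * l.+1%:R - m%:R * m.+1%:R) * J (vpoly m * p ^+ 2).
Proof.
have ode := legendre_ode l m; rewrite -/p in ode.
have d : (vpoly m.+1 * p^`())^`() =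
    (m%:R * m.+1%:R - l%:R * l.+1%:R)%:P * (vpoly m * p).
  rewrite derivM deriv_vpolyS vpolyS polyCB !polyCM !polyC_natr.
  rewrite [LHS](_ : _ = - vpoly m * (('X^2 - 1) * p^`(2) + 2 * m.+1%:R * 'X * p^`())); last first.
    by rewrite derivnS derivn1; ring.
  by move/eqP: ode; rewrite addr_eq0 => /eqP ->; ring.
have := J_parts p (vpoly m.+1 * p^`()).
rewrite d !hornerM.
have v1 (x : R) : x ^+ 2 = 1 -> (vpoly m.+1).[x] = 0.
  by move=> x1; rewrite vpolyS !(hornerM, hornerD, hornerN, hornerX, hornerC) -expr2 x1 subrr mul0r.
rewrite !v1 ?sqrrN ?expr1n // !mul0r !mulr0 subr0 sub0r.
rewrite (_ : p * (_%:P * _) = (m%:R * m.+1%:R - l%:R * l.+1%:R)%:P * (vpoly m * p ^+ 2)); last by ring.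
rewrite JZ -mulNr opprB => <-; congr J; ring.
Qed.

Lemma assoc_norm l m : (m <= l)%N ->
  J (vpoly m * (legendre R l)^`(m) ^+ 2) * ((2 * l + 1)%:R * (l - m)`!%:R) =
  2 * (l + m)`!%:R.
Proof.
elim: m => [_|m IH ml].
  rewrite /vpoly expr0 mul1r derivn0 J_legendre_sq subn0 addn0 mulrA divfK // pnatr_eq0 addn1.
have := IH (ltnW ml).
rewrite derivnS assoc_norm_rec -(subnSK ml) (addnS l m) !factS !natrM.
have -> : (l - m.+1).+1%:R = l%:R - m%:R :> R by rewrite subnSK // natrB // ltnW.
rewrite -(natr1 l) -(natr1 m) -(natr1 (l + m)) (natrD _ l m) => E.
rewrite [LHS](_ : _ = (l%:R + m%:R + 1) * (J (vpoly m * (legendre R l)^`(m) ^+ 2) *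
  ((2 * l + 1)%:R * ((l%:R - m%:R) * (l - m.+1)`!%:R)))); last by ring.
by rewrite E; ring.
Qed.

Lemma legendre_L1 n :
  Int 0 pi (fun b => sin b * `|(legendre R n).[cos b]|) <= 2 / Num.sqrt (2 * n + 1)%:R.
Proof.
set P := legendre R n; set s := Num.sqrt _.
have s0 : 0 < s by rewrite sqrtr_gt0 ltr0n addn1.
have s2 : s ^+ 2 = (2 * n + 1)%:R by rewrite sqr_sqrtr ?ler0n.
(* Cauchy-Schwarz in the form |x| <= 1/(2s) + s x^2/2. With s^2 = 2n + 1 each of the two terms
   integrates to 1/s. *)
have -> : 2 / s = J ((s^-1 / 2)%:P * 1 + (s / 2)%:P * P ^+ 2).
  rewrite JD !JZ J1 J_legendre_sq -s2; field; lra.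
apply: le_Int; last first.
- move=> b b0; apply: ler_wpM2l; first exact: sin_ge0_pi.
  rewrite hornerD !hornerM !hornerC mulr1 -expr2; set x := P.[_].
  rewrite -(ler_pM2l (x := 2 * s)); last by lra.
  have -> : 2 * s * (s^-1 / 2 + s / 2 * x ^+ 2) = 1 + (s * `|x|) ^+ 2.
    by rewrite exprMn real_normK ?num_real //; field; lra.
  have := sqr_ge0 (1 - s * `|x|); nra.
- exact: J_continuous.
- move=> b; apply: (@continuousM _ _ (@sin R) (fun b => `|P.[cos b]|)).
    exact: continuous_sin.
  apply: (@continuous_comp _ _ _ (fun b : R => P.[cos b]) (fun x => `|x|)).
    by apply: continuous_comp; [exact: continuous_cos|exact: continuous_horner].
  exact: norm_continuous.
Qed.

End Legendre.

(** * The Laplace series *)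

Section Zonal.
Variable R : realType.
Local Notation V := 'cV[R]_3.
Implicit Types (U W : V -> R) (v x t : V) (M : 'M[R]_3) (p : {poly R}).

Definition dot t x : R := \sum_i t i 0 * x i 0.

Lemma dotE t x : dot t x = t o0 0 * x o0 0 + t o1 0 * x o1 0 + t o2 0 * x o2 0.
Proof. exact: sum_ord3. Qed.

Lemma dotC t x : dot t x = dot x t.
Proof. by apply: eq_bigr => i _; rewrite mulrC. Qed.

Lemma dot_mx t x : dot t x = (t^T *m x) 0 0.
Proof. by rewrite mxE; apply: eq_bigr => i _; rewrite mxE. Qed.

Lemma dot_orth M t x : M^T *m M = 1%:M -> dot (M *m t) (M *m x) = dot t x.
Proof. by move=> MO; rewrite !dot_mx trmx_mul -mulmxA (mulmxA M^T) MO mul1mx. Qed.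

Lemma dot_e3 x : dot (e3 R) x = x o2 0.
Proof. by rewrite dotE !e3E /= !mul0r !add0r mul1r. Qed.

Lemma sm_dot t : sm (dot t).
Proof. by apply: sm_sum => i; apply: sm_scale; exact: sm_coord. Qed.

Lemma sm_zonal p t : sm (fun x => p.[dot t x]).
Proof. exact/sm_horner/sm_dot. Qed.

Lemma derive_horner_comp p U v x : sm U -> x != 0 ->
  'D_v (fun y => p.[U y]) x = p^`().[U x] * 'D_v U x.
Proof.
move=> sU x0.
have dU : differentiable U x by exact: sm_diff.
have dp : differentiable (horner p) (U x) by apply/derivable1_diffP; exact: derivable_horner.
rewrite deriveE; last exact: (differentiable_comp dU dp).
have := diff_comp dU dp => /(congr1 (fun f => f v)) /= ->.
rewrite deriveE // deriv1E; last exact: derivable_horner.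
by rewrite -derivE /GRing.scale /= mulrC.
Qed.

Lemma L_horner j k p U x : sm U -> x != 0 ->
  L j k (fun y => p.[U y]) x = p^`().[U x] * L j k U x.
Proof. by move=> sU x0; rewrite !LE !derive_horner_comp //; ring. Qed.

Lemma dot_lin t (a : R) x v : dot t (a *: x + v) = a * dot t x + dot t v.
Proof.
rewrite /dot mulr_sumr -big_split /=; apply: eq_bigr => i _.
by rewrite !mxE mulrDr mulrCA.
Qed.

Lemma derive_dot t v x : 'D_v (dot t) x = dot t v.
Proof.
have lin : linear (dot t : V -> R^o) by move=> a y z; exact: dot_lin.
pose f : {linear V -> R} := HB.pack (dot t : V -> R^o) (GRing.isLinear.Build _ _ _ _ _ lin).
have cf : continuous f.
  move=> y; rewrite (_ : (f : V -> R) = \sum_i (fun y : V => y i 0 *: (t i 0 : R^o))).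
    apply: differentiable_continuous; apply: differentiable_sum => i.
    exact/differentiableZl/differentiable_coord.
  by apply/funext => z; rewrite fct_sumE; apply: eq_bigr => i _; rewrite mulrC.
rewrite (_ : dot t = f) // deriveE; last exact: linear_differentiable.
by rewrite diff_lin.
Qed.

Lemma dot_basis t i : dot t (basis3 i) = t i 0.
Proof.
rewrite /dot (bigD1 i) //= big1 ?addr0 => [|j ji]; rewrite mxE ?eqxx ?mulr1 //.
by rewrite (negbTE ji) mulr0.
Qed.

Lemma L_dot j k t x : L j k (dot t) x = x j 0 * t k 0 - x k 0 * t j 0.
Proof. by rewrite LE !derive_dot !dot_basis. Qed.

Lemma LZ j k (c : R) U x : sm U -> x != 0 -> L j k (fun y => c * U y) x = c * L j k U x.
Proof.
move=> sU x0; rewrite (@L_mul _ j k (cst c) U) //; last exact: sm_cst.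
by rewrite (LE j k (cst c)) !derive_cst !mulr0 subrr mul0r add0r.
Qed.

Lemma LD j k U W x : sm U -> sm W -> x != 0 ->
  L j k (fun y => U y + W y) x = L j k U x + L j k W x.
Proof.
move=> sU sW x0.
have E v : 'D_v (fun y => U y + W y) x = 'D_v U x + 'D_v W x.
  by rewrite (@deriveD _ _ _ U W) //; exact: sm_derivable.
rewrite !LE !E; move: ('D__ _ _) ('D__ _ _) ('D__ _ _) ('D__ _ _) => a b c d; ring.
Qed.

Lemma LL_zonal j k p t x : j != k -> x != 0 -> L j k (L j k (fun y => p.[dot t y])) x =
  p^`(2).[dot t x] * (x j 0 * t k 0 - x k 0 * t j 0) ^+ 2
  - p^`().[dot t x] * (x j 0 * t j 0 + x k 0 * t k 0).
Proof.
move=> jk x0.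
pose U (y : V) := y j 0 * t k 0 - y k 0 * t j 0.
(* [L j k] maps the linear form of t to a linear form again, that of [s]. *)
pose s : V := t k 0 *: basis3 j + (- t j 0) *: basis3 k.
have sE (y : V) : U y = dot s y.
  rewrite dotC dot_lin -[_ *: basis3 k]addr0 dot_lin !dot_basis /U.
  by rewrite [dot y 0]big1 => [|i _]; [ring|rewrite mxE mulr0].
rewrite (@eq_L _ j k _ (fun y => p^`().[dot t y] * dot s y)) //; last first.
  by move=> y y0; rewrite L_horner ?L_dot -?sE //; exact: sm_dot.
rewrite L_mul //; [|exact: sm_zonal|exact: sm_dot].
rewrite L_horner //; last exact: sm_dot.
rewrite !L_dot -sE /U -[(p^`())^`()]/(p^`(2)) !mxE !eqxx /= !andbT (negbTE jk) eq_sym (negbTE jk) /=.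
ring.
Qed.

Lemma nsq_dot x : nsq x = dot x x.
Proof. by apply: eq_bigr => i _; rewrite expr2. Qed.

Lemma lap_zonal p t x : nsq t = 1 -> nsq x = 1 -> lap (fun y => p.[dot t y]) x =
  (1 - dot t x ^+ 2) * p^`(2).[dot t x] - 2 * dot t x * p^`().[dot t x].
Proof.
move=> t1 x1; have x0 := nsq1_neq0 x1; rewrite lapE !LL_zonal //.
(* Made homogeneous, the coefficient of p'' matches the sum of the squared minors of t and x by
   Lagrange's identity. *)
have -> : 1 - dot t x ^+ 2 = nsq t * nsq x - dot t x ^+ 2 by rewrite t1 x1 mulr1.
rewrite !nsqE !dotE.
move: (p^`(2).[_]) (p^`().[_]) => a b; ring.
Qed.

Lemma lap_legendre l t x : nsq t = 1 -> nsq x = 1 ->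
  lap (fun y => (legendre R l).[dot t y]) x =
  - (l * l.+1)%:R * (legendre R l).[dot t x].
Proof.
move=> t1 x1; rewrite lap_zonal //; set s := dot t x.
have := congr1 (horner^~ s) (legendre_ode R l 0).
rewrite derivn0 hornerC !(hornerD, hornerM, hornerN, hornerX, hornerC, horner_natr) natrM => E.
by rewrite -[LHS]addr0 -E; ring.
Qed.

End Zonal.

(** * Projections onto the harmonics of degree l and pointwise convergence of the Laplace series *)

Section Projections.
Variable R : realType.
Local Notation V := 'cV[R]_3.
Implicit Types (U W : V -> R) (v x t : V) (M : 'M[R]_3) (p : {poly R}).

(* The orthogonal projection onto the spherical harmonics of degree l. *)
Definition proj l W t : R :=
  (2 * l + 1)%:R / (4 * pi) * Isph (fun x => (legendre R l).[dot t x] * W x).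

Lemma cnz_proj l W t : cnz W -> cnz (fun x => (legendre R l).[dot t x] * W x).
Proof. by move=> cW; apply: cnzM => //; exact/sm_cnz/sm_zonal. Qed.

Lemma projD l U W t : cnz U -> cnz W ->
  proj l (fun x => U x + W x) t = proj l U t + proj l W t.
Proof.
move=> cU cW; rewrite /proj -mulrDr -ID; try exact: cnz_proj.
by congr (_ * _); apply: eq_I => x _; rewrite mulrDr.
Qed.

Lemma projZ l c W t : cnz W -> proj l (fun x => c * W x) t = c * proj l W t.
Proof.
move=> cW; rewrite /proj mulrCA -(IZ _ (@cnz_proj l W t cW)).
by congr (_ * _); apply: eq_I => x _; rewrite mulrCA.
Qed.

Lemma eq_proj l U W t : (forall x, nsq x = 1 -> U x = W x) -> proj l U t = proj l W t.
Proof. by move=> E; congr (_ * _); apply: eq_I => x x1; rewrite E. Qed.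

Lemma proj_SO3 l W M t : isSO3 M -> sm W ->
  proj l (fun x => W (M *m x)) t = proj l W (M *m t).
Proof.
move=> SM sW; congr (_ * _).
rewrite -[RHS](I_SO3 SM); last by apply: sm_mul => //; exact: sm_zonal.
by apply: eq_I => x _; rewrite dot_orth //; case: SM.
Qed.

Lemma proj_lap l W t : sm W -> nsq t = 1 -> proj l (lap W) t = - (l * l.+1)%:R * proj l W t.
Proof.
move=> sW t1; rewrite /proj -I_lap_sym //; last exact: sm_zonal.
rewrite mulrCA -(IZ _ (@cnz_proj l W t (sm_cnz sW))); congr (_ * _).
by apply: eq_I => x x1; rewrite lap_legendre // mulrA.
Qed.

Lemma SO3_to_pole t : nsq t = 1 -> exists2 M, isSO3 M & t = M *m e3 R.
Proof.
by move=> /SO3_transitive [a [b ->]]; exists (rotz a *m roty b) => //; apply: SO3_mul; exact: SO3_rot3.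
Qed.

(** After a rotation t is the pole, where the kernel depends on b alone and [legendre_L1] applies:
    (2l+1)/(4 pi) times 2 pi times 2/sqrt(2l+1) is sqrt(2l+1). *)
Lemma proj_bound l W t (C : R) : sm W -> nsq t = 1 ->
  (forall x, nsq x = 1 -> `|W x| <= C) -> `|proj l W t| <= Num.sqrt (2 * l + 1)%:R * C.
Proof.
move=> + /SO3_to_pole [M SM ->].
wlog -> : M SM W / M = 1%:M => [H sW WC|].
  rewrite -proj_SO3 // -[e3 R]mul1mx; apply: H => //.
  - by split; rewrite ?trmx1 ?mulmx1 // det1.
  - by apply: sm_orth => //; case: SM.
  - by move=> x x1; apply: WC; rewrite nsq_orth //; case: SM.
rewrite mul1mx => sW WC; have cW := sm_cnz sW.
set s := Num.sqrt _.
have s0 : 0 < s by rewrite sqrtr_gt0 ltr0n addn1.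
have s2 : s ^+ 2 = (2 * l + 1)%:R by rewrite sqr_sqrtr ?ler0n.
have pi0 := @pi_gt0 R.
have C0 : 0 <= C by apply: le_trans (WC _ (nsq_e3 R)).
have cP : continuous (fun b : R => `|(legendre R l).[cos b]|).
  move=> b; apply: (@continuous_comp _ _ _ (fun b : R => (legendre R l).[cos b]) (fun r : R => `|r|)).
    by apply: continuous_comp; [exact: continuous_cos|exact: continuous_horner].
  exact: norm_continuous.
rewrite /proj normrM ger0_norm; last by rewrite divr_ge0 ?ler0n //; lra.
have h : `|Isph (fun x => (legendre R l).[dot (e3 R) x] * W x)| <=
    2 * pi * C * (2 / s).
  apply: (@le_trans _ _ (Isph (fun x => C * `|(legendre R l).[dot (e3 R) x]|))).
    apply: le_normr_I; first exact: cnz_proj.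
      apply: cnzZ; apply: cnz_norm; exact/sm_cnz/sm_zonal.
    by move=> x x1; rewrite normrM mulrC ler_wpM2r // WC.
  rewrite (@I_separate _ _ (cst C) (fun b => `|(legendre R l).[cos b]|)) //.
  - rewrite Int_cst ?subr0 ?(ltW (pi2_gt0 R)) // mulrC mulrC [C * _]mulrC.
    apply: ler_wpM2l; last exact: legendre_L1.
    by rewrite mulr_ge0 //; lra.
  - by move=> b; exact: cst_continuous.
  - by move=> a b; rewrite dot_e3 sph_vec2.
apply: le_trans (ler_wpM2l _ h) _; first by rewrite divr_ge0 ?ler0n //; lra.
rewrite -s2 le_eqVlt; apply/orP; left; apply/eqP; field.
by apply/andP; split; lra.
Qed.

Lemma sin_ge_mul_cos (b : R) : 0 <= b <= pi -> b * cos b <= sin b.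
Proof.
move=> /andP[b0 bpi].
have d (s : R) : is_derive s 1 (fun s => sin s - s * cos s : R) (s * sin s).
  have := is_deriveB (is_derive_sin s) (@is_deriveM _ _ id (@cos R) s 1 _ _ (is_derive_id s 1) (is_derive_cos s)).
  by move=> h; apply: is_derive_eq; rewrite /GRing.scale /=; ring.
have [|c cb E] := @MVT_segment R _ _ 0 b b0 (fun s _ => d s).
  by apply: continuous_subspaceT; exact: is_derive_continuous d.
move: E; rewrite sin0 mul0r subr0 subr0 => E.
move: cb; rewrite in_itv /= => /andP[c0 cb].
suff : 0 <= c * sin c * b by lra.
by rewrite !mulr_ge0 // sin_ge0_pi // c0 (le_trans cb).
Qed.

(** Compares the distance to the nearest pole with [sin]. Near the poles [sin_ge_mul_cos] gives the
    factor 2; the constant 8 comes from the middle range, where pi <= 4 and sin b >= 1/2. *)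
Lemma min_le_sin (b : R) : 0 <= b <= pi -> Num.min b (pi - b) <= 8 * sin b.
Proof.
move=> bpi; have /andP[b0 b1] := bpi; have s0 := sin_ge0_pi bpi.
have pi4 : pi <= 4 :> R by have := @pihalf_lt2 R; lra.
have [c1|c1] := leP (1 / 2) (cos b).
  have := sin_ge_mul_cos bpi => h; rewrite ge_min; apply/orP; left.
  have : b * (1 / 2) <= b * cos b by exact: ler_wpM2l.
  lra.
have [c2|c2] := leP (cos b) (- (1 / 2)).
  have bpi' : 0 <= pi - b <= pi by apply/andP; split; lra.
  have := sin_ge_mul_cos bpi'.
  rewrite cosB sinB cospi sinpi !mul0r addr0 sub0r !mulN1r opprK => h.
  rewrite ge_min; apply/orP; right.
  have : (pi - b) * (1 / 2) <= (pi - b) * - cos b by apply: ler_wpM2l; lra.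
  lra.
rewrite ge_min; apply/orP; left.
have : sin b >= 1 / 2 by have := cos2Dsin2 b; nra.
lra.
Qed.

Lemma Lpol_sm a W : sm W -> sm (Lpol a W).
Proof. by move=> sW; apply: sm_sub; apply: sm_scale; exact: sm_L. Qed.

Lemma is_derive_Lpol a (b : R) W : sm W ->
  is_derive b 1 (fun s => Lpol a W (sph_vec a s)) (Lpol a (Lpol a W) (sph_vec a b)).
Proof.
move=> sW; apply: (is_derive_polar (W := Lpol a W)); apply: sm_diff; last exact: sph_vec_neq0.
exact: Lpol_sm.
Qed.

(** Expansion into four products of cos a and sin a with fixed second-order fields makes the bound
    independent of the azimuth. *)
Lemma Lpol2_bounded W : sm W -> exists2 K : R, 0 <= K &
  forall a x, nsq x = 1 -> `|Lpol a (Lpol a W) x| <= K.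
Proof.
move=> sW.
have B (j k p q : 'I_3) : exists2 K : R, 0 <= K & forall x, nsq x = 1 -> `|L j k (L p q W) x| <= K.
  by apply: sphere_bounded; apply: sm_cnz; do 2 apply: sm_L.
have [K1 K10 H1] := B o2 o0 o2 o0; have [K2 K20 H2] := B o2 o0 o1 o2.
have [K3 K30 H3] := B o1 o2 o2 o0; have [K4 K40 H4] := B o1 o2 o1 o2.
exists (K1 + K2 + K3 + K4); first lra.
move=> a x x1; have x0 := nsq1_neq0 x1.
have E j k : L j k (Lpol a W) x = cos a * L j k (L o2 o0 W) x - sin a * L j k (L o1 o2 W) x.
  have s1 : sm (fun x => cos a * L o2 o0 W x) by apply: sm_scale; exact: sm_L.
  have s2 : sm (fun x => - sin a * L o1 o2 W x) by apply: sm_scale; exact: sm_L.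
  rewrite (@eq_L _ j k _ (fun x => cos a * L o2 o0 W x + - sin a * L o1 o2 W x)) //; last first.
    by move=> y _; rewrite /Lpol mulNr.
  by rewrite LD // !LZ ?mulNr //; exact: sm_L.
rewrite {1}/Lpol !E !mulrBr !mulrA.
have h (u w z k : R) : `|u| <= 1 -> `|w| <= 1 -> `|z| <= k -> `|u * w * z| <= k.
  move=> u1 w1 zk; rewrite !normrM -[leRHS]mul1r; apply: ler_pM => //.
  by rewrite -[leRHS]mul1r; apply: ler_pM.
have c1 := normr_cos_le1 a; have s1 := normr_sin_le1 a.
have g1 := h _ _ _ _ c1 c1 (H1 x x1); have g2 := h _ _ _ _ c1 s1 (H2 x x1).
have g3 := h _ _ _ _ s1 c1 (H3 x x1); have g4 := h _ _ _ _ s1 s1 (H4 x x1).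
move: g1 g2 g3 g4; rewrite !ler_norml => /andP[? ?] /andP[? ?] /andP[? ?] /andP[? ?].
by apply/andP; split; lra.
Qed.

Lemma sph_vec_pole a : sph_vec a 0 = e3 R /\ sph_vec a pi = - e3 R.
Proof.
by split; apply: vec3P; rewrite ?(sph_vec0, sph_vec1, sph_vec2) ?mxE ?(sin0, cos0, sinpi, cospi) /= ?mul0r ?oppr0.
Qed.

(* Invariance under the half-turn about the axis kills the gradient at the poles. *)
Lemma Lpol_pole a W (e : R) : sm W -> e ^+ 2 = 1 ->
  (forall x, x != 0 -> W (rotz pi *m x) = W x) -> Lpol a W (e *: e3 R) = 0.
Proof.
move=> sW e2 WR; set x := e *: e3 R.
have x0 : x != 0.
  by rewrite scaler_eq0 negb_or -nsq_eq0 nsq_e3 oner_eq0 andbT -sqrf_eq0 e2 oner_eq0.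
have [r0 r1 r2] := rotz_vec pi x.
have Rx : rotz pi *m x = x.
  by apply: vec3P; rewrite ?r0 ?r1 ?r2 !mxE /= ?mulr0 ?subrr ?addr0.
have D i : (i == o2) = false -> 'D_(basis3 i) W x = 0.
  move=> io; have E : 'D_(basis3 i) W x = 'D_(- 1 *: basis3 i + 0) W x.
    rewrite -(eq_derive_punctured _ WR) // derive_mulmx Rx; last exact: sm_diff.
    have [k0 k1 k2] := rotz_vec pi (basis3 i : V).
    congr ('D__ W x); apply: vec3P; rewrite ?k0 ?k1 ?k2 !mxE ?cospi ?sinpi ?(eq_sym o2) ?io /=; ring.
  move: E; rewrite derive_lin; last exact: sm_diff.
  by rewrite derive0 addr0 => E; lra.
have z0 : x o0 0 = 0 by rewrite !mxE /= mulr0.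
have z1 : x o1 0 = 0 by rewrite !mxE /= mulr0.
by rewrite /Lpol !LE (D o0) // (D o1) // z0 z1 !(mulr0, mul0r, subrr).
Qed.

(** The polar derivative vanishes at both poles and has a bounded derivative in b, so it is at most
    K times the distance to the nearest pole. *)
Lemma Lpol_le_sin W : sm W -> (forall x, x != 0 -> W (rotz pi *m x) = W x) ->
  exists2 K : R, 0 <= K &
    forall a b : R, 0 <= b <= pi -> `|Lpol a W (sph_vec a b)| <= K * sin b.
Proof.
move=> sW WR; have [K K0 HK] := Lpol2_bounded sW.
exists (8 * K); first lra.
move=> a b; rewrite -[b]/(b : R) => /[dup] bpi /andP[b0 b1].
pose g s := Lpol a W (sph_vec a s).
have d (s : R) := is_derive_Lpol a s sW; have [P0 Ppi] := sph_vec_pole a.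
have cg : continuous g by exact: is_derive_continuous d.
have g0 : g 0 = 0 by rewrite /g P0 -[e3 R]scale1r Lpol_pole ?expr1n.
have gpi : g pi = 0 by rewrite /g Ppi -scaleN1r Lpol_pole ?sqrrN ?expr1n.
have M (s u : R) : s <= u -> `|g u - g s| <= K * (u - s).
  move=> su; have [|c cb ->] := @MVT_segment R g _ s u su (fun s _ => d s).
    exact: continuous_subspaceT.
  rewrite normrM (ger0_norm (x := u - s)) ?subr_ge0 //; apply: ler_wpM2r; first by rewrite subr_ge0.
  by apply: HK; rewrite nsq_sph_vec.
have h1 : `|g b| <= K * b by have := M _ _ b0; rewrite g0 !subr0.
have h2 : `|g b| <= K * (pi - b) by have := M _ _ b1; rewrite gpi sub0r normrN.
rewrite -/(g b); apply: (@le_trans _ _ (K * Num.min b (pi - b))).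
  by rewrite minr_pMr // le_min h1 h2.
by rewrite mulrAC [8 * _ * _]mulrC mulrA -mulrA; apply: ler_wpM2l => //; exact: min_le_sin.
Qed.

Lemma continuous_abs_cos p : continuous (fun b : R => sin b * `|p.[cos b]|).
Proof.
move=> b; apply: (@continuousM _ _ (@sin R) (fun b => `|p.[cos b]|)).
  exact: continuous_sin.
apply: (@continuous_comp _ _ _ (fun b : R => p.[cos b]) (fun r : R => `|r|)).
  by apply: continuous_comp; [exact: continuous_cos|exact: continuous_horner].
exact: norm_continuous.
Qed.

Lemma polint_zonal_parts p W a : sm W ->
  polint (@sin R) (fun x => p^`().[x o2 0] * W x) a =
  p.[1] * W (e3 R) - p.[-1] * W (- e3 R)
  + Int 0 pi (fun b => p.[cos b] * Lpol a W (sph_vec a b)).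
Proof.
move=> sW; have [P0 Ppi] := sph_vec_pole a.
have dP (b : R) : is_derive b 1 (fun b => p.[cos b]) (- (sin b * p^`().[cos b])).
  have h := @is_derive1_comp _ (horner p) (@cos R) b _ _ (is_derive_poly p (cos b)) (is_derive_cos b).
  by apply: is_derive_eq; rewrite mulrN mulrC.
have d (b : R) : is_derive b 1 (fun s => W (sph_vec a s)) (Lpol a W (sph_vec a b)).
  by apply: is_derive_polar; apply: sm_diff => //; exact: sph_vec_neq0.
have cL := @cnz_polar _ _ a (sm_cnz (Lpol_sm a sW)).
have cJ := @J_continuous R p^`().
have cN : continuous (fun b => - (sin b * p^`().[cos b])).
  rewrite (_ : (fun b => _) = fun b => -1 * (sin b * p^`().[cos b])).
    exact: continuousZ_real.
  by apply/funext => b; rewrite mulN1r.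
rewrite (Int_by_parts (@pi_gt0 R) dP cN d cL) P0 Ppi cospi cos0 /polint.
rewrite (@eq_Int _ _ _ (fun b => - _ * _) (fun b => -1 *
  (sin b * (p^`().[sph_vec a b o2 0] * W (sph_vec a b))))); last first.
  by move=> b _; rewrite sph_vec2 mulN1r mulNr mulrA.
rewrite IntZ; first ring.
apply: (@polint_integrand _ _ (fun x => p^`().[x o2 0] * W x)); first exact: continuous_sin.
by apply: sm_cnz; apply: sm_mul => //; apply: sm_horner; exact: sm_coord.
Qed.

(** Integration by parts in b turns p' into values at the poles. The remaining integral has lost the
    weight sin b of the measure; the bound on [Lpol] restores it, so that the L^1 norm m of p
    controls the error. *)
Lemma Isph_zonal_deriv p W (K m : R) : sm W -> 0 <= K ->
  (forall a b : R, 0 <= b <= pi -> `|Lpol a W (sph_vec a b)| <= K * sin b) ->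
  Int 0 pi (fun b => sin b * `|p.[cos b]|) <= m ->
  `|Isph (fun x => p^`().[x o2 0] * W x)
    - 2 * pi * (p.[1] * W (e3 R) - p.[-1] * W (- e3 R))| <= 2 * pi * (K * m).
Proof.
move=> sW K0 HK Hm; set k := p.[1] * _ - _.
pose U x := p^`().[x o2 0] * W x.
have cU : cnz U by apply: sm_cnz; apply: sm_mul => //; apply: sm_horner; exact: sm_coord.
have c1 : continuous (cst (- k) : R -> R) by move=> b; exact: cst_continuous.
have c2 : continuous (cst (K * m) : R -> R) by move=> b; exact: cst_continuous.
have -> : Isph U - 2 * pi * k = Int 0 (2 * pi) (fun a => polint (@sin R) U a + (cst (- k)) a).
  rewrite IntD //; last exact: continuous_polint_sin.
  by rewrite Int_cst ?(ltW (pi2_gt0 R)) // -IsphE; ring.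
have -> : 2 * pi * (K * m) = Int 0 (2 * pi) (cst (K * m)).
  by rewrite Int_cst ?(ltW (pi2_gt0 R)) // subr0 mulrC.
apply: le_normr_Int => //.
  move=> a; apply: (@continuousD _ _ _ (polint (@sin R) U) (cst (- k))); last exact: c1.
  exact: continuous_polint_sin.
move=> a _; rewrite polint_zonal_parts // -/k /cst addrC addKr.
have cp : continuous (fun b : R => K * (sin b * `|p.[cos b]|)).
  exact/continuousZ_real/continuous_abs_cos.
apply: (@le_trans _ _ (Int 0 pi (fun b => K * (sin b * `|p.[cos b]|)))); last first.
  by rewrite IntZ; [exact: ler_wpM2l|exact: continuous_abs_cos].
apply: le_normr_Int => //.
  move=> b; apply: (@continuousM _ _ (fun b => p.[cos b]) (fun b => Lpol a W (sph_vec a b))).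
    by apply: continuous_comp; [exact: continuous_cos|exact: continuous_horner].
  exact: (cnz_polar (sm_cnz (Lpol_sm a sW))).
move=> b b0; rewrite normrM mulrA mulrC.
by apply: ler_wpM2r => //; exact: HK.
Qed.

(** W is replaced by [W2], its average over the half-turn about the axis. This changes neither the
    value at the pole nor integrals against functions of x_2, and it yields the invariance required
    by [Lpol_le_sin]. *)
Lemma proj_sum_pole W : sm W -> exists2 K : R, 0 <= K & forall n,
  `|\sum_(l < n.+1) proj l W (e3 R) - W (e3 R)| <= K / Num.sqrt (2 * n + 1)%:R.
Proof.
move=> sW; pose W2 x := 2^-1 * (W x + W (rotz pi *m x)).
have sWR : sm (fun x => W (rotz pi *m x)) by apply: sm_orth => //; exact: rotz_orth.
have sW2 : sm W2 by apply: sm_scale; exact: sm_add.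
have RR x : rotz pi *m (rotz pi *m x) = x.
  have [h0 h1 h2] := rotz_vec pi (rotz pi *m x); have [k0 k1 k2] := rotz_vec pi x.
  by apply: vec3P; rewrite ?h0 ?h1 ?h2 ?k0 ?k1 ?k2 // cospi sinpi; ring.
have [|K K0 HK] := @Lpol_le_sin W2 sW2.
  by move=> x x0; rewrite /W2 RR addrC.
exists (2 * K); first lra.
move=> n; set s := Num.sqrt _; pose Q := legendre R n.+1 + legendre R n.
have s0 : 0 < s by rewrite sqrtr_gt0 ltr0n addn1.
have Hm : Int 0 pi (fun b => sin b * `|Q.[cos b]|) <= 4 / s.
  have c l := @continuous_abs_cos (legendre R l).
  apply: (@le_trans _ _ (Int 0 pi (fun b => sin b * `|(legendre R n.+1).[cos b]| +
     sin b * `|(legendre R n).[cos b]|))).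
    apply: le_Int; first exact: continuous_abs_cos.
      by move=> b; apply: (@continuousD _ _ _ (fun b => sin b * `|(legendre R n.+1).[cos b]|)
         (fun b => sin b * `|(legendre R n).[cos b]|)); exact: c.
    move=> b b0; rewrite -mulrDr; apply: ler_wpM2l; first exact: sin_ge0_pi.
    by rewrite hornerD; exact: ler_normD.
  rewrite IntD //.
  have h1 := legendre_L1 R n; have h2 := legendre_L1 R n.+1.
  have h3 : 2 / Num.sqrt (2 * n.+1 + 1)%:R <= 2 / s.
    apply: ler_wpM2l => //; rewrite lef_pV2 ?posrE ?sqrtr_gt0 ?ltr0n ?addn1 //.
    by rewrite /s addn1; apply: ler_wsqrtr; rewrite ler_nat ltnS leq_mul2l leqnSn orbT.
  by move: h1 h2 h3; rewrite -/s => h1 h2 h3; lra.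
have := Isph_zonal_deriv sW2 K0 HK Hm.
have W2e : W2 (e3 R) = W (e3 R).
  rewrite /W2 (_ : rotz pi *m e3 R = e3 R); first by field.
  have [k0 k1 k2] := rotz_vec pi (e3 R).
  by apply: vec3P; rewrite ?k0 ?k1 ?k2 // !e3E /=; ring.
(* Adding two consecutive Legendre polynomials cancels the value at -1, hence the contribution of
   the antipode. *)
have [Q1 QN] : Q.[1] = 2 /\ Q.[-1] = 0.
  by rewrite /Q !hornerD !legendre1 !legendreN1 exprS; split; ring.
rewrite Q1 QN W2e mul0r subr0.
have -> : Isph (fun x => Q^`().[x o2 0] * W2 x) = Isph (fun x => Q^`().[x o2 0] * W x).
  pose U x := Q^`().[x o2 0] * W x.
  have sU : sm U by apply: sm_mul => //; apply: sm_horner; exact: sm_coord.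
  rewrite (@eq_I _ _ (fun x => 2^-1 * (U x + U (rotz pi *m x)))); last first.
    by move=> x _; have [_ _ k2] := rotz_vec pi x; rewrite /U /W2 k2; ring.
  have sUR : sm (fun x => U (rotz pi *m x)) by apply: sm_orth => //; exact: rotz_orth.
  have sUU : sm (fun x => U x + U (rotz pi *m x)) by exact: sm_add.
  rewrite (IZ _ (sm_cnz sUU)) (ID (sm_cnz sU) (sm_cnz sUR)) I_rot3 //.
  by rewrite -/U; field.
have -> : \sum_(l < n.+1) proj l W (e3 R) = Isph (fun x => Q^`().[x o2 0] * W x) / (4 * pi).
  pose T (l : nat) x := (2 * l + 1)%:R * ((legendre R l).[dot (e3 R) x] * W x).
  have cT l : cnz (T l) by apply: cnzZ; exact: cnz_proj (sm_cnz sW).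
  have -> : Isph (fun x => Q^`().[x o2 0] * W x) = Isph (fun x => \sum_(l < n.+1) T l x).
    apply: eq_I => x _; rewrite /Q derivD -legendre_sum horner_sum mulr_suml.
    by apply: eq_bigr => l _; rewrite /T dot_e3 hornerM horner_natr mulrA.
  rewrite I_sum; last by move=> l; exact: cT.
  rewrite mulr_suml; apply: eq_bigr => l _.
  by rewrite (IZ _ (cnz_proj (W := W) (sm_cnz sW))) /proj mulrAC.
have pi0 := @pi_gt0 R.
set X := Isph _ => H.
rewrite [X in `|X|](_ : _ = (X - 2 * pi * (2 * W (e3 R))) / (4 * pi)); last first.
  by field; lra.
rewrite normrM [X in _ * X]gtr0_norm ?invr_gt0; last by lra.
rewrite ler_pdivrMr; last by lra.
apply: le_trans H _; rewrite le_eqVlt; apply/orP; left; apply/eqP; field; lra.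
Qed.

Lemma proj_cvg W t : sm W -> nsq t = 1 ->
  (fun n => \sum_(l < n) proj l W t) @ \oo --> W t.
Proof.
move=> sW /SO3_to_pole [M SM ->].
have sWM : sm (fun x => W (M *m x)) by apply: sm_orth => //; case: SM.
have [K K0 HK] := proj_sum_pole sWM.
rewrite -(cvg_shiftS (fun n => \sum_(l < n) proj l W (M *m e3 R))) /=.
apply/cvgrPdist_le => e e0; near=> n.
rewrite distrC; have := HK n.
rewrite (_ : \sum_(l < n.+1) proj l (fun x => W (M *m x)) (e3 R) = \sum_(l < n.+1) proj l W (M *m e3 R));
  last by apply: eq_bigr => l _; exact: proj_SO3.
move=> /le_trans; apply.
have h : (K / e) ^+ 2 < n%:R by near: n; exact: nbhs_infty_gtr.
set s := Num.sqrt _.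
have s0 : 0 < s by rewrite sqrtr_gt0 ltr0n addn1.
have s2 : s ^+ 2 = (2 * n + 1)%:R by rewrite sqr_sqrtr ?ler0n.
rewrite ler_pdivrMr // mulrC -ler_pdivrMr //.
rewrite -(@ler_pXn2r _ 2) ?nnegrE ?divr_ge0 ?(ltW e0) ?(ltW s0) // s2 natrD natrM.
have := ler0n R n; lra.
Unshelve. all: by end_near. Qed.

End Projections.

(** * The resolvent *)

Section Resolvent.
Variable R : realType.
Local Notation V := 'cV[R]_3.
Implicit Types (U W : V -> R) (v x t : V) (M : 'M[R]_3) (C : R).

(* resmul l * sqrt (2l+1), of order l^(-3/2), is dominated by the differences of tele. *)
Definition tele (l : nat) : R := (Num.sqrt l.+1%:R)^-1.

Lemma tele_gt0 l : 0 < tele l.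
Proof. by rewrite invr_gt0 sqrtr_gt0 ltr0n. Qed.

Lemma tele_noninc l : tele l.+1 <= tele l.
Proof. by rewrite lef_pV2 ?posrE ?sqrtr_gt0 ?ltr0n // ler_wsqrtr // ler_nat. Qed.

Lemma tele_cvg0 : tele @ \oo --> (0 : R).
Proof.
apply/cvgrPdist_le => e e0; near=> n.
rewrite sub0r normrN gtr0_norm ?tele_gt0 // /tele.
have h : e^-1 ^+ 2 < n%:R by near: n; exact: nbhs_infty_gtr.
set s := Num.sqrt _.
have s0 : 0 < s by rewrite sqrtr_gt0 ltr0n.
have s2 : s ^+ 2 = n.+1%:R by rewrite sqr_sqrtr ?ler0n.
rewrite -[leRHS]invrK lef_pV2 ?posrE ?invr_gt0 //.
rewrite -(@ler_pXn2r _ 2) ?nnegrE ?invr_ge0 ?(ltW e0) ?(ltW s0) // s2 -natr1; lra.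
Unshelve. all: by end_near. Qed.

Definition resmul (l : nat) : R := ((l * l.+1)%:R + 1)^-1.

Lemma resmul_gt0 l : 0 < resmul l.
Proof. by rewrite invr_gt0; have := ler0n R (l * l.+1); lra. Qed.

(** With r' = sqrt(l+2) the left side is at most (4 / r'^4) (2 r') = 8 / r'^3, while the difference
    1/r - 1/r' = 1/(r r' (r + r')) is at least 1/(2 r'^3). *)
Lemma sqrt_resmul_tele l : resmul l * Num.sqrt (2 * l + 1)%:R <= 16 * (tele l - tele l.+1).
Proof.
rewrite /tele; set r := Num.sqrt l.+1%:R; set r' := Num.sqrt l.+2%:R.
have r0 : 0 < r by rewrite sqrtr_gt0 ltr0n.
have r'0 : 0 < r' by rewrite sqrtr_gt0 ltr0n.
have r2 : r ^+ 2 = l%:R + 1 by rewrite sqr_sqrtr ?ler0n // natr1.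
have r'2 : r' ^+ 2 = l%:R + 2 by rewrite sqr_sqrtr ?ler0n // -addn2 natrD.
have l0 := ler0n R l.
have rr' : r <= r' by rewrite ler_wsqrtr // ler_nat.
have h1 : Num.sqrt (2 * l + 1)%:R <= 2 * r'.
  rewrite -(@ler_pXn2r _ 2) ?nnegrE ?sqrtr_ge0 ?mulr_ge0 ?(ltW r'0) //.
  by rewrite sqr_sqrtr ?ler0n // exprMn r'2 natrD natrM; lra.
have h2 : resmul l <= 4 / r' ^+ 4.
  rewrite /resmul -[leRHS]invrK lef_pV2 ?posrE ?invr_gt0 ?divr_gt0 ?exprn_gt0 //.
  have e4 : r' ^+ 4 = (l%:R + 2) ^+ 2 by rewrite -r'2 -exprM.
  by rewrite invf_div e4 ler_pdivrMr // natrM -(natr1 l); nra.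
have -> : r^-1 - r'^-1 = (r' ^+ 2 - r ^+ 2) / (r * r' * (r + r')).
  by field; rewrite !lt0r_neq0 //; lra.
have -> : r' ^+ 2 - r ^+ 2 = 1 by rewrite r2 r'2; ring.
apply: (@le_trans _ _ (4 / r' ^+ 4 * (2 * r'))).
  by apply: ler_pM => //; rewrite ?(ltW (resmul_gt0 l)) ?sqrtr_ge0.
have -> : 4 / r' ^+ 4 * (2 * r') = 16 * (1 / (r' * r' * (r' + r'))) by field; lra.
apply: ler_wpM2l => //; rewrite !mul1r lef_pV2 ?posrE ?mulr_gt0 ?addr_gt0 //.
apply: ler_pM => //; rewrite ?mulr_ge0 ?addr_ge0 ?(ltW r0) ?(ltW r'0) //.
  by apply: ler_pM => //; exact: ltW.
by rewrite lerD2r.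
Qed.

(** Domination by a telescoping series: it gives convergence together with the explicit tail C *
    [tele] n, uniform in all parameters on which C does not depend. *)
Definition tele_dom C (u : nat -> R) := forall l, `|u l| <= C * (tele l - tele l.+1).

Lemma tele_dom_ge0 C u : tele_dom C u -> 0 <= C.
Proof.
move=> /(_ 0%N) H; have {H} := le_trans (normr_ge0 _) H.
rewrite /tele sqrtr1 invr1 pmulr_lge0 // subr_gt0 invf_lt1 ?sqrtr_gt0 ?ltr0n //.
by rewrite -[ltLHS]sqrtr1 ltr_sqrt ?ltr1n ?ltr0n.
Qed.

Lemma tele_dom_cauchy C u n m : tele_dom C u -> (n <= m)%N ->
  `|\sum_(l < m) u l - \sum_(l < n) u l| <= C * tele n.
Proof.
move=> uC nm; have C0 := tele_dom_ge0 uC; rewrite -(subnKC nm); move: (m - n)%N => k.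
suff : `|\sum_(l < n + k) u l - \sum_(l < n) u l| <= C * (tele n - tele (n + k)).
  move=> /le_trans; apply; apply: ler_wpM2l => //; have := tele_gt0 (n + k); lra.
elim: k => [|k IH]; first by rewrite addn0 !subrr normr0 mulr0.
rewrite addnS big_ord_recr /= addrAC; apply: le_trans (ler_normD _ _) _.
have -> : C * (tele n - tele (n + k).+1) =
  C * (tele n - tele (n + k)) + C * (tele (n + k) - tele (n + k).+1) by ring.
by apply: lerD.
Qed.

Lemma tele_dom_cvg C u : tele_dom C u -> cvgn (fun n => \sum_(l < n) u l).
Proof.
move=> uC; apply: cauchy_cvg; apply/cauchy_ballP => e e0.
have [N HN] : exists N, C * tele N < e / 2.
  have h : (fun n => C * tele n) @ \oo --> (C * 0 : R).
    by apply: cvgMr; exact: tele_cvg0.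
  have /= : \forall n \near \oo, C * tele n < e / 2.
    by apply: (cvgr_lt _ h); rewrite mulr0; lra.
  by move=> [N _ HN]; exists N; apply: HN => /=.
near_simpl; near=> n m.
rewrite /ball /=.
have hn : `|\sum_(l < n) u l - \sum_(l < N) u l| <= C * tele N.
  by apply: tele_dom_cauchy => //; near: n; exact: nbhs_infty_ge.
have hm : `|\sum_(l < m) u l - \sum_(l < N) u l| <= C * tele N.
  by apply: tele_dom_cauchy => //; near: m; exact: nbhs_infty_ge.
move: hn hm; rewrite !ler_norml ltr_norml => /andP[? ?] /andP[? ?].
by apply/andP; split; lra.
Unshelve. all: by end_near. Qed.

Lemma tele_dom_tail C u (a : R) n : tele_dom C u -> (fun n => \sum_(l < n) u l) @ \oo --> a ->
  `|a - \sum_(l < n) u l| <= C * tele n.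
Proof.
move=> uC ua.
have h : (fun m => `|\sum_(l < m) u l - \sum_(l < n) u l|) @ \oo --> `|a - \sum_(l < n) u l|.
  by apply: cvg_norm; apply: cvgB => //; exact: cvg_cst.
have e := cvg_lim (@Rhausdorff R) h; rewrite -e.
apply: limr_le; first by apply/cvg_ex; eexists; exact: h.
by near=> m; apply: tele_dom_cauchy => //; near: m; exact: nbhs_infty_ge.
Unshelve. all: by end_near. Qed.

Definition Tn n W t : R := \sum_(l < n) resmul l * proj l W t.

Definition T W t : R := limn (fun n => Tn n W t).

Lemma T_dom W t C : sm W -> nsq t = 1 -> (forall x, nsq x = 1 -> `|W x| <= C) ->
  tele_dom (16 * C) (fun l => resmul l * proj l W t).
Proof.
move=> sW t1 HC l; have C0 : 0 <= C by apply: le_trans (HC t t1).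
rewrite normrM gtr0_norm ?resmul_gt0 //.
apply: (@le_trans _ _ (resmul l * (Num.sqrt (2 * l + 1)%:R * C))).
  by apply: ler_wpM2l; [exact: ltW (resmul_gt0 _)|exact: proj_bound].
rewrite mulrA [leLHS]mulrC [16 * C]mulrC -[leRHS]mulrA; apply: ler_wpM2l => //.
exact: sqrt_resmul_tele.
Qed.

Lemma T_cvg W t : sm W -> nsq t = 1 -> (fun n => Tn n W t) @ \oo --> T W t.
Proof.
move=> sW t1; have [C C0 HC] := sphere_bounded (sm_cnz sW).
exact: (tele_dom_cvg (T_dom sW t1 HC)).
Qed.

Lemma cvgn_unique (u : nat -> R) (a b : R) : u @ \oo --> a -> u @ \oo --> b -> a = b.
Proof. by move=> ua ub; apply: (cvg_unique _ ua ub). Qed.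

Lemma T_lim W t (a : R) : sm W -> nsq t = 1 -> (fun n => Tn n W t) @ \oo --> a -> T W t = a.
Proof. by move=> sW t1 h; exact: cvgn_unique (T_cvg sW t1) h. Qed.

Lemma T_tail n W t C : sm W -> nsq t = 1 -> (forall x, nsq x = 1 -> `|W x| <= C) ->
  `|T W t - Tn n W t| <= 16 * C * tele n.
Proof. by move=> sW t1 HC; exact: tele_dom_tail (T_dom sW t1 HC) (T_cvg sW t1). Qed.

Lemma T_bound W t C : sm W -> nsq t = 1 -> (forall x, nsq x = 1 -> `|W x| <= C) ->
  `|T W t| <= 16 * C.
Proof.
move=> sW t1 HC; have := T_tail 0 sW t1 HC.
by rewrite /Tn big_ord0 subr0 /tele sqrtr1 invr1 mulr1.
Qed.

Lemma TD U W t : sm U -> sm W -> nsq t = 1 -> T (fun x => U x + W x) t = T U t + T W t.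
Proof.
move=> sU sW t1; apply: T_lim => //; first exact: sm_add.
rewrite (_ : (fun n => _) = (fun n => Tn n U t + Tn n W t)); last first.
  apply/funext => n; rewrite /Tn -big_split; apply: eq_bigr => l _ /=.
  by rewrite projD ?mulrDr //; exact: sm_cnz.
by apply: cvgD; exact: T_cvg.
Qed.

Lemma TZ c W t : sm W -> nsq t = 1 -> T (fun x => c * W x) t = c * T W t.
Proof.
move=> sW t1; apply: T_lim => //; first exact: sm_scale.
rewrite (_ : (fun n => _) = (fun n => c * Tn n W t)); last first.
  apply/funext => n; rewrite /Tn mulr_sumr; apply: eq_bigr => l _.
  by rewrite projZ 1?mulrCA //; exact: sm_cnz.
by apply: cvgMr; exact: T_cvg.
Qed.

Lemma eq_T U W t : (forall x, nsq x = 1 -> U x = W x) -> T U t = T W t.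
Proof.
move=> E; congr (limn _); apply/funext => n; apply: eq_bigr => l _.
by rewrite (eq_proj _ _ E).
Qed.

Lemma T_SO3 W M t : isSO3 M -> sm W -> T (fun x => W (M *m x)) t = T W (M *m t).
Proof.
move=> SM sW; congr (limn _); apply/funext => n; apply: eq_bigr => l _.
by rewrite proj_SO3.
Qed.

Lemma proj_resolvent l W t : sm W -> nsq t = 1 ->
  proj l W t = resmul l * proj l (fun x => W x - lap W x) t.
Proof.
move=> sW t1; have sL := sm_lap sW; have cL := sm_cnz sL.
have -> : proj l (fun x => W x - lap W x) t = proj l W t + -1 * proj l (lap W) t.
  rewrite -projZ // -projD //; [|exact: sm_cnz|exact: cnzZ].
  by apply: eq_proj => x _; rewrite mulN1r.
rewrite proj_lap // /resmul; have := ler0n R (l * l.+1) => h; field; lra.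
Qed.

(** The degree l part of W - lap W is 1 + l(l+1) times that of W, so the partial sums are those of
    the Laplace series of W. *)
Lemma T_inverse W t : sm W -> nsq t = 1 -> T (fun x => W x - lap W x) t = W t.
Proof.
move=> sW t1; apply: T_lim => //; first by apply: sm_sub => //; exact: sm_lap.
rewrite (_ : (fun n => _) = (fun n => \sum_(l < n) proj l W t)); first exact: proj_cvg.
by apply/funext => n; apply: eq_bigr => l _; rewrite -proj_resolvent.
Qed.

(** The Laplace series of W is the series of T at W - lap W, whose tail is uniform in t; pointwise
    convergence serves only to identify the sum. *)
Lemma proj_sum_uniform W : sm W -> exists2 C, 0 <= C & forall n t, nsq t = 1 ->
  `|W t - \sum_(l < n) proj l W t| <= C * tele n.
Proof.
move=> sW; have s1 : sm (fun x => W x - lap W x) by apply: sm_sub => //; exact: sm_lap.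
have [C C0 HC] := sphere_bounded (sm_cnz s1).
exists (16 * C); first lra.
move=> n t t1; have := T_tail n s1 t1 HC; rewrite T_inverse //.
rewrite (_ : Tn _ _ _ = \sum_(l < n) proj l W t) //.
by apply: eq_bigr => l _; rewrite -proj_resolvent.
Qed.

Lemma proj_L j k l W t : sm W -> proj l (L j k W) t =
  - ((2 * l + 1)%:R / (4 * pi) * Isph (fun x =>
     (x j 0 * t k 0 - x k 0 * t j 0) * ((legendre R l)^`().[dot t x] * W x))).
Proof.
move=> sW; rewrite /proj -mulrN; congr (_ * _); apply/eqP; rewrite -eqr_oppLR; apply/eqP.
rewrite -I_L_parts //; last exact: sm_zonal.
apply: eq_I => x x1; rewrite L_horner ?L_dot; [ring|exact: sm_dot|exact: nsq1_neq0].
Qed.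

(* The three fields t_i L_jk sum to zero over cyclic permutations of (i, j, k). *)
Lemma proj_L_cyclic i j k l W t : sm W -> t i 0 * proj l (L j k W) t
  + t j 0 * proj l (L k i W) t + t k 0 * proj l (L i j W) t = 0.
Proof.
move=> sW; rewrite !proj_L //; set c := _ / _.
pose F p q x := (x p 0 * t q 0 - x q 0 * t p 0) * ((legendre R l)^`().[dot t x] * W x).
have cF p q : cnz (F p q).
  apply: sm_cnz; apply: sm_mul; last by apply: sm_mul => //; exact: sm_zonal.
  apply: (@sm_eq _ (fun x => t q 0 * x p 0 - t p 0 * x q 0)).
    by apply: sm_sub; apply: sm_scale; exact: sm_coord.
  by move=> x _; ring.
rewrite -/(F j k) -/(F k i) -/(F i j).
have E : t i 0 * Isph (F j k) + t j 0 * Isph (F k i) + t k 0 * Isph (F i j) = 0.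
  have cZ a p q : cnz (fun x => a * F p q x) by exact: cnzZ.
  rewrite -(IZ _ (cF j k)) -(IZ _ (cF k i)) -(IZ _ (cF i j)).
  rewrite -(ID (cZ (t i 0) j k) (cZ (t j 0) k i)).
  rewrite -(ID (cnzD (cZ (t i 0) j k) (cZ (t j 0) k i)) (cZ (t k 0) i j)).
  rewrite (@eq_I _ _ (cst 0)) ?I_cst ?mulr0 // => x _.
  by rewrite /F /cst; ring.
rewrite [LHS](_ : _ = - c * (t i 0 * Isph (F j k) + t j 0 * Isph (F k i) + t k 0 * Isph (F i j))).
  by rewrite E mulr0.
ring.
Qed.

(** The vector of the three T (L_jk W) is orthogonal to t, as the angular momentum of a function
    must be. [L_Text] deduces from this that L_jk commutes with T. *)
Lemma T_L_cyclic i j k W t : sm W -> nsq t = 1 -> t i 0 * T (L j k W) t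
  + t j 0 * T (L k i W) t + t k 0 * T (L i j W) t = 0.
Proof.
move=> sW t1; have sL p q := sm_L p q sW.
have h : (fun n => t i 0 * Tn n (L j k W) t + t j 0 * Tn n (L k i W) t + t k 0 * Tn n (L i j W) t) @ \oo
   --> t i 0 * T (L j k W) t + t j 0 * T (L k i W) t + t k 0 * T (L i j W) t.
  by apply: cvgD; [apply: cvgD|]; apply: cvgMr; exact: T_cvg.
apply: (cvgn_unique h).
rewrite (_ : (fun n => _) = cst 0); first exact: cvg_cst.
apply/funext => n; rewrite /Tn !mulr_sumr -!big_split /= big1 // => l _.
rewrite [LHS](_ : _ = resmul l * (t i 0 * proj l (L j k W) t
  + t j 0 * proj l (L k i W) t + t k 0 * proj l (L i j W) t)); last by ring.
by rewrite proj_L_cyclic ?mulr0.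
Qed.

End Resolvent.

(** * First-order expansion of T W along rotations *)

Section Taylor.
Variable R : realType.
Local Notation V := 'cV[R]_3.
Implicit Types (U W : V -> R) (v x t z d y : V) (M A B : 'M[R]_3) (C r : R).

Lemma dot_sqr_le x y : dot x y ^+ 2 <= nsq x * nsq y.
Proof.
rewrite !nsqE dotE -subr_ge0.
rewrite [X in 0 <= X](_ : _ = (x o0 0 * y o1 0 - x o1 0 * y o0 0) ^+ 2 +
  (x o1 0 * y o2 0 - x o2 0 * y o1 0) ^+ 2 + (x o2 0 * y o0 0 - x o0 0 * y o2 0) ^+ 2); last by ring.
by rewrite !addr_ge0 // sqr_ge0.
Qed.

Lemma nsqD x y : nsq (x + y) = nsq x + 2 * dot x y + nsq y.
Proof. by rewrite !nsqE dotE !mxE; ring. Qed.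

Lemma nsqZ (s : R) x : nsq (s *: x) = s ^+ 2 * nsq x.
Proof. by rewrite !nsqE !mxE; ring. Qed.

Lemma dotZr (s : R) x y : dot x (s *: y) = s * dot x y.
Proof. by rewrite !dotE !mxE; ring. Qed.

Lemma shell_segment z d (s : R) : nsq z = 1 -> nsq d <= 1 / 4 -> 0 <= s <= 1 ->
  1 / 4 <= nsq (z + s *: d) <= 4.
Proof.
move=> z1 d4 /andP[s0 s1]; have := dot_sqr_le z d; rewrite z1 mul1r => h.
rewrite nsqD nsqZ dotZr z1; set p := dot z d in h *; set q := nsq d in d4 h *.
have p1 : -(1 / 2) <= p <= 1 / 2 by apply/andP; split; nra.
move: p1 => /andP[pl pr].
have q0 : 0 <= q by apply: le_trans h; exact: sqr_ge0.
have sp : -(1 / 2) <= s * p <= 1 / 2 by apply/andP; split; nra.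
move: sp => /andP[spl spr].
have h2 : (s * p) ^+ 2 <= s ^+ 2 * q by rewrite exprMn ler_wpM2l ?sqr_ge0.
have h3 : s ^+ 2 * q <= 1 / 4 by nra.
by apply/andP; split; nra.
Qed.

Lemma normr_coord_le1 x i : nsq x = 1 -> `|x i 0| <= 1.
Proof.
move=> x1; have := coord_le_nsq x i; rewrite x1 => h.
by rewrite -(@ler_pXn2r _ 2) ?nnegrE // expr1n.
Qed.

(** Two applications of the mean value theorem along the segment from z to z + d. The constant
    bounds the sum of all second partial derivatives on the shell, hence does not depend on z. *)
Lemma taylor2 W : sm W -> exists2 C, 0 <= C & forall z d, nsq z = 1 -> nsq d <= 1 / 4 ->
  `|W (z + d) - W z - 'D_d W z| <= C * nsq d.
Proof.
move=> sW.
pose S (p : 'I_3 * 'I_3) x := 'D_(basis3 p.1) (fun y => 'D_(basis3 p.2) W y) x.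
have sS p : sm (S p) by do 2 apply: sm_derive.
have [C C0 HC] : exists2 C, 0 <= C & forall x, 1 / 4 <= nsq x <= 4 ->
    `|\sum_(p <- enum {: 'I_3 * 'I_3}) `|S p x| | <= C.
  by apply: shell_bounded; apply: cnz_sum => p; apply: cnz_norm; exact: sm_cnz.
exists C => // z d z1 d4.
pose g s := z + s *: d.
have g_ne0 (s : R) : 0 <= s <= 1 -> g s != 0.
  move=> s01; rewrite -nsq_eq0; have /andP[h _] := shell_segment z1 d4 s01.
  by apply/eqP => e; move: h; rewrite e; lra.
have dg (U : V -> R) (s : R) : 0 <= s <= 1 -> sm U -> is_derive s 1 (fun s => U (g s)) ('D_d U (g s)).
  move=> s01 sU; apply: is_derive_path; last by apply: sm_diff => //; exact: g_ne0.
  move=> i; rewrite (_ : (fun s => _) = (fun s : R => z i 0 + s * d i 0)); last first.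
    by apply/funext => u; rewrite !mxE.
  by apply: is_derive_eq; rewrite /GRing.scale /=; ring.
have sD := sm_derive d sW.
have E2 x : x != 0 -> 'D_d (fun y => 'D_d W y) x =
    \sum_i d i 0 * \sum_j d j 0 * S (i, j) x.
  move=> x0; rewrite derive_basis; last exact: sm_diff.
  apply: eq_bigr => i _; congr (_ * _).
  have sj j : sm (fun y => d j 0 * 'D_(basis3 j) W y) by apply: sm_scale; exact: sm_derive.
  rewrite (@eq_derive_punctured _ _ (fun y => \sum_j d j 0 * 'D_(basis3 j) W y)) //; last first.
    by move=> y y0; rewrite derive_basis //; exact: sm_diff.
  rewrite (_ : (fun y => _) = \sum_j (fun y => d j 0 * 'D_(basis3 j) W y)); last first.
    by apply/funext => y; rewrite fct_sumE.
  rewrite derive_sum; last by move=> j; exact: sm_derivable.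
  apply: eq_bigr => j _.
  rewrite (_ : (fun y => d j 0 * _) = d j 0 \*: (fun y => 'D_(basis3 j) W y)) //.
  by rewrite deriveZ //; apply: sm_derivable => //; exact: sm_derive.
have B2 x : 1 / 4 <= nsq x <= 4 -> `|'D_d (fun y => 'D_d W y) x| <= C * nsq d.
  move=> x4; have x0 : x != 0.
    by rewrite -nsq_eq0; apply/eqP => e; move: x4; rewrite e => /andP[]; lra.
  rewrite E2 //; under eq_bigr do rewrite mulr_sumr.
  rewrite pair_big /= -big_enum /=.
  apply: le_trans (ler_norm_sum _ _ _) _.
  apply: (@le_trans _ _ (\sum_(p <- enum {: 'I_3 * 'I_3}) nsq d * `|S p x|)).
    apply: ler_sum => -[i j] _ /=; rewrite mulrA normrM; apply: ler_wpM2r => //.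
    rewrite normrM.
    have hi := coord_le_nsq d i; have hj := coord_le_nsq d j.
    have := sqr_ge0 (`|d i 0| - `|d j 0|); nra.
  rewrite -mulr_sumr mulrC; apply: ler_wpM2r; first exact: nsq_ge0.
  by apply: le_trans (HC x x4); exact: ler_norm.
have g0 : g 0 = z by rewrite /g scale0r addr0.
have g1 : g 1 = z + d by rewrite /g scale1r.
have in01 (s : R) : s \in `]0, 1[ -> 0 <= s <= 1.
  by rewrite in_itv /= => /andP[a b]; rewrite !ltW.
have within (U : V -> R) (a b : R) : sm U -> 0 <= a -> b <= 1 -> {within `[a, b], continuous (fun s => U (g s))}.
  move=> sU a0 b1; apply: continuous_in_subspaceT => s; rewrite inE /= in_itv /= => /andP[as_ sb].
  apply: differentiable_continuous; apply/derivable1_diffP.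
  by have [] := dg U s _ sU; rewrite ?(le_trans a0 as_) ?(le_trans sb b1).
have [c c01 Ec] := @MVT R _ _ 0 1 ltr01 (fun s s01 => dg W s (in01 s s01) sW) (within W 0 1 sW (lexx _) (lexx _)).
have /andP[c0 c1] := in01 c c01.
have [|u u01 Eu] := @MVT_segment R (fun s => 'D_d W (g s))
  (fun s => 'D_d (fun y => 'D_d W y) (g s)) 0 c c0 _ (within _ 0 c sD (lexx _) c1).
  move=> s; rewrite in_itv /= => /andP[s0 sc]; apply: dg => //.
  by rewrite (ltW s0) /= ltW // (lt_le_trans sc).
move: Ec Eu; rewrite g0 g1 !subr0 mulr1 => -> ->.
rewrite normrM (ger0_norm c0) -[leRHS]mulr1; apply: ler_pM => //.
apply: B2; apply: shell_segment => //; move: u01; rewrite in_itv /= => /andP[-> uc] /=.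
exact: le_trans c1.
Qed.

Lemma sm_linear_field A W : sm W -> sm (fun x => 'D_(A *m x) W x).
Proof.
move=> sW.
have H i : sm (fun x => (A *m x) i 0 * 'D_(basis3 i) W x).
  apply: sm_mul; last exact: sm_derive.
  apply: (@sm_eq _ (fun x => \sum_j A i j * x j 0)); last by move=> x _; rewrite mxE.
  by apply: sm_sum => j; apply: sm_scale; exact: sm_coord.
apply: (sm_eq (sm_sum _ _ H)) => x x0; rewrite derive_basis //.
exact: sm_diff.
Qed.

Lemma mulmx_entry_bound A x i r : (forall p q, `|A p q| <= r) -> nsq x = 1 ->
  `|(A *m x) i 0| <= 3 * r.
Proof.
move=> Ar x1; rewrite mxE sum_ord3.
have h j : `|A i j * x j 0| <= r.
  by rewrite normrM -[r]mulr1; apply: ler_pM => //; exact: normr_coord_le1.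
have := h o0; have := h o1; have := h o2; rewrite !ler_norml.
by move=> /andP[? ?] /andP[? ?] /andP[? ?]; apply/andP; split; lra.
Qed.

(** The increment of T W is T of the increment of W, so the Taylor remainder is estimated inside T
    by [T_bound]. *)
Lemma T_near W : sm W -> exists2 C, 0 <= C & forall B r t, isSO3 (1%:M + B) ->
  (forall i j, `|B i j| <= r) -> r <= 1 / 20 -> nsq t = 1 ->
  `|T W ((1%:M + B) *m t) - T W t - T (fun x => 'D_(B *m x) W x) t| <= C * r ^+ 2.
Proof.
move=> sW; have [C C0 HC] := taylor2 sW.
exists (16 * (27 * C)); first lra.
move=> B r t SB Br r20 t1.
have r0 : 0 <= r by apply: le_trans (Br o0 o0).
have sWM : sm (fun x => W ((1%:M + B) *m x)) by apply: sm_orth => //; case: SB.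
have sN : sm (fun x => - W x) by exact: sm_opp.
have sf := sm_linear_field B sW; have sfN := sm_opp sf.
rewrite -T_SO3 //.
have -> : T (fun x => W ((1%:M + B) *m x)) t - T W t - T (fun x => 'D_(B *m x) W x) t =
    T (fun x => W ((1%:M + B) *m x) + -1 * W x + -1 * 'D_(B *m x) W x) t.
  have s1 := sm_scale (-1) sW; have s2 := sm_scale (-1) sf.
  by rewrite !TD // ?TZ ?mulN1r //; exact: sm_add.
rewrite -mulrA; apply: T_bound => //.
  by apply: sm_add; [apply: sm_add|]; rewrite //; exact: sm_scale.
move=> x x1; rewrite !mulN1r mulmxDl mul1mx.
have hB i := mulmx_entry_bound i Br x1.
(* Three coordinates of size at most 3 r. For r <= 1/20 this stays below the 1/4 required by
   [taylor2]. *)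
have n1 : nsq (B *m x) <= 27 * r ^+ 2.
  have h i : (B *m x) i 0 ^+ 2 <= 9 * r ^+ 2.
    have := hB i; rewrite -(@ler_pXn2r _ 2) ?nnegrE ?mulr_ge0 // real_normK ?num_real //.
    by rewrite exprMn => h; apply: le_trans h _; lra.
  by rewrite nsqE; have := h o0; have := h o1; have := h o2; lra.
apply: le_trans (HC x (B *m x) x1 _) _; first nra.
by have := ler_wpM2l C0 n1; lra.
Qed.

Lemma T_sum (J : finType) (c : J -> R) (F : J -> V -> R) t : (forall j, sm (F j)) ->
  nsq t = 1 -> T (fun x => \sum_j c j * F j x) t = \sum_j c j * T (F j) t.
Proof.
move=> sF t1; rewrite -big_enum /= (_ : (fun x => _) = fun x => \sum_(j <- enum J) c j * F j x); last first.
  by apply/funext => x; rewrite big_enum.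
elim: (enum J) => [|j s IH].
  rewrite big_nil (@eq_T _ _ (fun x => 0 * cst 0 x)) ?TZ ?mul0r //; first exact: sm_cst.
  by move=> x _; rewrite big_nil mul0r.
rewrite big_cons -IH -(TZ _ (sF j)) // -TD //; first last.
- by apply: sm_sum => i; exact: sm_scale.
- exact: sm_scale.
by apply: eq_T => x _; rewrite big_cons.
Qed.

(** The Cayley-Hamilton identity of a skew matrix. *)
Lemma skew_cube A : A^T = - A ->
  A *m A *m A = - (A o0 o1 ^+ 2 + A o1 o2 ^+ 2 + A o2 o0 ^+ 2) *: A.
Proof.
move=> AT; have S i j : A j i = - A i j.
  by have := congr1 (fun B : 'M[R]_3 => B i j) AT; rewrite !mxE.
have D i : A i i = 0 by have := S i i; lra.
apply/matrixP => i j; rewrite !mxE sum_ord3 !mxE !sum_ord3.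
case: (ord3P i) => ->; case: (ord3P j) => ->.
all: rewrite !D (S o0 o1) (S o1 o2) (S o2 o0); ring.
Qed.

(* The rotation in the plane of [y0] and [y] taking [y0] to [y]. *)
Definition planar y0 y : 'M[R]_3 := \matrix_(i, j) (y i 0 * y0 j 0 - y0 i 0 * y j 0).

(** Rodrigues' formula minus the identity: for unit vectors [planar] is sin theta times the unit
    generator, cos theta is [dot y0 y], and (1 - cos) / sin^2 = 1 / (1 + cos). No angle has to be
    chosen. *)
Definition moving y0 y : 'M[R]_3 :=
  planar y0 y + (1 + dot y0 y)^-1 *: (planar y0 y *m planar y0 y).

Lemma planar_skew y0 y : (planar y0 y)^T = - planar y0 y.
Proof. by apply/matrixP => i j; rewrite !mxE; ring. Qed.

Lemma planar_mul y0 y x : planar y0 y *m x = dot y0 x *: y - dot y x *: y0.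
Proof.
apply/matrixP => i j; rewrite ord1 !mxE sum_ord3 !mxE !dotE; ring.
Qed.

Lemma planar_derive y0 y x W : differentiable W x ->
  'D_(planar y0 y *m x) W x = \sum_i \sum_j y0 i 0 * y j 0 * L i j W x.
Proof.
move=> dW; rewrite derive_basis //.
have H (a b c f : 'I_3 -> R) : \sum_i ((\sum_k a k * c k) * b i - (\sum_k b k * c k) * a i) * f i =
    \sum_i \sum_j a i * b j * (c i * f j - c j * f i).
  by rewrite !sum_ord3; ring.
transitivity (\sum_i \sum_j y0 i 0 * y j 0 *
   (x i 0 * 'D_(basis3 j) W x - x j 0 * 'D_(basis3 i) W x)).
  rewrite -(H (fun i => y0 i 0) (fun i => y i 0) (fun i => x i 0)).
  by apply: eq_bigr => i _; rewrite planar_mul !mxE.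
by apply: eq_bigr => i _; apply: eq_bigr => j _; rewrite LE.
Qed.

Lemma moving_SO3 y0 y : nsq y0 = 1 -> nsq y = 1 -> 1 + dot y0 y != 0 ->
  isSO3 (1%:M + moving y0 y).
Proof.
move=> h0 h1; set c := dot y0 y => c1; set k := (1 + c)^-1.
set A := planar y0 y; have AT : A^T = - A := planar_skew y0 y.
have kc : k * (1 + c) = 1 by rewrite mulVf.
pose n := A o0 o1 ^+ 2 + A o1 o2 ^+ 2 + A o2 o0 ^+ 2.
have nE : n = 1 - c ^+ 2.
  transitivity (nsq y0 * nsq y - c ^+ 2); last by rewrite h0 h1 mulr1.
  by rewrite /n /A !mxE !nsqE /c dotE; ring.
(* With n = sin^2 and k = 1/(1 + cos), this one relation gives both orthogonality and the
   determinant. *)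
have kn : k ^+ 2 * n = 2 * k - 1.
  rewrite nE (_ : k ^+ 2 * (1 - c ^+ 2) = (k * (1 + c)) * (2 * k - k * (1 + c))); last by ring.
  by rewrite kc mul1r.
have A3 : A *m A *m A = - n *: A by exact: skew_cube.
rewrite /moving -/A -/c -/k addrA; split.
  have A3' : A *m (A *m A) = - n *: A by rewrite mulmxA.
  have A4 : A *m A *m (A *m A) = - n *: (A *m A) by rewrite mulmxA A3 -scalemxAl.
  rewrite !linearD /= !linearZ /= trmx1 trmx_mul AT mulNmx mulmxN opprK.
  rewrite !(mulmxDl, mulmxDr) -!(scalemxAl, scalemxAr) !(mul1mx, mulmx1).
  rewrite ?(mulNmx, mulmxN) A4 A3 A3'.
  move: (A *m A) => A2; apply/matrixP => i j; rewrite !mxE.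
  move: (A i j) (A2 i j) ((i == j)%:R : R) => y1 y2 y3.
  have e : k * n * k = 2 * k - 1 by rewrite -kn; ring.
  rewrite [LHS](_ : _ = y3 + (2 * k - 1 - k * n * k) * y2); last by ring.
  by rewrite e subrr mul0r addr0.
have := det_skew 1 k AT; rewrite scale1r -/A -/n => ->.
rewrite [LHS](_ : _ = 1 - 2 * (k * n) + (k ^+ 2 * n) * n + n); last by ring.
by rewrite kn; ring.
Qed.

Lemma moving_mul y0 y : nsq y0 = 1 -> nsq y = 1 -> 1 + dot y0 y != 0 ->
  (1%:M + moving y0 y) *m y0 = y.
Proof.
move=> h0 h1; rewrite /moving; set c := dot y0 y => c1.
rewrite !mulmxDl mul1mx -scalemxAl -mulmxA !planar_mul -!nsq_dot h0 scale1r.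
rewrite [dot y y0]dotC -/c.
have E : y - c *: y0 = - c *: y0 + y by rewrite addrC scaleNr.
have e1 : dot y0 (y - c *: y0) = 0 by rewrite E dot_lin -nsq_dot h0 mulr1 addNr.
have e2 : dot y (y - c *: y0) = 1 - c ^+ 2.
  by rewrite E dot_lin -nsq_dot h1 [dot y y0]dotC -/c; ring.
rewrite e1 e2; apply/matrixP => i j; rewrite !mxE; field.
exact: c1.
Qed.

Lemma nsq_le_coord x r : (forall i, `|x i 0| <= r) -> nsq x <= 3 * r ^+ 2.
Proof.
move=> H; have r0 : 0 <= r by apply: le_trans (H o0).
have h i : x i 0 ^+ 2 <= r ^+ 2.
  by have := H i; rewrite -(@ler_pXn2r _ 2) ?nnegrE // real_normK ?num_real.
by rewrite nsqE; have := h o0; have := h o1; have := h o2; lra.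
Qed.

(* T commutes with rotations, so T W y - T W y0 = T (W o M - W) y0 for the rotation M
   moving y0 to y; a Taylor expansion of W in M gives the derivative of T W. *)
Lemma T_move W : sm W -> exists2 C, 0 <= C & forall y0 y r, nsq y0 = 1 -> nsq y = 1 ->
  (forall i, `|(y - y0) i 0| <= r) -> r <= 1 / 100 ->
  `|T W y - T W y0 - \sum_(p : 'I_3 * 'I_3) (y0 p.1 0 * y p.2 0) * T (L p.1 p.2 W) y0| <= C * r ^+ 2.
Proof.
move=> sW; have [C1 C10 H1] := T_near sW.
have [C2 C20 H2] : exists2 C, 0 <= C & forall x, nsq x = 1 ->
    `|\sum_(p <- enum 'I_3) `|'D_(basis3 p) W x| | <= C.
  by apply: sphere_bounded; apply: cnz_sum => p; apply: cnz_norm; exact/sm_cnz/sm_derive.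
exists (9 * C1 + 16 * (36 * C2)); first lra.
move=> y0 y r h0 h1 yr r100.
have r0 : 0 <= r by apply: le_trans (yr o0).
have nh := nsq_le_coord yr.
set c := dot y0 y.
(* As |y - y0|^2 = 2 - 2 c is at most 3 r^2, the two points are far from antipodal and 1/(1 + c)
   stays bounded. *)
have c12 : 1 / 2 <= c.
  have e : nsq (y - y0) = 2 - 2 * c.
    by rewrite -scaleN1r nsqD nsqZ dotZr h0 h1 [dot y y0]dotC -/c; ring.
  by move: nh; rewrite e; nra.
have c1 : 1 + c != 0 by rewrite lt0r_neq0 //; lra.
pose k := (1 + c)^-1; pose A := planar y0 y; pose B := moving y0 y.
have k01 : 0 <= k <= 1.
  have k0 : 0 < k by rewrite invr_gt0; lra.
  have kc : k * (1 + c) = 1 by rewrite mulVf.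
  by apply/andP; split; nra.
have hA i j : `|A i j| <= 2 * r.
  (* The entry vanishes at y = y0, so y may be replaced by y - y0. *)
  rewrite /A mxE (_ : _ - _ = (y - y0) i 0 * y0 j 0 - y0 i 0 * (y - y0) j 0); last by rewrite !mxE; ring.
  have g p q : `|(y - y0) p 0 * y0 q 0| <= r.
    rewrite normrM -[leRHS]mulr1.
    by apply: ler_pM; [exact: normr_ge0|exact: normr_ge0|exact: yr|exact: normr_coord_le1].
  apply: le_trans (ler_normB _ _) _; have := g i j; have := g j i.
  by rewrite [y0 i 0 * _]mulrC; lra.
have hA2 i j : `|(A *m A) i j| <= 12 * r ^+ 2.
  rewrite mxE sum_ord3.
  have g p : `|A i p * A p j| <= 4 * r ^+ 2.
    rewrite normrM (_ : 4 * r ^+ 2 = (2 * r) * (2 * r)); last by ring.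
    by apply: ler_pM; [exact: normr_ge0|exact: normr_ge0|exact: hA|exact: hA].
  have := g o0; have := g o1; have := g o2; rewrite !ler_norml.
  by move=> /andP[? ?] /andP[? ?] /andP[? ?]; apply/andP; split; lra.
have hB i j : `|B i j| <= 3 * r.
  rewrite /B /moving mxE [X in _ + X]mxE.
  apply: le_trans (ler_normD _ _) _.
  have g : `|k * (A *m A) i j| <= 12 * r ^+ 2.
    move: k01 => /andP[k0 k1]; rewrite normrM (ger0_norm k0) -[leRHS]mul1r.
    by apply: ler_pM; [exact: k0|exact: normr_ge0|exact: k1|exact: hA2].
  by have := hA i j; have g2 := g; rewrite -/A -/c -/k; nra.
have SB := moving_SO3 h0 h1 c1.
have := H1 B (3 * r) y0 SB hB; rewrite (moving_mul h0 h1 c1) => /(_ _ h0) H.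
have {}H := H ltac:(lra).
have sL p : sm (L p.1 p.2 W) by exact: sm_L.
have sA := sm_linear_field A sW; have sA2 := sm_linear_field (A *m A) sW.
(* B = A + k A^2: the field of A gives the stated first-order sum, and that of A^2, of size r^2,
   joins the error. *)
have E : T (fun x => 'D_(B *m x) W x) y0 =
    \sum_(p : 'I_3 * 'I_3) (y0 p.1 0 * y p.2 0) * T (L p.1 p.2 W) y0
    + k * T (fun x => 'D_(A *m A *m x) W x) y0.
  rewrite -(T_sum _ sL) // -TZ // -TD //; first last.
  - exact: sm_scale.
  - by apply: sm_sum => p; exact: sm_scale.
  apply: eq_T => x x1; have x0 := nsq1_neq0 x1; have dW := sm_diff sW x0.
  rewrite /B /moving mulmxDl -scalemxAl addrC derive_lin // addrC; congr (_ + _).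
  rewrite -(pair_bigA _ (fun i j => y0 i 0 * y j 0 * L i j W x)) /=.
  exact: planar_derive.
have F : `|T (fun x => 'D_(A *m A *m x) W x) y0| <= 16 * (36 * C2 * r ^+ 2).
  apply: T_bound => // x x1; have x0 := nsq1_neq0 x1.
  rewrite derive_basis; last exact: sm_diff.
  apply: le_trans (ler_norm_sum _ _ _) _.
  apply: (@le_trans _ _ (\sum_i 36 * r ^+ 2 * `|'D_(basis3 i) W x|)).
    apply: ler_sum => i _; rewrite normrM; apply: ler_wpM2r => //.
    by rewrite (_ : 36 * _ = 3 * (12 * r ^+ 2)); [exact: mulmx_entry_bound|ring].
  rewrite -mulr_sumr (_ : 36 * C2 * r ^+ 2 = 36 * r ^+ 2 * C2); last by ring.
  apply: ler_wpM2l; first by rewrite mulr_ge0 ?sqr_ge0.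
  by have := H2 x x1; rewrite big_enum /=; exact/le_trans/ler_norm.
rewrite E in H.
have k0 : `|k * T (fun x => 'D_(A *m A *m x) W x) y0| <= 16 * (36 * C2 * r ^+ 2).
  by move: k01 => /andP[k0 k1]; rewrite normrM (ger0_norm k0) -[leRHS]mul1r; apply: ler_pM; [exact: k0|exact: normr_ge0|exact: k1|exact: F].
have tri (a S K X Y : R) : `|a - (S + K)| <= X -> `|K| <= Y -> `|a - S| <= X + Y.
  move=> h h'; rewrite (_ : a - S = (a - (S + K)) + K); last by ring.
  by apply: le_trans (ler_normD _ _) _; exact: lerD.
have := tri _ _ _ _ _ H k0.
by rewrite (_ : C1 * _ + _ = (9 * C1 + 16 * (36 * C2)) * r ^+ 2) //; ring.
Qed.

End Taylor.

(** * Smoothness of the resolvent *)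

Section ResolventSmooth.
Variable R : realType.
Local Notation V := 'cV[R]_3.
Implicit Types (U W : V -> R) (v x t z y : V).

Definition unitv x : V := (enorm x)^-1 *: x.

Definition Text W x : R := T W (unitv x).

Lemma enorm_gt0 x : x != 0 -> 0 < enorm x.
Proof. by move=> x0; rewrite sqrtr_gt0; exact: nsq_gt0. Qed.

Lemma enorm_sqr x : enorm x ^+ 2 = nsq x.
Proof. by rewrite sqr_sqrtr ?nsq_ge0. Qed.

Lemma nsq_unitv x : x != 0 -> nsq (unitv x) = 1.
Proof.
move=> x0; rewrite nsqZ -enorm_sqr -exprMn mulVf ?expr1n //.
by rewrite lt0r_neq0 // enorm_gt0.
Qed.

Lemma enorm_continuous : continuous (@enorm R).
Proof.
move=> x; apply: (@continuous_comp _ _ _ (@nsq R) (@Num.sqrt R)); first exact: nsq_continuous.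
exact: sqrt_continuous.
Qed.

Lemma dot_linear_continuous z : exists2 f : {linear V -> R}, (f : V -> R) = dot z & continuous f.
Proof.
have lin : linear (dot z : V -> R^o) by move=> a x y; exact: dot_lin.
pose f : {linear V -> R} := HB.pack (dot z : V -> R^o) (GRing.isLinear.Build _ _ _ _ _ lin).
exists f => // y; rewrite (_ : (f : V -> R) = \sum_i (fun y : V => y i 0 *: (z i 0 : R^o))).
  apply: differentiable_continuous; apply: differentiable_sum => i.
  exact/differentiableZl/differentiable_coord.
by apply/funext => x; rewrite fct_sumE; apply: eq_bigr => i _; rewrite mulrC.
Qed.

Lemma coord_le_norm x i : `|x i 0| <= `|x|.
Proof.
rewrite [leRHS]/Num.norm /= mx_normrE.
exact: (le_bigmax _ (fun p : 'I_3 * 'I_1 => `|x p.1 p.2|) (i, 0)).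
Qed.

Lemma T_L_anti j k W t : sm W -> nsq t = 1 -> T (L j k W) t = - T (L k j W) t.
Proof.
move=> sW t1; rewrite -mulN1r -TZ //; last exact: sm_L.
by apply: eq_T => x _; rewrite L_anti mulN1r.
Qed.

(** For U homogeneous of degree 0, Euler's identity gives nsq x times the k-th partial derivative as
    the sum of x_j L_jk U. Here L_jk (Text W) is replaced by its expected value Text (L_jk W). *)
Definition gradText W x : V := \col_k \sum_j x j 0 / nsq x * Text (L j k W) x.

Lemma nsq_unitv_diff x y : x != 0 -> y != 0 ->
  nsq (unitv x - unitv y) <= nsq (x - y) / (enorm x * enorm y).
Proof.
move=> x0 y0; have nx := enorm_gt0 x0; have ny := enorm_gt0 y0.
have e1 : nsq (unitv x - unitv y) = 2 - 2 * ((enorm x * enorm y)^-1 * dot x y).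
  have dE : dot (unitv x) (unitv y) = (enorm x * enorm y)^-1 * dot x y.
    by rewrite /unitv dotZr dotC dotZr [dot y x]dotC invfM; ring.
  have := nsq_unitv y0; have := nsq_unitv x0; rewrite -dE.
  move: (unitv x) (unitv y) => u w u1 w1.
  by rewrite -[- w]scaleN1r nsqD nsqZ dotZr u1 w1; ring.
have e2 : nsq (x - y) = enorm x ^+ 2 + enorm y ^+ 2 - 2 * dot x y.
  by rewrite -[- y]scaleN1r nsqD nsqZ dotZr !enorm_sqr; ring.
rewrite e1 e2 ler_pdivlMr ?mulr_gt0 // mulrBl -mulrA mulrAC mulVf ?mul1r; last first.
  by rewrite mulf_neq0 // lt0r_neq0.
have := sqr_ge0 (enorm x - enorm y); lra.
Qed.

Lemma sqr_ratio_bound (n m q w : R) : 0 < n -> n / 4 <= m -> q <= 3 * w ^+ 2 ->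
  q <= (4 * w / n) ^+ 2 * (m * n).
Proof.
move=> n0 nm qw; apply: le_trans qw _.
have -> : (4 * w / n) ^+ 2 * (m * n) = 16 * w ^+ 2 * (m / n) by field; exact: lt0r_neq0.
have h : 1 / 4 <= m / n by rewrite ler_pdivlMr // mulrC mulrA mulr1.
have := sqr_ge0 w; nra.
Qed.

Lemma small_ratio_bound (n w : R) : 0 < n -> w <= n / 400 -> 4 * w / n <= 1 / 100.
Proof. by move=> n0 wn; rewrite ler_pdivrMr //; lra. Qed.

(** [T_move] is applied to the unit vectors of x and v + x, at distance of order |v|/|x|, so its
    error is quadratic in v. *)
Lemma Text_diff W x : sm W -> x != 0 ->
  differentiable (Text W) x /\ 'd (Text W) x = dot (gradText W x) :> (V -> R).
Proof.
move=> sW x0; have [f fE cf] := dot_linear_continuous (gradText W x).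
rewrite -fE; apply: differentiable_epsP => // e e0; rewrite fE.
have [C C0 HC] := T_move sW.
set N := enorm x; have N0 : 0 < N := enorm_gt0 x0.
pose tau (p : 'I_3 * 'I_3) := T (L p.1 p.2 W) (unitv x).
pose D v := \sum_p x p.1 0 * v p.2 0 * tau p.
pose K := \sum_p `|x p.1 0 * tau p|.
have K0 : 0 <= K by apply: sumr_ge0.
have DK v : `|D v| <= K * `|v|.
  apply: le_trans (ler_norm_sum _ _ _) _; rewrite mulr_suml; apply: ler_sum => p _.
  by rewrite mulrAC normrM; apply: ler_wpM2l => //; exact: coord_le_norm.
(* By antisymmetry of [tau] the radial direction contributes nothing, so [D] at v + x equals [D] at
   v. *)
have Dxx : D x = 0.
  have a p q : tau (p, q) = - tau (q, p) by rewrite /tau T_L_anti // nsq_unitv.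
  rewrite /D -(pair_bigA _ (fun i j => x i 0 * x j 0 * tau (i, j))) /= !sum_ord3.
  have d p : tau (p, p) = 0 by have := a p p; lra.
  by rewrite !d (a o1 o0) (a o2 o0) (a o2 o1); ring.
have DD v w : D (v + w) = D v + D w.
  by rewrite /D -big_split; apply: eq_bigr => p _; rewrite mxE /=; ring.
have grad v : dot (gradText W x) v = D v / N ^+ 2.
  rewrite /D -(pair_bigA _ (fun i j => x i 0 * v j 0 * tau (i, j))) /= exchange_big mulr_suml.
  apply: eq_bigr => k _; rewrite mxE !mulr_suml; apply: eq_bigr => j _.
  by rewrite /tau /= -/(Text (L j k W) x) enorm_sqr; ring.
have c2 : (fun v : V => enorm (v + x)) @ (0 : V) --> N.
  rewrite /N -{2}[x]add0r.
  apply: (@continuous_comp _ _ _ (fun v : V => v + x) (@enorm R)); last exact: enorm_continuous.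
  by apply: continuousD; [exact: cvg_id|exact: cst_continuous].
have NN : N * N != 0 by apply: mulf_neq0; exact: lt0r_neq0.
have c1 : (fun v : V => (N * enorm (v + x))^-1) @ (0 : V) --> (N * N)^-1.
  exact: (cvgV NN (cvgMl_tmp c2)).
(* Three thresholds: [d1] makes r <= 1/100, [d2] absorbs the quadratic error of [T_move], and [d3]
   the replacement of 1/(N |v + x|) by 1/N^2. *)
pose d1 := N / 400; have d10 : 0 < d1 by apply: divr_gt0; rewrite ?ltr0n.
pose d2 := e / 2 / (C * 16 / N ^+ 2 + 1).
have q0 : 0 < C * 16 / N ^+ 2 + 1.
  by apply: ltr_wpDl => //; apply: divr_ge0; [apply: mulr_ge0|exact: sqr_ge0].
have d20 : 0 < d2 by apply: divr_gt0 => //; apply: divr_gt0.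
pose d3 := e / 2 / (K + 1); have d30 : 0 < d3.
  by apply: divr_gt0; [apply: divr_gt0|apply: ltr_wpDl].
have nb (d : R) : 0 < d -> \forall v \near (0 : V), `|v| <= d.
  by move=> d0; apply/nbhs_ballP; exists d => //= v; rewrite -ball_normE /= sub0r normrN => /ltW.
near=> v.
have v1 : `|v| <= d1 by near: v; exact: nb.
have v2 : `|v| <= d2 by near: v; exact: nb.
have M4 : N / 4 <= enorm (v + x).
  near: v; apply: (cvgr_ge _ c2).
  by rewrite ltr_pdivrMr ?ltr0n // ltr_pMr // ltr1n.
have v3 : `|(N * N)^-1 - (N * enorm (v + x))^-1| <= d3.
  by near: v; move/cvgrPdist_le: c1; apply.
set M := enorm (v + x) in M4 v3 *.
have M0 : 0 < M by apply: lt_le_trans M4; apply: divr_gt0; rewrite ?ltr0n.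
have x1 : v + x != 0 by apply/eqP => vx; move: M0; rewrite /M vx -sqrtr0 /enorm -/(nsq 0) (eqP (_ : nsq 0 == 0)) ?nsq_eq0 ?sqrtr0 ?ltxx.
pose r := 4 * `|v| / N.
have nv := nsq_le_coord (coord_le_norm v).
have hr i : `|(unitv (v + x) - unitv x) i 0| <= r.
  rewrite -(@ler_pXn2r _ 2) ?nnegrE ?divr_ge0 ?mulr_ge0 ?(ltW N0) //.
  apply: le_trans (coord_le_nsq _ _) _; apply: le_trans (nsq_unitv_diff x1 x0) _.
  rewrite addrK -/M -/N ler_pdivrMr ?mulr_gt0 //; exact: sqr_ratio_bound.
have r100 : r <= 1 / 100 by exact: small_ratio_bound.
have := HC _ _ _ (nsq_unitv x0) (nsq_unitv x1) hr r100.
have -> : \sum_(p : 'I_3 * 'I_3) (unitv x p.1 0 * unitv (v + x) p.2 0) * T (L p.1 p.2 W) (unitv x)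
    = D v * (N * M)^-1.
  have <- : D (v + x) = D v by rewrite DD Dxx addr0.
  rewrite [RHS]mulr_suml; apply: eq_bigr => p _.
  by rewrite /unitv !mxE -/N -/M /tau invfM /=; ring.
move=> H; rewrite grad.
have -> : Text W (v + x) - Text W x - D v / N ^+ 2 =
   (Text W (v + x) - Text W x - D v * (N * M)^-1) + D v * ((N * M)^-1 - (N * N)^-1).
  by rewrite expr2; ring.
apply: le_trans (ler_normD _ _) _; rewrite (_ : e * `|v| = e / 2 * `|v| + e / 2 * `|v|); last by field.
apply: lerD.
  apply: le_trans H _.
  rewrite /r (_ : C * _ = C * 16 / N ^+ 2 * `|v| * `|v|); last by field; exact: lt0r_neq0.
  apply: ler_wpM2r => //; apply: (@le_trans _ _ ((C * 16 / N ^+ 2 + 1) * d2)).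
    apply: ler_pM => //; last by rewrite lerDl.
    by apply: divr_ge0; [apply: mulr_ge0|exact: sqr_ge0].
  by rewrite /d2 mulrC divfK // lt0r_neq0.
rewrite normrM distrC mulrC.
apply: (@le_trans _ _ (d3 * (K * `|v|))).
  by apply: ler_pM => //; exact: DK.
rewrite mulrA; apply: ler_wpM2r => //.
apply: (@le_trans _ _ (d3 * (K + 1))).
  by apply: ler_wpM2l; [exact: ltW|rewrite lerDl].
by rewrite /d3 divfK // lt0r_neq0 //; apply: ltr_wpDl.
Unshelve. all: by end_near. Qed.

Lemma Text_derive W x v : sm W -> x != 0 -> 'D_v (Text W) x = dot (gradText W x) v.
Proof. by move=> sW x0; have [d E] := Text_diff sW x0; rewrite deriveE // E. Qed.

Lemma alg_sum (S : (V -> R) -> Prop) (J : Type) (s : seq J) (F : J -> V -> R) :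
  (forall j, alg S (F j)) -> alg S (fun x => \sum_(j <- s) F j x).
Proof.
move=> aF; elim: s => [|j s IH].
  by apply: (alg_eq (alg_cst S 0)) => x _; rewrite big_nil.
by apply: (alg_eq (alg_add (aF j) IH)) => x _; rewrite big_cons.
Qed.

(** The derivatives of Text W are combinations of the functions Text (L_jk W) with smooth
    coefficients, so these functions and the smooth ones satisfy the criterion [alg_sm]. *)
Lemma sm_Text W : sm W -> sm (Text W).
Proof.
move=> sW; apply: (@alg_sm _ (fun U => sm U \/ exists2 W', sm W' & U = Text W')).
- move=> U [sU|[W' sW' ->]] x x0; first exact: sm_diff.
  by have [] := Text_diff sW' x0.
- move=> U v [sU|[W' sW' ->]].
    by exists (fun x => 'D_v U x) => //; apply: alg_gen; left; exact: sm_derive.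
  exists (fun x => \sum_k \sum_j (fun x => x j 0 / nsq x * v k 0) x * Text (L j k W') x).
    apply: alg_sum => k; apply: alg_sum => j.
    apply: (@alg_mul _ _ (fun x => x j 0 / nsq x * v k 0) (Text (L j k W'))); apply: alg_gen; last first.
      by right; exists (L j k W') => //; exact: sm_L.
    left; apply: sm_mul; last exact: sm_cst.
    apply: sm_mul; first exact: sm_coord.
    by apply: sm_inv; [exact: sm_nsq|move=> x x0; rewrite nsq_eq0].
  move=> x x0; rewrite Text_derive //; apply: eq_bigr => k _.
  by rewrite mxE mulr_suml; apply: eq_bigr => j _; rewrite mulrAC.
- by apply: alg_gen; right; exists W.
Qed.

Lemma L_Text j k W x : sm W -> x != 0 -> L j k (Text W) x = Text (L j k W) x.
Proof.
move=> sW x0; rewrite LE !Text_derive // !dot_basis !mxE !mulr_sumr -sumrB.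
have nx : nsq x != 0 by rewrite nsq_eq0.
transitivity ((\sum_i x i 0 ^+ 2) / nsq x * Text (L j k W) x); last by rewrite divff // mul1r.
rewrite !mulr_suml; apply: eq_bigr => i _.
(* The cyclic relation turns x_j T (L_ik W) - x_k T (L_ij W) into x_i T (L_jk W); weighted by x_i /
   nsq x, these add up to T (L_jk W). *)
have := T_L_cyclic i j k sW (nsq_unitv x0); rewrite !mxE -!/(Text _ x).
rewrite [Text (L k i W) x]T_L_anti ?nsq_unitv // -/(Text (L i k W) x).
have n0 : (enorm x)^-1 != 0 by rewrite invr_neq0 // lt0r_neq0 // enorm_gt0.
move: (Text _ x) (Text _ x) (Text _ x) => a b c E.
have {}E : x i 0 * c = x j 0 * b - x k 0 * a.
  apply: (mulfI n0); apply/eqP; rewrite -subr_eq0; apply/eqP; rewrite -[RHS]E; ring.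
rewrite [RHS](_ : _ = x i 0 / nsq x * (x i 0 * c)); last by ring.
by rewrite E; ring.
Qed.

Lemma lap_Text W x : sm W -> x != 0 -> lap (Text W) x = Text (lap W) x.
Proof.
move=> sW x0; have u1 := nsq_unitv x0.
have E j k : L j k (L j k (Text W)) x = Text (L j k (L j k W)) x.
  rewrite -L_Text //; last exact: sm_L.
  by apply: eq_L => // y y0; rewrite L_Text.
have s j k : sm (L j k (L j k W)) by do 2 apply: sm_L.
rewrite lapE !E /Text -!TD //; last exact: sm_add.
by apply: eq_T => y _; rewrite lapE.
Qed.

Lemma Text_resolvent W x : sm W -> x != 0 -> Text W x - lap (Text W) x = W (unitv x).
Proof.
move=> sW x0; have sL := sm_lap sW; rewrite lap_Text // /Text.
rewrite -[RHS]T_inverse ?nsq_unitv //.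
rewrite [RHS](@eq_T _ _ (fun y => W y + -1 * lap W y)) => [|y _]; last by rewrite mulN1r.
by rewrite TD ?TZ ?mulN1r ?nsq_unitv //; exact: sm_scale.
Qed.

End ResolventSmooth.

(** * Functions homogeneous of degree zero and the Euclidean Laplacian *)

Section Homogeneous.
Variable R : realType.
Local Notation V := 'cV[R]_3.
Implicit Types (U W : V -> R) (v x t y : V).

Definition hom0 U := forall (c : R) x, 0 < c -> x != 0 -> U (c *: x) = U x.

Definition elap U x : R := \sum_i 'D_(basis3 i) (fun y => 'D_(basis3 i) U y) x.

Lemma derive_mul U W v x : sm U -> sm W -> x != 0 ->
  'D_v (fun y => U y * W y) x = 'D_v U x * W x + U x * 'D_v W x.
Proof.
move=> sU sW x0; transitivity (U x * 'D_v W x + W x * 'D_v U x); last by rewrite addrC mulrC.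
by rewrite (@deriveM _ _ U W) //; exact: sm_derivable.
Qed.

Lemma derive_sub U W v x : sm U -> sm W -> x != 0 ->
  'D_v (fun y => U y - W y) x = 'D_v U x - 'D_v W x.
Proof. by move=> sU sW x0; rewrite deriveB //; exact: sm_derivable. Qed.

Lemma derive_sum3 (F : 'I_3 -> V -> R) v x : (forall i, sm (F i)) -> x != 0 ->
  'D_v (fun y => \sum_i F i y) x = \sum_i 'D_v (F i) x.
Proof.
move=> sF x0; rewrite (_ : (fun y => _) = \sum_i F i); last by apply/funext => y; rewrite fct_sumE.
by rewrite derive_sum // => i; exact: sm_derivable.
Qed.

Lemma euler U x : sm U -> hom0 U -> x != 0 -> \sum_i x i 0 * 'D_(basis3 i) U x = 0.
Proof.
move=> sU hU x0; rewrite -derive_basis; last exact: sm_diff.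
have dU : differentiable U ((1 + 0 : R) *: x) by rewrite addr0 scale1r; exact: sm_diff.
have dg (i : 'I_3) : is_derive (0 : R) 1 (fun s : R => ((1 + s) *: x) i 0) (x i 0).
  rewrite (_ : (fun s : R => _) = fun s => (1 + s) * x i 0); last by apply/funext => s; rewrite mxE.
  by apply: is_derive_eq; rewrite /GRing.scale /=; ring.
have H := is_derive_path (g := fun s : R => (1 + s) *: x) dg dU.
rewrite -[x in LHS]scale1r -[in LHS](addr0 1) in H *.
have := @derive_val _ _ _ _ _ _ _ H; rewrite /= addr0 !scale1r => <-.
rewrite (@near_eq_derive _ _ _ _ (cst (U x))) ?derive_cst //.
near=> s; rewrite /cst hU //.
suff : `|0 - s| < 1 by rewrite sub0r normrN ltr_norml => /andP[]; lra.
by near: s; exact: cvgr_dist_lt.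
Unshelve. all: by end_near. Qed.

(** Euler's identity, differentiated and contracted with x once more. *)
Lemma euler2 U x : sm U -> hom0 U -> x != 0 ->
  \sum_k \sum_j x k 0 * x j 0 * 'D_(basis3 k) (fun y => 'D_(basis3 j) U y) x = 0.
Proof.
move=> sU hU x0.
have E k : 'D_(basis3 k) U x + \sum_j x j 0 * 'D_(basis3 k) (fun y => 'D_(basis3 j) U y) x = 0.
  have H : 'D_(basis3 k) (fun y => \sum_i y i 0 * 'D_(basis3 i) U y) x = 0.
    rewrite (@eq_derive_punctured _ _ (cst 0)) ?derive_cst // => y y0; exact: euler.
  rewrite -[RHS]H derive_sum3 // => [|i]; last by apply: sm_mul; [exact: sm_coord|exact: sm_derive].
  rewrite [RHS](eq_bigr (fun i => (basis3 k : V) i 0 * 'D_(basis3 i) U x +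
     x i 0 * 'D_(basis3 k) (fun y => 'D_(basis3 i) U y) x)) => [|i _]; last first.
    by rewrite derive_mul ?derive_coord //; [exact: sm_coord|exact: sm_derive].
  rewrite big_split /=; congr (_ + _).
  rewrite (bigD1 k) //= big1 ?addr0 => [|i ik].
    by rewrite mxE eqxx mul1r.
  by rewrite mxE (negbTE ik) mul0r.
transitivity (- \sum_k x k 0 * 'D_(basis3 k) U x); last by rewrite euler ?oppr0.
rewrite -sumrN; apply: eq_bigr => k _.
have /eqP := E k; rewrite addrC addr_eq0 => /eqP Ek.
rewrite -mulrN -Ek mulr_sumr; apply: eq_bigr => j _; exact: esym (mulrA _ _ _).
Qed.

Lemma basis3E (i j : 'I_3) : (basis3 i : V) j 0 = (j == i)%:R.
Proof. by rewrite mxE andbT. Qed.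

Lemma L_sqr j k U x
    (dd := fun i l => 'D_(basis3 i) (fun y => 'D_(basis3 l) U y) x)
    (d := fun i => 'D_(basis3 i) U x) : j != k -> sm U -> x != 0 ->
  L j k (L j k U) x = x j 0 ^+ 2 * dd k k + x k 0 ^+ 2 * dd j j
    - x j 0 * x k 0 * dd k j - x k 0 * x j 0 * dd j k - x j 0 * d j - x k 0 * d k.
Proof.
move=> jk sU x0.
have E i : 'D_(basis3 i) (L j k U) x = (j == i)%:R * d k + x j 0 * dd i k
    - ((k == i)%:R * d j + x k 0 * dd i j).
  rewrite (_ : L j k U = fun y => y j 0 * 'D_(basis3 k) U y - y k 0 * 'D_(basis3 j) U y); last first.
    by apply/funext => y; rewrite LE.
  have s a b : sm (fun x => x a 0 * 'D_(basis3 b) U x) by apply: sm_mul; [exact: sm_coord|exact: sm_derive].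
  rewrite (derive_sub _ (s j k) (s k j) x0).
  rewrite (derive_mul _ (@sm_coord R j) (@sm_derive R U (basis3 k) sU) x0).
  rewrite (derive_mul _ (@sm_coord R k) (@sm_derive R U (basis3 j) sU) x0).
  by rewrite !derive_coord !basis3E.
have kj : (k == j) = false by rewrite eq_sym (negbTE jk).
rewrite LE (E k) (E j) !eqxx kj (negbTE jk).
by move: dd d {E} => dd d /=; ring.
Qed.

(** In general [lap] is nsq x times the Euclidean Laplacian, minus the second derivative in the
    direction x, minus twice the first one; the two Euler identities remove these radial terms. *)
Lemma lap_hom0 U x : sm U -> hom0 U -> x != 0 -> lap U x = nsq x * elap U x.
Proof.
move=> sU hU x0; have := euler sU hU x0; have := euler2 sU hU x0.
pose dd j k := 'D_(basis3 j) (fun y => 'D_(basis3 k) U y) x.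
pose d k := 'D_(basis3 k) U x.
have Ls j k : j != k -> L j k (L j k U) x = x j 0 ^+ 2 * dd k k + x k 0 ^+ 2 * dd j j
    - x j 0 * x k 0 * dd k j - x k 0 * x j 0 * dd j k - x j 0 * d j - x k 0 * d k.
  by move=> jk; exact: L_sqr.
rewrite lapE (Ls o0 o1) // (Ls o1 o2) // (Ls o2 o0) //.
rewrite (_ : elap U x = \sum_i dd i i) // (_ : \sum_i x i 0 * _ = \sum_i x i 0 * d i) //.
rewrite (_ : \sum_k \sum_j _ = \sum_k \sum_j x k 0 * x j 0 * dd k j) //.
move: dd d {Ls} => dd d; rewrite /nsq !sum_ord3 => E2 E1.
transitivity ((x o0 0 ^+ 2 + x o1 0 ^+ 2 + x o2 0 ^+ 2) * (dd o0 o0 + dd o1 o1 + dd o2 o2) - 2 * 0 - 0); last by ring.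
rewrite -[X in _ - 2 * X - _]E1 -[X in _ - X]E2; ring.
Qed.

Lemma hom0_L j k U : sm U -> hom0 U -> hom0 (L j k U).
Proof.
move=> sU hU c x c0 x0; have cx : c *: x != 0 by rewrite scaler_eq0 negb_or x0 lt0r_neq0.
have D v : c * 'D_v U (c *: x) = 'D_v U x.
  have M0 y : (c%:M : 'M[R]_3) *m y = c *: y by rewrite mul_scalar_mx.
  have dU : differentiable U ((c%:M : 'M[R]_3) *m x) by rewrite M0; exact: sm_diff.
  transitivity ('D_v (fun y => U ((c%:M : 'M[R]_3) *m y)) x); last first.
    by apply: eq_derive_punctured => // y y0; rewrite M0 hU.
  rewrite derive_mulmx // !M0 -[c *: v]addr0 derive_lin; last exact: sm_diff.
  rewrite [X in _ + X](_ : _ = 0) ?addr0 // derive_basis; last exact: sm_diff.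
  by rewrite big1 // => i _; rewrite mxE mul0r.
by rewrite !LE !mxE -!D; ring.
Qed.

Lemma hom0_lap U : sm U -> hom0 U -> hom0 (lap U).
Proof.
move=> sU hU c x c0 x0; rewrite !lapE.
have h j k : L j k (L j k U) (c *: x) = L j k (L j k U) x.
  by apply: (@hom0_L j k) => //; [exact: sm_L|exact: hom0_L].
by rewrite !h.
Qed.

Lemma elap_orth M U x : M^T *m M = 1%:M -> M *m M^T = 1%:M -> sm U -> x != 0 ->
  elap (fun y => U (M *m y)) x = elap U (M *m x).
Proof.
move=> MO OM sU x0; have Mx y : y != 0 -> M *m y != 0 by exact: orth_neq0.
have E i : 'D_(basis3 i) (fun y => 'D_(basis3 i) (fun y => U (M *m y)) y) x =
    \sum_j \sum_k M j i * M k i * 'D_(basis3 j) (fun y => 'D_(basis3 k) U y) (M *m x).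
  have D1 W y : sm W -> y != 0 -> 'D_(basis3 i) (fun y => W (M *m y)) y =
      \sum_j M j i * 'D_(basis3 j) W (M *m y).
    move=> sW y0; rewrite derive_mulmx; last by apply: sm_diff => //; exact: Mx.
    rewrite derive_basis; last by apply: sm_diff => //; exact: Mx.
    apply: eq_bigr => j _; congr (_ * _).
    by rewrite /basis3 -colE mxE.
  rewrite (@eq_derive_punctured _ _ (fun y => \sum_k M k i * 'D_(basis3 k) U (M *m y))) //; last first.
    by move=> y y0; rewrite D1.
  rewrite derive_sum3 // => [|k]; last first.
    by apply: sm_scale; apply: (@sm_orth _ M (fun y => 'D_(basis3 k) U y)) => //; exact: sm_derive.
  rewrite exchange_big; apply: eq_bigr => k _.
  rewrite derive_mul //; last 2 first.
  - exact: sm_cst.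
  - by apply: (@sm_orth _ M (fun y => 'D_(basis3 k) U y)) => //; exact: sm_derive.
  rewrite derive_cst mul0r add0r (D1 (fun y => 'D_(basis3 k) U y)) ?mulr_sumr //; last exact: sm_derive.
  by apply: eq_bigr => j _; ring.
transitivity (\sum_i \sum_j \sum_k M j i * M k i * 'D_(basis3 j) (fun y => 'D_(basis3 k) U y) (M *m x)).
  by apply: eq_bigr => i _; exact: E.
rewrite exchange_big; apply: eq_bigr => j _ /=.
rewrite exchange_big (bigD1 j) //= [X in _ + X]big1 ?addr0 => [|k kj]; last first.
  rewrite -mulr_suml (_ : \sum_i _ = (M *m M^T) j k); last by rewrite mxE; apply: eq_bigr => i _; rewrite mxE.
  by rewrite OM mxE eq_sym (negbTE kj) mul0r.
rewrite -mulr_suml (_ : \sum_i _ = (M *m M^T) j j); last by rewrite mxE; apply: eq_bigr => i _; rewrite mxE.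
by rewrite OM mxE eqxx mul1r.
Qed.

Lemma hom0_mx M U : M^T *m M = 1%:M -> hom0 U -> hom0 (fun x => U (M *m x)).
Proof. by move=> MO hU c x c0 x0; rewrite -scalemxAr hU //; exact: orth_neq0. Qed.

(** Through the Euclidean Laplacian, whose invariance is the relation M M^T = 1; a rotation permutes
    the single fields L_jk only up to linear combinations. *)
Lemma lap_SO3 M U x : isSO3 M -> sm U -> hom0 U -> x != 0 ->
  lap (fun y => U (M *m y)) x = lap U (M *m x).
Proof.
move=> [MO dM] sU hU x0; have sM := sm_orth MO sU; have hM := hom0_mx MO hU.
rewrite (lap_hom0 sM hM x0) (lap_hom0 sU hU (orth_neq0 MO x0)).
by rewrite (nsq_orth x MO) (elap_orth MO (orth_trmx MO) sU x0).
Qed.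

Lemma lap2_SO3 M U x : isSO3 M -> sm U -> hom0 U -> x != 0 ->
  lap (lap (fun y => U (M *m y))) x = lap (lap U) (M *m x).
Proof.
move=> SM sU hU x0; rewrite -(@lap_SO3 M (lap U)) //; last 2 first.
- exact: sm_lap.
- exact: hom0_lap.
rewrite !lapE; have E j k : L j k (L j k (lap (fun y => U (M *m y)))) x =
    L j k (L j k (fun y => lap U (M *m y))) x.
  apply: eq_L => // y y0; apply: eq_L => // z z0; exact: lap_SO3.
by rewrite !E.
Qed.

(* Differential operators of order at most n with polynomial coefficients. *)
Inductive dop : nat -> ((V -> R) -> V -> R) -> Prop :=
| dop_gen n (s : seq 'I_3) : (size s <= n)%N -> dop n (fun U => Defs.iterD (map basis3 s) U)
| dop_coord n A i : dop n A -> dop n (fun U x => x i 0 * A U x)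
| dop_sub n A B : dop n A -> dop n B -> dop n (fun U x => A U x - B U x)
| dop_eq n A B : dop n A -> (forall U x, sm U -> x != 0 -> A U x = B U x) -> dop n B.

Lemma dop_sm n A U : dop n A -> sm U -> sm (A U).
Proof.
move=> dA sU; elim: dA => {n A} [n s _|n A i _ IH|n A B _ IA _ IB|n A B _ IA E].
- by elim: s => // i s IH; exact: sm_derive.
- by apply: sm_mul => //; exact: sm_coord.
- exact: sm_sub.
- by apply: sm_eq IA _ => x x0; exact: E.
Qed.

Lemma dopS n A : dop n A -> dop n.+1 A.
Proof.
elim=> {n A} [n s sn|n A i _ IH|n A B _ IA _ IB|n A B _ IA E].
- by apply: dop_gen; exact: leqW.
- exact: dop_coord.
- exact: dop_sub.
- exact: dop_eq IA E.
Qed.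

Lemma dop_zero n : dop n (fun _ _ => 0).
Proof.
have d := @dop_gen n [::] (leq0n n).
by apply: (dop_eq (dop_sub d d)) => U x _ _; rewrite subrr.
Qed.

Lemma dop_add n A B : dop n A -> dop n B -> dop n (fun U x => A U x + B U x).
Proof.
move=> dA dB; apply: (dop_eq (dop_sub dA (dop_sub (dop_zero n) dB))) => U x _ _.
by rewrite sub0r opprK.
Qed.

Lemma dop_derive n A i : dop n A -> dop n.+1 (fun U x => 'D_(basis3 i) (A U) x).
Proof.
elim=> {n A} [n s sn|n A j dA IH|n A B dA IA dB IB|n A B dA IA E].
- by apply: (@dop_gen n.+1 (i :: s)).
- have d : dop n.+1 (fun U x => (basis3 i : V) j 0 * A U x).
    rewrite mxE; case: eqVneq => _ /=.
      by apply: (dop_eq (dopS dA)) => U x _ _; rewrite mul1r.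
    by apply: (dop_eq (dop_zero _)) => U x _ _; rewrite mul0r.
  apply: (dop_eq (dop_add d (dop_coord j IH))) => U x sU x0.
  by rewrite (derive_mul _ (@sm_coord R j) (dop_sm dA sU) x0) derive_coord.
- apply: (dop_eq (dop_sub IA IB)) => U x sU x0.
  by rewrite derive_sub //; [exact: dop_sm dA sU|exact: dop_sm dB sU].
- by apply: (dop_eq IA) => U x sU x0; apply: eq_derive_punctured => // y y0; exact: E.
Qed.

Lemma dop_L n A j k : dop n A -> dop n.+1 (fun U => L j k (A U)).
Proof.
move=> dA; apply: (dop_eq (dop_sub (dop_coord j (dop_derive k dA)) (dop_coord k (dop_derive j dA)))).
by move=> U x _ _; rewrite LE.
Qed.

Lemma dop_lap n A : dop n A -> dop n.+2 (fun U => lap (A U)).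
Proof.
move=> dA; have d j k := dop_L j k (dop_L j k dA).
by apply: (dop_eq (dop_add (dop_add (d o0 o1) (d o1 o2)) (d o2 o0))) => U x _ _; rewrite lapE.
Qed.

Lemma dop_bound n A : dop n A -> exists2 K : R, 0 <= K &
  forall U (M : R) t, sm U -> nsq t = 1 ->
  (forall s, (size s <= n)%N -> `|Defs.iterD (map basis3 s) U t| <= M) -> `|A U t| <= K * M.
Proof.
elim=> {n A} [n s sn|n A i _ [K K0 H]|n A B _ [K K0 HA] _ [K' K'0 HB]|n A B _ [K K0 H] E].
- by exists 1 => // U M t _ _ H; rewrite mul1r H.
- exists K => // U M t sU t1 B; rewrite normrM -[leRHS]mul1r.
  by apply: ler_pM => //; [exact: normr_coord_le1|exact: H].
- exists (K + K'); first exact: addr_ge0.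
  move=> U M t sU t1 B0; rewrite mulrDl; apply: le_trans (ler_normB _ _) _.
  by apply: lerD; [exact: HA|exact: HB].
- exists K => // U M t sU t1 B0; rewrite -E //; first exact: H.
  exact: nsq1_neq0.
Qed.

(** Two Laplacians are an operator of order 4 with polynomial coefficients, bounded on the sphere by
    the seminorms of [is_distribution]. *)
Lemma lap2_bound : exists2 K : R, 0 <= K &
  forall U (M : R) t, sm U -> nsq t = 1 ->
  (forall s, (size s <= 4)%N -> `|Defs.iterD (map basis3 s) U t| <= M) -> `|lap (lap U) t| <= K * M.
Proof. exact: (dop_bound (dop_lap (dop_lap (@dop_gen 0 [::] (leqnn 0))))). Qed.

End Homogeneous.

(** * The operator Q *)

Section ComplexFunctions.
Variable R : realType.
Local Notation V := 'cV[R]_3.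
Implicit Types (U W : V -> R) (x : V) (t : S2 R) (f g : S2 R -> R[i]).

Definition reE f : V -> R := reals_of (ext0 f).
Definition imE f : V -> R := imags_of (ext0 f).

Lemma eq_complex (z w : R[i]) : complex.Re z = complex.Re w -> complex.Im z = complex.Im w -> z = w.
Proof. by case: z w => [a b] [c d] /= -> ->. Qed.

Lemma smoothS2_sm f : smoothS2 f <-> sm (reE f) /\ sm (imE f).
Proof.
split=> [sf|[sr si] vs x x0]; last by split; [exact: sr|exact: si].
by split=> vs x x0; have [] := sf vs x x0.
Qed.

Lemma nsq_S2 t : nsq (S2val t) = 1.
Proof. by rewrite -enorm_sqr (eqP (S2P t)) expr1n. Qed.

Lemma S2_surj x : nsq x = 1 -> exists t, S2val t = x.
Proof.
move=> x1; have xP : enorm x == 1 by rewrite /enorm -/(nsq x) x1 sqrtr1.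
by exists (MkS2 xP).
Qed.

Lemma S2_neq0 t : S2val t != 0.
Proof. exact/nsq1_neq0/nsq_S2. Qed.

Lemma insubd_unitv x : x != 0 -> S2val (insubd (north : S2 R) (unitv x)) = unitv x.
Proof.
move=> x0; rewrite insubdK // unfold_in /enorm -/(nsq _) nsq_unitv // sqrtr1 eqxx.
by [].
Qed.

Lemma unitv1 x : nsq x = 1 -> unitv x = x.
Proof. by move=> x1; rewrite /unitv /enorm -/(nsq x) x1 sqrtr1 invr1 scale1r. Qed.

Lemma ext0_S2 f t : ext0 f (S2val t) = f t.
Proof.
congr f; apply: val_inj; rewrite /= insubd_unitv ?S2_neq0 //.
by rewrite unitv1 // nsq_S2.
Qed.

Lemma reE_S2 f t : reE f (S2val t) = complex.Re (f t).
Proof. by rewrite /reE /reals_of ext0_S2. Qed.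

Lemma imE_S2 f t : imE f (S2val t) = complex.Im (f t).
Proof. by rewrite /imE /imags_of ext0_S2. Qed.

Lemma unitvZ (c : R) x : 0 < c -> unitv (c *: x) = unitv x.
Proof.
move=> c0; rewrite /unitv {1}/enorm -/(nsq _) nsqZ sqrtrM ?sqr_ge0 // sqrtr_sqr gtr0_norm //.
by rewrite -/(enorm x) scalerA invfM mulrAC mulVf ?mul1r // lt0r_neq0.
Qed.

Lemma hom0_ext0 f (c : R) x : 0 < c -> ext0 f (c *: x) = ext0 f x.
Proof. by move=> c0; rewrite /ext0 -/(unitv _) unitvZ. Qed.

Lemma hom0_reE f : hom0 (reE f).
Proof. by move=> c x c0 _; rewrite /reE /reals_of hom0_ext0. Qed.

Lemma hom0_imE f : hom0 (imE f).
Proof. by move=> c x c0 _; rewrite /imE /imags_of hom0_ext0. Qed.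

Definition S2fun U W : S2 R -> R[i] := fun t => Complex (U t) (W t).

Lemma reE_S2fun U W x : x != 0 -> reE (S2fun U W) x = U (unitv x).
Proof. by move=> x0; rewrite /reE /reals_of /ext0 /= insubd_unitv. Qed.

Lemma imE_S2fun U W x : x != 0 -> imE (S2fun U W) x = W (unitv x).
Proof. by move=> x0; rewrite /imE /imags_of /ext0 /= insubd_unitv. Qed.

Lemma Re_sum (J : Type) (r : seq J) (F : J -> R[i]) :
  complex.Re (\sum_(j <- r) F j) = \sum_(j <- r) complex.Re (F j).
Proof. by elim/big_rec2: _ => // j a b _ <-; case: (F j) b => [? ?] [? ?]. Qed.

Lemma Im_sum (J : Type) (r : seq J) (F : J -> R[i]) :
  complex.Im (\sum_(j <- r) F j) = \sum_(j <- r) complex.Im (F j).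
Proof. by elim/big_rec2: _ => // j a b _ <-; case: (F j) b => [? ?] [? ?]. Qed.

Lemma laplS2E f t : smoothS2 f ->
  laplS2 f t = Complex (lap (reE f) (S2val t)) (lap (imE f) (S2val t)).
Proof.
move=> /smoothS2_sm [sr si].
have E U : sm U -> hom0 U -> elap U (S2val t) = lap U (S2val t).
  by move=> sU hU; rewrite lap_hom0 ?S2_neq0 // nsq_S2 mul1r.
have Er : complex.Re (laplS2 f t) = lap (reE f) (S2val t).
  by rewrite -(E _ sr (hom0_reE f)) [LHS]Re_sum.
have Ei : complex.Im (laplS2 f t) = lap (imE f) (S2val t).
  by rewrite -(E _ si (hom0_imE f)) [LHS]Im_sum.
exact: eq_complex.
Qed.

Lemma unitvV x : x != 0 -> unitv (unitv x) = unitv x.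
Proof. by move=> x0; rewrite unitv1 // nsq_unitv. Qed.

(** [xget] falls back on zero unless a solution exists; the one exhibited is [Text] of the real and
    imaginary parts. *)
Lemma resolventS2P f : smoothS2 f -> smoothS2 (resolventS2 f) /\
  forall t, resolventS2 f t - laplS2 (resolventS2 f) t = f t.
Proof.
move=> sf; rewrite /resolventS2; set P := [set u | _]; suff : exists u, P u.
  by move=> [u Pu]; exact: (@xgetPex _ (cst 0) P (ex_intro _ u Pu)).
have /smoothS2_sm [sr si] := sf.
have Er x : x != 0 -> Text (reE f) x = reE (S2fun (Text (reE f)) (Text (imE f))) x.
  by move=> x0; rewrite reE_S2fun // /Text unitvV.
have Ei x : x != 0 -> Text (imE f) x = imE (S2fun (Text (reE f)) (Text (imE f))) x.
  by move=> x0; rewrite imE_S2fun // /Text unitvV.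
have su : smoothS2 (S2fun (Text (reE f)) (Text (imE f))).
  by apply/smoothS2_sm; split; [exact: sm_eq (sm_Text sr) Er|exact: sm_eq (sm_Text si) Ei].
exists (S2fun (Text (reE f)) (Text (imE f))); split=> // t; rewrite laplS2E //.
have elap U W : (forall x, x != 0 -> U x = W x) -> lap U (S2val t) = lap W (S2val t).
  by move=> E; rewrite !lapE; congr (_ + _ + _); apply: eq_L (S2_neq0 t) => y y0; exact: eq_L.
rewrite -(elap _ _ Er) -(elap _ _ Ei); apply: eq_complex => /=.
  by rewrite Text_resolvent ?S2_neq0 // unitv1 ?nsq_S2 // reE_S2.
by rewrite Text_resolvent ?S2_neq0 // unitv1 ?nsq_S2 // imE_S2.
Qed.

Definition qmul (l : nat) : R := (l * l.+1)%:R * resmul R l.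

Lemma proj_lap_resolvent l U W x : sm U -> nsq x = 1 ->
  (forall y, nsq y = 1 -> U y - lap U y = W y) ->
  proj l (fun y => - lap U y) x = qmul l * proj l W x.
Proof.
move=> sU x1 E; have cL := sm_cnz (sm_lap sU).
rewrite -(eq_proj l x E) /qmul -mulrA -proj_resolvent //.
rewrite -[RHS]opprK -mulNr -proj_lap // -mulN1r -projZ //.
by apply: eq_proj => y _; rewrite mulN1r.
Qed.

Lemma opQ_parts f : smoothS2 f -> exists U W,
  [/\ sm U, sm W, forall t, opQ f t = Complex (U t) (W t),
      forall l x, nsq x = 1 -> proj l U x = qmul l * proj l (reE f) x &
      forall l x, nsq x = 1 -> proj l W x = qmul l * proj l (imE f) x].
Proof.
move=> sf; have [su E] := resolventS2P sf; set u := resolventS2 f in su E *.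
have /smoothS2_sm [sr si] := su.
have Es x : nsq x = 1 -> reE u x - lap (reE u) x = reE f x /\ imE u x - lap (imE u) x = imE f x.
  move=> /S2_surj [t <-]; have := E t; rewrite laplS2E // !reE_S2 !imE_S2.
  by case: (u t) => a b <-.
exists (fun x => - lap (reE u) x), (fun x => - lap (imE u) x); split.
- exact/sm_opp/sm_lap.
- exact/sm_opp/sm_lap.
- by move=> t; rewrite /opQ laplS2E.
- by move=> l x x1; apply: proj_lap_resolvent => // y /Es [].
- by move=> l x x1; apply: proj_lap_resolvent => // y /Es [].
Qed.

Lemma integralS2E f U W : (forall t, f t = Complex (U (S2val t)) (W (S2val t))) ->
  integralS2 f = Complex (Isph U) (Isph W).
Proof.
move=> E; rewrite !IsphE; apply: eq_complex; rewrite /= IntE; congr (Rintegral _ _ _);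
  apply/funext => a; rewrite /reals_of /imags_of /polint IntE /=; congr (Rintegral _ _ _);
  apply/funext => b; rewrite /reals_of /imags_of E /=; ring.
Qed.

Lemma dist_of_funE f phi U W : sm U -> sm W -> smoothS2 phi ->
  (forall t, f t = Complex (U (S2val t)) (W (S2val t))) ->
  dist_of_fun f phi = Complex
    (Isph (fun x => U x * reE phi x) - Isph (fun x => W x * imE phi x))
    (Isph (fun x => U x * imE phi x) + Isph (fun x => W x * reE phi x)).
Proof.
move=> sU sW /smoothS2_sm [sr si] E.
rewrite -IB -?ID; try exact/sm_cnz/sm_mul.
apply: integralS2E => t; rewrite E !reE_S2 !imE_S2; case: (phi t) => a b /=.
by apply: eq_complex.
Qed.

(** The integral is a polynomial in t: each factor [dot t x] splits into coordinates, t_i leaving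
    the integral and x_i joining W. *)
Lemma sm_zonal_I (p : {poly R}) W : sm W -> sm (fun t : V => Isph (fun x => p.[dot t x] * W x)).
Proof.
elim/poly_ind: p W => [|q c IH] W sW.
  apply: (sm_eq (sm_cst 0)) => t _; rewrite -[LHS](mul0r (Isph W)) -IZ; last exact: sm_cnz.
  by apply: eq_I => x _; rewrite horner0.
have sxW i : sm (fun x => x i 0 * W x) by apply: sm_mul => //; exact: sm_coord.
have s1 : sm (fun t : V => \sum_i t i 0 * Isph (fun x => q.[dot t x] * (x i 0 * W x)) + c * Isph W).
  apply: sm_add; last exact: sm_cst.
  by apply: sm_sum => i; apply: sm_mul; [exact: sm_coord|exact: IH].
apply: (sm_eq s1) => t _.
have cz i : cnz (fun x => t i 0 * (q.[dot t x] * (x i 0 * W x))).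
  by apply/cnzZ/sm_cnz/sm_mul => //; exact: sm_zonal.
rewrite -IZ; last exact: sm_cnz.
rewrite (eq_bigr (fun i => Isph (fun x => t i 0 * (q.[dot t x] * (x i 0 * W x))))) => [|i _]; last first.
  by rewrite IZ //; apply/sm_cnz/sm_mul => //; exact: sm_zonal.
rewrite -I_sum // -ID; last 2 first.
- by apply: cnz_sum => i; exact: cz.
- exact/cnzZ/sm_cnz.
apply: eq_I => x _; rewrite !hornerE mulrDl; congr (_ + _).
rewrite -mulrA {2}/dot mulr_suml mulr_sumr; apply: eq_bigr => i _; ring.
Qed.

Lemma sm_proj l W : sm W -> sm (proj l W).
Proof. by move=> sW; apply: sm_scale; exact: sm_zonal_I. Qed.

Lemma I_proj_cvg U phi : sm U -> sm phi ->
  (fun n => \sum_(l < n) Isph (fun x => proj l U x * phi x)) @ \oo --> Isph (fun x => U x * phi x).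
Proof.
move=> sU sphi; have [C C0 HC] := proj_sum_uniform sU.
have [B B0 HB] := sphere_bounded (sm_cnz sphi).
have key n : `|Isph (fun x => U x * phi x) - \sum_(l < n) Isph (fun x => proj l U x * phi x)|
    <= 4 * pi * (C * B) * tele R n.
  have sp l : sm (fun x => proj l U x * phi x) by apply: sm_mul => //; exact: sm_proj.
  rewrite -I_sum => [|l]; last exact: sm_cnz.
  rewrite -IB; [|exact/sm_cnz/sm_mul|by apply: cnz_sum => l; exact: sm_cnz].
  rewrite -[leRHS]mulrA; apply: I_bound => [|x x1].
    apply: sm_cnz; apply: sm_sub; first exact: sm_mul.
    by apply: sm_sum => l.
  rewrite -mulr_suml -mulrBl normrM mulrAC.
  by apply: ler_pM => //; [exact: HC|exact: HB].
apply/cvgrPdist_le => e e0.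
have h : (fun n => 4 * pi * (C * B) * tele R n) @ \oo --> (4 * pi * (C * B) * 0 : R).
  by apply: cvgMl_tmp; exact: tele_cvg0.
near=> n; apply: le_trans (key n) _; near: n.
by apply: (cvgr_le _ h); rewrite mulr0.
Unshelve. all: by end_near. Qed.

End ComplexFunctions.

(** * Spherical harmonics *)

Section Harmonics.
Variable R : realType.
Local Notation V := 'cV[R]_3.
Implicit Types (U W : V -> R) (x v : V) (q : {poly R}).

Fixpoint zpow (m : nat) x : R * R :=
  if m is k.+1 then
    (x o0 0 * (zpow k x).1 - x o1 0 * (zpow k x).2, x o1 0 * (zpow k x).1 + x o0 0 * (zpow k x).2)
  else (1, 0).

(* Real and imaginary parts of (x_0 + i x_1)^m. *)
Definition Cm m x := (zpow m x).1.
Definition Sm m x := (zpow m x).2.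

Lemma sm_CS m : sm (Cm m) /\ sm (Sm m).
Proof.
elim: m => [|m [sC sS]]; first by split; exact: sm_cst.
by split; [apply: sm_sub|apply: sm_add]; apply: sm_mul => //; exact: sm_coord.
Qed.

Lemma sm_Cm m : sm (Cm m). Proof. by have [] := sm_CS m. Qed.
Lemma sm_Sm m : sm (Sm m). Proof. by have [] := sm_CS m. Qed.

(** The derivative of z^m is m z^(m-1); for m = 0 the predecessor is 0 and the factor m removes the
    term. *)
Lemma derive_CS m v x : x != 0 ->
  'D_v (Cm m) x = m%:R * (v o0 0 * Cm m.-1 x - v o1 0 * Sm m.-1 x) /\
  'D_v (Sm m) x = m%:R * (v o1 0 * Cm m.-1 x + v o0 0 * Sm m.-1 x).
Proof.
move=> x0; elim: m => [|m [IC IS]].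
  by split; rewrite mul0r; [exact: (derive_cst (1 : R))|exact: (derive_cst (0 : R))].
have sc i := @sm_coord R i; have sC := sm_Cm m; have sS := sm_Sm m.
have E1 : 'D_v (Cm m.+1) x = v o0 0 * Cm m x + x o0 0 * 'D_v (Cm m) x
    - (v o1 0 * Sm m x + x o1 0 * 'D_v (Sm m) x).
  rewrite (_ : Cm m.+1 = fun y => y o0 0 * Cm m y - y o1 0 * Sm m y) // derive_sub //; try exact: sm_mul.
  by rewrite (derive_mul v (sc o0) sC x0) (derive_mul v (sc o1) sS x0) !derive_coord.
have E2 : 'D_v (Sm m.+1) x = v o1 0 * Cm m x + x o1 0 * 'D_v (Cm m) x
    + (v o0 0 * Sm m x + x o0 0 * 'D_v (Sm m) x).
  rewrite (_ : Sm m.+1 = (fun y : V => y o1 0 * Cm m y) + (fun y : V => y o0 0 * Sm m y)) // deriveD; last 2 first.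
  - by apply: sm_derivable => //; exact: sm_mul.
  - by apply: sm_derivable => //; exact: sm_mul.
  by rewrite (derive_mul v (sc o1) sC x0) (derive_mul v (sc o0) sS x0) !derive_coord.
rewrite E1 E2 IC IS /= -(natr1 m); case: m {IC IS E1 E2 sC sS} => [|m] /=; first by split; ring.
by rewrite /Cm /Sm /=; split; ring.
Qed.

Lemma L_CS j k m x : x != 0 ->
  L j k (Cm m) x = m%:R * ((x j 0 * (k == o0)%:R - x k 0 * (j == o0)%:R) * Cm m.-1 x
    - (x j 0 * (k == o1)%:R - x k 0 * (j == o1)%:R) * Sm m.-1 x) /\
  L j k (Sm m) x = m%:R * ((x j 0 * (k == o1)%:R - x k 0 * (j == o1)%:R) * Cm m.-1 x
    + (x j 0 * (k == o0)%:R - x k 0 * (j == o0)%:R) * Sm m.-1 x).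
Proof.
move=> x0; rewrite !LE.
have [a1 a2] := derive_CS m (basis3 k) x0; have [b1 b2] := derive_CS m (basis3 j) x0.
by rewrite a1 a2 b1 b2 !basis3E !(eq_sym _ k) !(eq_sym _ j); split; ring.
Qed.

Lemma L_x2_mul j k U x : sm U -> x != 0 -> L j k (fun y => y o2 0 * U y) x =
  (x j 0 * (k == o2)%:R - x k 0 * (j == o2)%:R) * U x + x o2 0 * L j k U x.
Proof.
move=> sU x0; rewrite (L_mul j k (@sm_coord R o2) sU x0) LE !derive_coord !basis3E.
by rewrite !(eq_sym o2).
Qed.

Lemma L01_CS m x : x != 0 -> L o0 o1 (Cm m) x = - m%:R * Sm m x /\ L o0 o1 (Sm m) x = m%:R * Cm m x.
Proof.
move=> x0; have [-> ->] := L_CS o0 o1 m x0.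
by case: m => [|m] /=; rewrite ?mul0r ?oppr0 ?mul0r //; split; rewrite /Cm /Sm /=; ring.
Qed.

Lemma L12_CS m x : x != 0 -> L o1 o2 (Cm m) x = m%:R * (x o2 0 * Sm m.-1 x) /\
  L o1 o2 (Sm m) x = - m%:R * (x o2 0 * Cm m.-1 x).
Proof. by move=> x0; have [-> ->] := L_CS o1 o2 m x0; split=> /=; ring. Qed.

Lemma L20_CS m x : x != 0 -> L o2 o0 (Cm m) x = m%:R * (x o2 0 * Cm m.-1 x) /\
  L o2 o0 (Sm m) x = m%:R * (x o2 0 * Sm m.-1 x).
Proof. by move=> x0; have [-> ->] := L_CS o2 o0 m x0; split=> /=; ring. Qed.

(** (x_0 + i x_1)^m is a harmonic polynomial, homogeneous of degree m, whence the eigenvalue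
    -m(m+1). *)
Lemma lap_CS m x : x != 0 ->
  lap (Cm m) x = - (m * m.+1)%:R * Cm m x /\ lap (Sm m) x = - (m * m.+1)%:R * Sm m x.
Proof.
move=> x0; have sC := sm_Cm; have sS := sm_Sm.
have sx U : sm U -> sm (fun y => y o2 0 * U y) by move=> sU; apply: sm_mul => //; exact: sm_coord.
have [e1 e2] := L01_CS m x0; have [f1 f2] := L12_CS m.-1 x0; have [g1 g2] := L20_CS m.-1 x0.
have H01C : L o0 o1 (L o0 o1 (Cm m)) x = - m%:R * (m%:R * Cm m x).
  rewrite (@eq_L _ _ _ _ (fun y => - m%:R * Sm m y)) ?LZ ?e2 // => y y0.
  by have [] := L01_CS m y0.
have H01S : L o0 o1 (L o0 o1 (Sm m)) x = m%:R * (- m%:R * Sm m x).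
  rewrite (@eq_L _ _ _ _ (fun y => m%:R * Cm m y)) ?LZ ?e1 // => y y0.
  by have [] := L01_CS m y0.
have H12C : L o1 o2 (L o1 o2 (Cm m)) x =
    m%:R * (x o1 0 * Sm m.-1 x + x o2 0 * L o1 o2 (Sm m.-1) x).
  rewrite (@eq_L _ _ _ _ (fun y => m%:R * (y o2 0 * Sm m.-1 y))) // => [|y y0]; last first.
    by have [] := L12_CS m y0.
  by rewrite LZ ?L_x2_mul //=; [ring|exact: sx].
have H12S : L o1 o2 (L o1 o2 (Sm m)) x =
    - m%:R * (x o1 0 * Cm m.-1 x + x o2 0 * L o1 o2 (Cm m.-1) x).
  rewrite (@eq_L _ _ _ _ (fun y => - m%:R * (y o2 0 * Cm m.-1 y))) // => [|y y0]; last first.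
    by have [] := L12_CS m y0.
  by rewrite LZ ?L_x2_mul //=; [ring|exact: sx].
have H20C : L o2 o0 (L o2 o0 (Cm m)) x =
    m%:R * (- x o0 0 * Cm m.-1 x + x o2 0 * L o2 o0 (Cm m.-1) x).
  rewrite (@eq_L _ _ _ _ (fun y => m%:R * (y o2 0 * Cm m.-1 y))) // => [|y y0]; last first.
    by have [] := L20_CS m y0.
  by rewrite LZ ?L_x2_mul //=; [ring|exact: sx].
have H20S : L o2 o0 (L o2 o0 (Sm m)) x =
    m%:R * (- x o0 0 * Sm m.-1 x + x o2 0 * L o2 o0 (Sm m.-1) x).
  rewrite (@eq_L _ _ _ _ (fun y => m%:R * (y o2 0 * Sm m.-1 y))) // => [|y y0]; last first.
    by have [] := L20_CS m y0.
  by rewrite LZ ?L_x2_mul //=; [ring|exact: sx].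
rewrite !lapE H01C H01S H12C H12S H20C H20S f1 f2 g1 g2 natrM -(natr1 m).
by case: m {e1 e2 f1 f2 g1 g2 H01C H01S H12C H12S H20C H20S} => [|m] /=; split; rewrite ?mul0r ?oppr0 ?mul0r // /Cm /Sm /=; ring.
Qed.

Lemma lap_mul U W x : sm U -> sm W -> x != 0 -> lap (fun y => U y * W y) x =
  lap U x * W x + 2 * (L o0 o1 U x * L o0 o1 W x + L o1 o2 U x * L o1 o2 W x
    + L o2 o0 U x * L o2 o0 W x) + U x * lap W x.
Proof.
move=> sU sW x0.
have E j k : L j k (L j k (fun y => U y * W y)) x =
    L j k (L j k U) x * W x + 2 * (L j k U x * L j k W x) + U x * L j k (L j k W) x.
  have s1 : sm (fun y => L j k U y * W y) by apply: sm_mul => //; exact: sm_L.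
  have s2 : sm (fun y => U y * L j k W y) by apply: sm_mul => //; exact: sm_L.
  rewrite (@eq_L _ _ _ _ (fun y => L j k U y * W y + U y * L j k W y)) // => [|y y0]; last exact: L_mul.
  rewrite LD // !L_mul //; try exact: sm_L.
  by move: (L j k (L j k U) x) (L j k (L j k W) x) (L j k U x) (L j k W x) => a b c d; ring.
by rewrite !lapE !E; ring.
Qed.

Lemma sm_x2 q : sm (fun x => q.[x o2 0]).
Proof. by apply: sm_horner; exact: sm_coord. Qed.

Lemma lap_x2 q x : nsq x = 1 -> lap (fun y => q.[y o2 0]) x =
  (1 - x o2 0 ^+ 2) * q^`(2).[x o2 0] - 2 * x o2 0 * q^`().[x o2 0].
Proof.
move=> x1; have E y : dot (e3 R) y = y o2 0 by rewrite dotC dot_basis.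
have e1 : nsq (e3 R) = 1 by exact: nsq_e3.
rewrite -(E x) -lap_zonal //; congr (lap _ _); by apply/funext => y; rewrite E.
Qed.

(** In the Leibniz rule the cross terms give -2 m x_2 q' U. They raise the coefficient of -x_2 q'
    from 2 to 2(m+1), the one in the equation of the m-th derivative of P_l. *)
Lemma lap_assoc l m U x (q := (legendre R l)^`(m)) : U = Cm m \/ U = Sm m -> nsq x = 1 ->
  lap (fun y => q.[y o2 0] * U y) x = - (l * l.+1)%:R * (q.[x o2 0] * U x).
Proof.
move=> HU x1; have x0 := nsq1_neq0 x1.
have sU : sm U by case: HU => ->; [exact: sm_Cm|exact: sm_Sm].
have lU : lap U x = - (m * m.+1)%:R * U x by have [? ?] := lap_CS m x0; case: HU => ->.
have cross : x o1 0 * L o1 o2 U x - x o0 0 * L o2 o0 U x = - (m%:R * x o2 0 * U x).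
  have [a1 a2] := L12_CS m x0; have [b1 b2] := L20_CS m x0.
  by case: HU => ->; rewrite ?a1 ?a2 ?b1 ?b2; case: (m) => [|k] /=; rewrite ?mul0r ?oppr0 ?mulr0 ?mul0r ?subrr ?oppr0 // /Cm /Sm /=; ring.
have Lq j k : L j k (fun y => q.[y o2 0]) x = q^`().[x o2 0] * (x j 0 * (k == o2)%:R - x k 0 * (j == o2)%:R).
  rewrite (L_horner j k q (@sm_coord R o2) x0) LE !derive_coord !basis3E.
  by rewrite !(eq_sym o2).
rewrite lap_mul //; last exact: sm_x2.
have L01q : L o0 o1 (fun y => q.[y o2 0]) x = 0 by rewrite Lq /= !mulr0 subrr mulr0.
have L12q : L o1 o2 (fun y => q.[y o2 0]) x = q^`().[x o2 0] * x o1 0.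
  by rewrite Lq /= mulr0 subr0 mulr1.
have L20q : L o2 o0 (fun y => q.[y o2 0]) x = - (q^`().[x o2 0] * x o0 0).
  by rewrite Lq /= mulr0 sub0r mulr1 mulrN.
rewrite L01q L12q L20q lap_x2 // lU.
have ode := congr1 (fun p : {poly R} => p.[x o2 0]) (legendre_ode R l m); rewrite /= -/q in ode.
rewrite !(hornerD, hornerM, hornerN, hornerXn, hornerX, hornerC, horner_natr) in ode.
transitivity (- U x * 0 + 2 * q^`().[x o2 0] * (x o1 0 * L o1 o2 U x - x o0 0 * L o2 o0 U x
    + m%:R * x o2 0 * U x) - l%:R * l.+1%:R * q.[x o2 0] * U x); last first.
  by rewrite cross natrM; ring.
rewrite -[X in - U x * X]ode (_ : q^`(2) = q^`()^`()) // !natrM -(natr1 m).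
by move: (q^`()^`()) => q2; ring.
Qed.

End Harmonics.

(** * Normalized spherical harmonics as functions of x *)

Section HarmonicFunctions.
Variable R : realType.
Local Notation V := 'cV[R]_3.
Implicit Types (U W : V -> R) (x v : V) (q : {poly R}).

Definition Nlm (l k : nat) : R :=
  Num.sqrt (((2 * l + 1)%:R * (l - k)`!%:R) / (4 * pi * (l + k)`!%:R)).

(** The factor sin^k b e^(i k a) is written as the polynomial (x_0 + i x_1)^k, which makes Y_l^k
    visibly smooth at the poles; the two signs (-1)^k of the definition have cancelled. *)
Definition YC l k x : R := Nlm l k * (((legendre R l)^`(k)).[x o2 0] * Cm k x).
Definition YS l k x : R := Nlm l k * (((legendre R l)^`(k)).[x o2 0] * Sm k x).

Lemma sm_YC l k : sm (YC l k).
Proof. by apply: sm_scale; apply: sm_mul; [exact: sm_x2|exact: sm_Cm]. Qed.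

Lemma sm_YS l k : sm (YS l k).
Proof. by apply: sm_scale; apply: sm_mul; [exact: sm_x2|exact: sm_Sm]. Qed.

Definition eigen l U := sm U /\ forall x, nsq x = 1 -> lap U x = - (l * l.+1)%:R * U x.

Lemma eigenZ l (c : R) U : eigen l U -> eigen l (fun x => c * U x).
Proof.
move=> [sU eU]; split; first exact: sm_scale.
move=> x x1; rewrite (lap_mul (@sm_cst R c) sU (nsq1_neq0 x1)) eU //.
have E j k y : y != 0 -> L j k (cst c) y = 0.
  by move=> y0; rewrite LE !derive_cst !mulr0 subrr.
have x0 := nsq1_neq0 x1.
rewrite !E // !mul0r addr0 addr0 mulr0 addr0 lapE.
have E2 j k : L j k (L j k (cst c)) x = 0.
  by rewrite (@eq_L _ _ _ _ (cst 0)) // => [|y y0]; [rewrite LE !derive_cst !mulr0 subrr|rewrite E].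
by rewrite !E2 !addr0 mul0r add0r mulrCA.
Qed.

Lemma eigen_YC l k : eigen l (YC l k).
Proof.
apply: eigenZ; split; first by apply: sm_mul; [exact: sm_x2|exact: sm_Cm].
by move=> x x1; apply: lap_assoc => //; left.
Qed.

Lemma eigen_YS l k : eigen l (YS l k).
Proof.
apply: eigenZ; split; first by apply: sm_mul; [exact: sm_x2|exact: sm_Sm].
by move=> x x1; apply: lap_assoc => //; right.
Qed.

Lemma eigen_I_lap l U W : eigen l U -> sm W ->
  (l * l.+1)%:R ^+ 2 * Isph (fun x => U x * W x) = Isph (fun x => U x * lap (lap W) x).
Proof.
move=> [sU eU] sW.
have E W' : sm W' -> Isph (fun x => U x * lap W' x) = - (l * l.+1)%:R * Isph (fun x => U x * W' x).
  move=> sW'; rewrite -I_lap_sym // -IZ; last exact/sm_cnz/sm_mul.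
  by apply: eq_I => x x1; rewrite eU // mulrA.
by rewrite !E //; [ring|exact: sm_lap].
Qed.

Lemma CS_sph_vec k a b :
  Cm k (sph_vec a b : V) = sin b ^+ k * cos (k%:R * a) /\
  Sm k (sph_vec a b : V) = sin b ^+ k * sin (k%:R * a).
Proof.
elim: k => [|k [IC IS]]; first by rewrite /Cm /Sm /= !mul0r cos0 sin0 expr0 mul1r mulr0.
rewrite /Cm /Sm /= -/(Cm k _) -/(Sm k _) IC IS sph_vec0 sph_vec1 -natr1 mulrDl mul1r.
by rewrite sinD cosD exprS; split; ring.
Qed.

Lemma CS_sqr k x : nsq x = 1 -> Cm k x ^+ 2 + Sm k x ^+ 2 = (vpoly R k).[x o2 0].
Proof.
move=> /sph_vec_surj [a [b [_ _ <-]]]; have [-> ->] := CS_sph_vec k a b.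
rewrite sph_vec2 /vpoly horner_exp !hornerE /= -sin2cos2 -exprM mulnC exprM !exprMn.
by rewrite -mulrDr cos2Dsin2 mulr1.
Qed.

(** The sum of the squares no longer depends on the azimuth, which leaves the one-dimensional
    integral [assoc_norm]. *)
Lemma Y_norm l k : (k <= l)%N -> Isph (fun x => YC l k x ^+ 2 + YS l k x ^+ 2) = 1.
Proof.
move=> kl; set q := (legendre R l)^`(k).
rewrite (@eq_I _ _ (fun x => Nlm l k ^+ 2 * (vpoly R k * q ^+ 2).[x o2 0])) => [|x x1]; last first.
  rewrite hornerM -(CS_sqr k x1) horner_exp /YC /YS -/q; ring.
rewrite IZ; last exact/sm_cnz/sm_x2.
rewrite (@I_separate _ _ (cst 1) (fun b => (vpoly R k * q ^+ 2).[cos b])); last 3 first.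
- by move=> ?; exact: cst_continuous.
- by move=> b; apply: (@continuous_comp _ _ _ (@cos R)); [exact: continuous_cos|exact: continuous_horner].
- by move=> a b; rewrite sph_vec2 mul1r.
rewrite Int_cst ?(ltW (pi2_gt0 R)) // subr0 mul1r -/(J _).
have := assoc_norm R kl; rewrite -/q.
have p0 := pi_gt0 R.
have f1 : (0 : R) < (l - k)`!%:R by rewrite ltr0n fact_gt0.
have f2 : (0 : R) < (l + k)`!%:R by rewrite ltr0n fact_gt0.
have f3 : (0 : R) < (2 * l + 1)%:R by rewrite ltr0n addn1.
rewrite /Nlm sqr_sqrtr; last first.
  by apply: divr_ge0; rewrite ?mulr_ge0 ?(ltW f1) ?(ltW f2) ?(ltW f3) ?(ltW p0).
move: ((l - k)`!%:R : R) ((l + k)`!%:R : R) ((2 * l + 1)%:R : R) f1 f2 f3 (J _) (pi : R) p0 => A B D A0 B0 D0 j P P0 E.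
have -> : D * A / (4 * P * B) * (2 * P * j) = (j * (D * A)) / (2 * B).
  by have pn := lt0r_neq0 P0; have Bn := lt0r_neq0 B0; field; rewrite ?pn ?Bn.
by rewrite E divff // mulf_neq0 ?lt0r_neq0.
Qed.

(** From |U| <= (1 + U^2)/2, whose integral is at most (4 pi + 1)/2. *)
Lemma I_le_norm1 U W (C : R) : cnz U -> cnz W -> Isph (fun x => U x ^+ 2) <= 1 ->
  (forall x, nsq x = 1 -> `|W x| <= C) -> `|Isph (fun x => U x * W x)| <= (4 * pi + 1) / 2 * C.
Proof.
move=> cU cW U1 HC.
have C0 : 0 <= C by apply: le_trans (HC _ (nsq_e3 R)).
have c2 : cnz (fun x => U x ^+ 2) by apply: cnzM.
have c3 : cnz (fun x => 1 + U x ^+ 2) by apply: cnzD => //; exact: cnz_cst.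
apply: (@le_trans _ _ (Isph (fun x => C / 2 * (1 + U x ^+ 2)))).
  apply: le_normr_I => //; [exact: cnzM|exact: cnzZ|].
  move=> x x1; rewrite normrM.
  apply: (@le_trans _ _ (`|U x| * C)); first by apply: ler_wpM2l => //; exact: HC.
  rewrite mulrC -mulrA; apply: ler_wpM2l => //.
  rewrite -(real_normK (num_real (U x))).
  by have := sqr_ge0 (1 - `|U x|); lra.
rewrite IZ // (@ID _ (cst 1)) //; last exact: cnz_cst.
rewrite I_cst mulr1 mulrC [leRHS]mulrAC -[leRHS]mulrA [leLHS]mulrC [leRHS]mulrC.
by apply: ler_wpM2l; [rewrite divr_ge0|rewrite lerD2l].
Qed.

(* Real and imaginary parts of Y_l^m; Negz j is -(j+1). *)
Definition Yr (l : nat) (m : int) : V -> R :=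
  match m with Posz j => YC l j | Negz j => fun x => (-1) ^+ j.+1 * YC l j.+1 x end.
Definition Yi (l : nat) (m : int) : V -> R :=
  match m with Posz j => YS l j | Negz j => fun x => (-1) ^+ j * YS l j.+1 x end.

Lemma eigen_Yr l m : eigen l (Yr l m).
Proof. by case: m => j; [exact: eigen_YC|exact/eigenZ/eigen_YC]. Qed.

Lemma eigen_Yi l m : eigen l (Yi l m).
Proof. by case: m => j; [exact: eigen_YS|exact/eigenZ/eigen_YS]. Qed.

Lemma Y_norm_le l m : (absz m <= l)%N ->
  Isph (fun x => Yr l m x ^+ 2) <= 1 /\ Isph (fun x => Yi l m x ^+ 2) <= 1.
Proof.
have H k : (k <= l)%N -> Isph (fun x => YC l k x ^+ 2) <= 1 /\ Isph (fun x => YS l k x ^+ 2) <= 1.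
  move=> kl; have cC := sm_cnz (sm_YC l k); have cS := sm_cnz (sm_YS l k).
  have c1 : cnz (fun x => YC l k x ^+ 2) by apply: cnzM.
  have c2 : cnz (fun x => YS l k x ^+ 2) by apply: cnzM.
  rewrite -(Y_norm kl); split; apply: le_I => //; try exact: cnzD.
    by move=> x _; rewrite lerDl sqr_ge0.
  by move=> x _; rewrite lerDr sqr_ge0.
case: m => j /= jl; first exact: H.
have [h1 h2] := H _ jl; split.
  by rewrite (@eq_I _ _ (fun x => YC l j.+1 x ^+ 2)) // => x _; rewrite exprMn sqrr_sign mul1r.
by rewrite (@eq_I _ _ (fun x => YS l j.+1 x ^+ 2)) // => x _; rewrite exprMn sqrr_sign mul1r.
Qed.

Lemma anglesP (t : S2 R) : S2val t = sph_vec (angles t).1 (angles t).2 /\ 0 <= (angles t).2 <= pi.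
Proof.
rewrite /angles; set P := [set ab | _]; suff : exists ab, P ab.
  move=> [ab Pab]; have [_ h2 h3] := @xgetPex _ (0, 0) P (ex_intro _ ab Pab).
  by split=> //; rewrite -{1}h3.
have [a [b [a2 bp E]]] := sph_vec_surj (nsq_S2 t).
by exists (a, b); split=> //; apply: val_inj.
Qed.

(** [angles] returns some polar coordinates of t, and [CS_sph_vec] shows that the harmonic depends
    on t only, poles included. *)
Lemma harmonicE l m (t : S2 R) : (absz m <= l)%N ->
  Defs.harmonic l m t = Complex (Yr l m (S2val t)) (Yi l m (S2val t)).
Proof.
move=> ml; have [-> bpi] := anglesP t; rewrite /Defs.harmonic.
move: (angles t).1 (angles t).2 bpi => a b bpi.
have sb : Num.sqrt (1 - cos b ^+ 2) = sin b.
  by rewrite -sin2cos2 sqrtr_sqr ger0_norm // sin_ge0_pi.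
have pol k : assoc_legendre_nat l k (cos b) = (-1) ^+ k * sin b ^+ k * ((legendre R l)^`(k)).[cos b].
  by rewrite /assoc_legendre_nat sb.
case: m ml => k kl; rewrite /harmonic_angles /= /Yr /Yi /YC /YS.
  have [-> ->] := CS_sph_vec k a b; rewrite sph_vec2 pol.
  rewrite subzn // absz_nat -/(Nlm l k) -exprnP.
  have s1 : (-1) ^+ k * (-1) ^+ k = 1 :> R by rewrite -exprMn mulrNN mulr1 expr1n.
  have -> : (-1) ^+ k * Nlm l k * ((-1) ^+ k * sin b ^+ k * (legendre R l)^`(k).[cos b])
      = ((-1) ^+ k * (-1) ^+ k) * (Nlm l k * ((legendre R l)^`(k).[cos b] * sin b ^+ k)) by ring.
  rewrite s1 mul1r -pmulrn; apply: eq_complex => /=; ring.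
have [-> ->] := CS_sph_vec k.+1 a b; rewrite sph_vec2 pol.
have -> : absz (l%:Z + Negz k) = (l - k.+1)%N by rewrite NegzE subzn // absz_nat.
have f1 : (0 : R) < (l - k.+1)`!%:R by rewrite ltr0n fact_gt0.
have f2 : (0 : R) < (l + k.+1)`!%:R by rewrite ltr0n fact_gt0.
have p0 := pi_gt0 R; have pn := lt0r_neq0 p0; have f1n := lt0r_neq0 f1; have f2n := lt0r_neq0 f2.
(* The quotient of factorials in P_l^(-k) moves under the root and exchanges the two factorials of
   the normalization. *)
have E : Num.sqrt ((2 * l + 1)%:R * (l + k.+1)`!%:R / (4 * pi * (l - k.+1)`!%:R))
    * ((l - k.+1)`!%:R / (l + k.+1)`!%:R) = Nlm l k.+1.
  have c0 : 0 <= (l - k.+1)`!%:R / (l + k.+1)`!%:R :> R by rewrite divr_ge0 // ltW.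
  rewrite -[X in _ * X](ger0_norm c0) -sqrtr_sqr -sqrtrM; last first.
    by apply: divr_ge0; rewrite ?mulr_ge0 ?ler0n ?(ltW p0).
  congr Num.sqrt; move: f1n f2n; move: ((l - k.+1)`!%:R : R) ((l + k.+1)`!%:R : R) => A B An Bn.
  by move: (pi : R) pn => P Pn; field; rewrite ?Pn ?An ?Bn.
have sN : (-1) ^ Negz k = (-1) ^+ k.+1 :> R by rewrite /exprz -exprVn invrN1.
have s1 : (-1) ^+ k.+1 * (-1) ^+ k.+1 = 1 :> R by rewrite -exprMn mulrNN mulr1 expr1n.
have aE : (Negz k)%:~R * a = - (k.+1%:R * a) by rewrite NegzE mulrNz mulNr -pmulrn.
rewrite aE cosN sinN sN.
set S := Num.sqrt _ in E *.
have -> : (-1) ^+ k.+1 * S * ((-1) ^+ k.+1 * (l - k.+1)`!%:R / (l + k.+1)`!%:R *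
    ((-1) ^+ k.+1 * sin b ^+ k.+1 * (legendre R l)^`(k.+1).[cos b])) =
    ((-1) ^+ k.+1 * (-1) ^+ k.+1) * ((-1) ^+ k.+1 *
    ((S * ((l - k.+1)`!%:R / (l + k.+1)`!%:R)) * ((legendre R l)^`(k.+1).[cos b] * sin b ^+ k.+1))).
  ring.
rewrite s1 mul1r E; apply: eq_complex => /=; first by ring.
by rewrite [(-1) ^+ k.+1]exprS; ring.
Qed.

End HarmonicFunctions.

(** * The distribution h *)

Section HDistribution.
Variable R : realType.
Local Notation V := 'cV[R]_3.
Implicit Types (U W : V -> R) (x v : V) (Y : nat -> int -> V -> R) (f : S2 R -> R[i]).

(** All that the estimates require of the harmonics, stated so that the families of real and of
    imaginary parts are treated alike. *)
Definition normalized Y := (forall l m, eigen l (Y l m)) /\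
  forall l m, (absz m <= l)%N -> Isph (fun x => Y l m x ^+ 2) <= 1.

Lemma normalized_Yr : normalized (@Yr R).
Proof. by split=> l m; [exact: eigen_Yr|move=> /(@Y_norm_le R) []]. Qed.

Lemma normalized_Yi : normalized (@Yi R).
Proof. by split=> l m; [exact: eigen_Yi|move=> /(@Y_norm_le R) []]. Qed.

Definition hT Y l U : R :=
  coef_h R l * \sum_(k < (2 * l)%N.+1) Isph (fun x => Y l (k%:Z - l%:Z) x * U x).

Definition hfun Y n x : R :=
  \sum_(l < n) coef_h R l * \sum_(k < (2 * l)%N.+1) Y l (k%:Z - l%:Z) x.

Definition hlim Y U : R := limn (fun n => \sum_(l < n) hT Y l U).

Lemma absz_index l (k : 'I_(2 * l).+1) : (absz (k%:Z - l%:Z) <= l)%N.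
Proof.
have k2 : (k <= l + l)%N by have := ltn_ord k; rewrite ltnS [in leqRHS]mul2n -addnn.
have [lk|kl] := leqP l k.
  by rewrite subzn // absz_nat leq_subLR.
by rewrite distnC subzn ?(ltnW kl) // absz_nat leq_subr.
Qed.

Lemma sm_hfun Y n : normalized Y -> sm (hfun Y n).
Proof.
move=> [eY _]; apply: sm_sum => l; apply: sm_scale; apply: sm_sum => k.
by have [] := eY l (k%:Z - l%:Z).
Qed.

Lemma I_hfun Y n U : normalized Y -> sm U ->
  Isph (fun x => hfun Y n x * U x) = \sum_(l < n) hT Y l U.
Proof.
move=> [eY _] sU; have sY l m : sm (Y l m) by have [] := eY l m.
have s1 l (k : nat) : cnz (fun x => Y l (k%:Z - l%:Z) x * U x) by exact/sm_cnz/sm_mul.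
rewrite (@eq_I _ _ (fun x => \sum_(l < n) coef_h R l * \sum_(k < (2 * l).+1) (Y l (k%:Z - l%:Z) x * U x))).
  rewrite I_sum => [|l]; last by apply/cnzZ/cnz_sum => k.
  apply: eq_bigr => l _; rewrite IZ; last by apply: cnz_sum => k.
  by rewrite I_sum // => k.
move=> x _; rewrite /hfun mulr_suml; apply: eq_bigr => l _.
by rewrite -mulrA mulr_suml.
Qed.

Lemma hT_add Y l U W : normalized Y -> sm U -> sm W ->
  hT Y l (fun x => U x + W x) = hT Y l U + hT Y l W.
Proof.
move=> [eY _] sU sW; have sY m : sm (Y l m) by have [] := eY l m.
rewrite /hT -mulrDr -big_split; congr (_ * _); apply: eq_bigr => k _ /=.
rewrite -ID; [|exact/sm_cnz/sm_mul|exact/sm_cnz/sm_mul].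
by apply: eq_I => x _; rewrite mulrDr.
Qed.

Lemma hTZ Y l (c : R) U : normalized Y -> sm U -> hT Y l (fun x => c * U x) = c * hT Y l U.
Proof.
move=> [eY _] sU; have sY m : sm (Y l m) by have [] := eY l m.
rewrite /hT [RHS]mulrCA [X in _ = _ * X]mulr_sumr; congr (_ * _); apply: eq_bigr => k _ /=.
rewrite -IZ; last exact/sm_cnz/sm_mul.
by apply: eq_I => x _; rewrite mulrCA.
Qed.

Lemma coef_h_bound l : 0 <= coef_h R l <= Num.sqrt (2 * l + 1)%:R.
Proof.
have p1 : (1 : R) <= pi by have := pi_ge2 R; lra.
have p0 := pi_gt0 R.
have a0 : 0 <= coef_a R l by rewrite /coef_a mulr_ge0 ?invr_ge0 ?sqrtr_ge0 ?mulr_ge0 ?(ltW p0).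
have a1 : coef_a R l <= Num.sqrt (2 * l + 1)%:R.
  rewrite /coef_a -[leRHS]mul1r; apply: ler_pM; rewrite ?sqrtr_ge0 ?invr_ge0 ?mulr_ge0 ?(ltW p0) //.
    by rewrite invf_le1 ?mulr_gt0 //; lra.
  rewrite ler_wsqrtr // ler_pdivrMr ?mulr_gt0 // ler_peMr ?ler0n //; lra.
have q0 : (0 : R) <= (l * (l + 1))%:R by rewrite ler0n.
have q1 : (0 : R) < (l * (l + 1) + 1)%:R by rewrite ltr0n addn1.
rewrite /coef_h; apply/andP; split.
  by apply: divr_ge0; [exact: mulr_ge0|exact: ltW].
apply: le_trans a1; rewrite ler_pdivrMr // mulrC; apply: ler_wpM2l => //.
by rewrite ler_nat leq_addr.
Qed.

(** The root bounds [coef_h], 2l + 1 counts the values of m, and the square is gained from the two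
    Laplacians. The constant is 36 = 16 * 9/4, where 9/4 is the value of (2l+1)(l(l+1)+1) /
    (l(l+1))^2 at l = 1. *)
Lemma tele_coef l : (0 < l)%N ->
  Num.sqrt (2 * l + 1)%:R * ((2 * l + 1)%:R / (l * l.+1)%:R ^+ 2) <= 36 * (tele R l - tele R l.+1).
Proof.
move=> l0; have l1 : (1 : R) <= l%:R by rewrite ler1n.
have -> : 36 * (tele R l - tele R l.+1) = 9 / 4 * (16 * (tele R l - tele R l.+1)) by field.
apply: (@le_trans _ _ (9 / 4 * (resmul R l * Num.sqrt (2 * l + 1)%:R))); last first.
  by apply: ler_wpM2l; [lra|exact: sqrt_resmul_tele].
rewrite [leRHS]mulrA [leLHS]mulrC; apply: ler_wpM2r; first exact: sqrtr_ge0.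
rewrite /resmul !natrM -(natr1 l) natrD natrM; move: (l%:R : R) l1 => s s1.
have q2 : 0 < s * (s + 1) by nra.
rewrite ler_pdivrMr ?exprn_gt0 // mulrAC ler_pdivlMr; last by lra.
have -> : 9 / 4 * (s * (s + 1)) ^+ 2 = (3 / 2 * (s * (s + 1))) * (3 / 2 * (s * (s + 1))) by field.
by apply: ler_pM; nra.
Qed.

(* The Laplacian is moved twice from Y_l^m to the test function, which gains (l(l+1))^-2. *)
Lemma hT_dom Y U (S : R) : normalized Y -> sm U ->
  (forall x, nsq x = 1 -> `|lap (lap U) x| <= S) ->
  tele_dom (36 * ((4 * pi + 1) / 2 * S)) (hT Y ^~ U).
Proof.
move=> [eY nY] sU HS l; have S0 : 0 <= S by apply: le_trans (HS _ (nsq_e3 R)).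
have p0 := pi_gt0 R.
have M0 : 0 <= (4 * pi + 1) / 2 * S by rewrite mulr_ge0 ?divr_ge0 ?addr_ge0 ?mulr_ge0 ?(ltW p0).
rewrite mulrAC; set M := (4 * pi + 1) / 2 * S in M0 *.
(* At l = 0 the Laplacian gains nothing, but [coef_h] vanishes. *)
case: (posnP l) => [->|l0].
  rewrite /hT /coef_h !mul0n !mul0r normr0 mulr_ge0 // mulr_ge0 //.
  by rewrite subr_ge0 tele_noninc.
apply: le_trans (ler_wpM2r M0 (tele_coef l0)).
have [h0 h1] := andP (coef_h_bound l).
rewrite /hT normrM (ger0_norm h0) -[leRHS]mulrA; apply: ler_pM => //.
apply: le_trans (ler_norm_sum _ _ _) _.
have q0 : (0 : R) < (l * l.+1)%:R ^+ 2 by rewrite exprn_gt0 // ltr0n muln_gt0 l0.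
have -> : (2 * l + 1)%:R / (l * l.+1)%:R ^+ 2 * M = \sum_(k < (2 * l).+1) (M / (l * l.+1)%:R ^+ 2).
  rewrite sumr_const card_ord -[RHS]mulr_natl addn1; ring.
apply: ler_sum => k _; set m := (k%:Z - l%:Z).
rewrite ler_pdivlMr // mulrC -(ger0_norm (ltW q0)) -normrM eigen_I_lap //.
have [sY _] := eY l m.
by apply: I_le_norm1 => //; [exact: sm_cnz|exact/sm_cnz/sm_lap/sm_lap|apply: nY; exact: absz_index].
Qed.

Lemma hlim_cvg Y U : normalized Y -> sm U -> (fun n => \sum_(l < n) hT Y l U) @ \oo --> hlim Y U.
Proof.
move=> nY sU; have [S S0 HS] := sphere_bounded (sm_cnz (sm_lap (sm_lap sU))).
exact: (tele_dom_cvg (hT_dom nY sU HS)).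
Qed.

Lemma hlim_tail Y U (S : R) n : normalized Y -> sm U ->
  (forall x, nsq x = 1 -> `|lap (lap U) x| <= S) ->
  `|hlim Y U - \sum_(l < n) hT Y l U| <= 36 * ((4 * pi + 1) / 2 * S) * tele R n.
Proof. by move=> nY sU HS; apply: tele_dom_tail (hT_dom nY sU HS) (hlim_cvg nY sU). Qed.

Lemma hlim_bound Y U (S : R) : normalized Y -> sm U ->
  (forall x, nsq x = 1 -> `|lap (lap U) x| <= S) -> `|hlim Y U| <= 36 * ((4 * pi + 1) / 2 * S).
Proof.
move=> nY sU HS; have := hlim_tail 0 nY sU HS.
by rewrite big_ord0 subr0 /tele sqrtr1 invr1 mulr1.
Qed.

Lemma hlim_add Y U W : normalized Y -> sm U -> sm W ->
  hlim Y (fun x => U x + W x) = hlim Y U + hlim Y W.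
Proof.
move=> nY sU sW; apply: cvgn_unique (hlim_cvg nY (sm_add sU sW)) _.
rewrite (_ : (fun n => _) = (fun n => \sum_(l < n) hT Y l U + \sum_(l < n) hT Y l W)); last first.
  by apply/funext => n; rewrite -big_split; apply: eq_bigr => l _; rewrite hT_add.
by apply: cvgD; exact: hlim_cvg.
Qed.

Lemma hlimZ Y (c : R) U : normalized Y -> sm U -> hlim Y (fun x => c * U x) = c * hlim Y U.
Proof.
move=> nY sU; apply: cvgn_unique (hlim_cvg nY (sm_scale c sU)) _.
rewrite (_ : (fun n => _) = (fun n => c * \sum_(l < n) hT Y l U)); last first.
  by apply/funext => n; rewrite mulr_sumr; apply: eq_bigr => l _; rewrite hTZ.
by apply: cvgMl_tmp; exact: hlim_cvg.
Qed.

Lemma eq_hlim Y U W : (forall x, nsq x = 1 -> U x = W x) -> hlim Y U = hlim Y W.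
Proof.
move=> E; congr (limn _); apply/funext => n; apply: eq_bigr => l _.
by congr (_ * _); apply: eq_bigr => k _; apply: eq_I => x x1; rewrite E.
Qed.

Lemma h_partialE n t : h_partial (R:=R) n t =
  Complex (hfun (@Yr R) n (S2val t)) (hfun (@Yi R) n (S2val t)).
Proof.
have E l : \sum_(k < (2 * l).+1) Defs.harmonic l (k%:Z - l%:Z) t = Complex
   (\sum_(k < (2 * l).+1) Yr l (k%:Z - l%:Z) (S2val t)) (\sum_(k < (2 * l).+1) Yi l (k%:Z - l%:Z) (S2val t)).
  by apply: eq_complex; rewrite ?Re_sum ?Im_sum; apply: eq_bigr => k _; rewrite harmonicE ?absz_index.
apply: eq_complex; rewrite /h_partial ?Re_sum ?Im_sum; apply: eq_bigr => l _; rewrite E /=; ring.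
Qed.

Lemma dist_h_partial n phi : smoothS2 phi -> dist_of_fun (h_partial (R:=R) n) phi = Complex
  (\sum_(l < n) hT (@Yr R) l (reE phi) - \sum_(l < n) hT (@Yi R) l (imE phi))
  (\sum_(l < n) hT (@Yr R) l (imE phi) + \sum_(l < n) hT (@Yi R) l (reE phi)).
Proof.
move=> sphi; have nr := normalized_Yr; have ni := normalized_Yi.
rewrite (dist_of_funE (sm_hfun n nr) (sm_hfun n ni) sphi (h_partialE n)).
by have [sr si] := (smoothS2_sm phi).1 sphi; rewrite !I_hfun.
Qed.

Lemma h_dist_ccvg phi : smoothS2 phi -> ccvg (fun n => dist_of_fun (h_partial (R:=R) n) phi) (Complex
  (hlim (@Yr R) (reE phi) - hlim (@Yi R) (imE phi)) (hlim (@Yr R) (imE phi) + hlim (@Yi R) (reE phi))).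
Proof.
move=> sphi; have nr := normalized_Yr; have ni := normalized_Yi.
have [sr si] := (smoothS2_sm phi).1 sphi.
split.
  rewrite (_ : reals_of _ = fun n => \sum_(l < n) hT (@Yr R) l (reE phi) - \sum_(l < n) hT (@Yi R) l (imE phi)).
    by apply: cvgB; exact: hlim_cvg.
  by apply/funext => n; rewrite /reals_of dist_h_partial.
rewrite (_ : imags_of _ = fun n => \sum_(l < n) hT (@Yr R) l (imE phi) + \sum_(l < n) hT (@Yi R) l (reE phi)).
  by apply: cvgD; exact: hlim_cvg.
by apply/funext => n; rewrite /imags_of dist_h_partial.
Qed.

Lemma h_distE phi : smoothS2 phi -> h_dist phi = Complex
  (hlim (@Yr R) (reE phi) - hlim (@Yi R) (imE phi)) (hlim (@Yr R) (imE phi) + hlim (@Yi R) (reE phi)).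
Proof.
move=> /h_dist_ccvg [cr ci]; rewrite /h_dist /clim.
by apply: eq_complex; [exact: (cvg_lim (@Rhausdorff R) cr)|exact: (cvg_lim (@Rhausdorff R) ci)].
Qed.

Lemma normc_le (z : R[i]) (M : R) : `|z| <= M%:C%C -> `|complex.Re z| <= M /\ `|complex.Im z| <= M.
Proof.
case: z => a b; rewrite normc_def lecR /= => H.
by split; apply: le_trans H; rewrite -sqrtr_sqr ler_wsqrtr // ?lerDl ?lerDr sqr_ge0.
Qed.

Lemma le_normc (z : R[i]) (M : R) : `|complex.Re z| <= M -> `|complex.Im z| <= M ->
  `|z| <= (2 * M)%:C%C.
Proof.
case: z => a b /= aM bM; have M0 : 0 <= M by apply: le_trans aM.
rewrite normc_def lecR /= -(ger0_norm (_ : 0 <= 2 * M)) ?mulr_ge0 // -sqrtr_sqr ler_wsqrtr //.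
rewrite -(real_normK (num_real a)) -(real_normK (num_real b)).
by have := normr_ge0 a; have := normr_ge0 b; nra.
Qed.

Lemma smoothS2_lin (c : R[i]) phi psi : smoothS2 phi -> smoothS2 psi ->
  let chi := fun t : S2 R => c * phi t + psi t in
  [/\ smoothS2 chi,
   forall x, reE chi x = (complex.Re c * reE phi x + - complex.Im c * imE phi x) + reE psi x &
   forall x, imE chi x = (complex.Re c * imE phi x + complex.Im c * reE phi x) + imE psi x].
Proof.
move=> /smoothS2_sm [sr si] /smoothS2_sm [tr ti] chi.
have Er x : reE chi x = (complex.Re c * reE phi x + - complex.Im c * imE phi x) + reE psi x.
  rewrite /reE /imE /reals_of /imags_of /chi /ext0; clear chi.
  by case: c (phi _) (psi _) => [c d] [a b] [a' b'] /=; ring.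
have Ei x : imE chi x = (complex.Re c * imE phi x + complex.Im c * reE phi x) + imE psi x.
  rewrite /reE /imE /reals_of /imags_of /chi /ext0; clear Er chi.
  by case: c (phi _) (psi _) => [c d] [a b] [a' b'] /=; ring.
split=> //; apply/smoothS2_sm; split.
  apply: (@sm_eq _ (fun x => (complex.Re c * reE phi x + - complex.Im c * imE phi x) + reE psi x)) => [|x _].
    by apply: sm_add => //; apply: sm_add; exact: sm_scale.
  by rewrite Er.
apply: (@sm_eq _ (fun x => (complex.Re c * imE phi x + complex.Im c * reE phi x) + imE psi x)) => [|x _].
  by apply: sm_add => //; apply: sm_add; exact: sm_scale.
by rewrite Ei.
Qed.

Lemma h_dist_is_distribution : is_distribution (@h_dist R).
Proof.
have nr := normalized_Yr; have ni := normalized_Yi; split.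
  move=> c phi psi sphi spsi; have [schi Er Ei] := smoothS2_lin c sphi spsi.
  have [sr si] := (smoothS2_sm phi).1 sphi; have [tr ti] := (smoothS2_sm psi).1 spsi.
  have lin Y (a b : R) U W Z : normalized Y -> sm U -> sm W -> sm Z ->
      hlim Y (fun x => a * U x + b * W x + Z x) = a * hlim Y U + b * hlim Y W + hlim Y Z.
    move=> nY sU sW sZ; rewrite hlim_add //; last by apply: sm_add; exact: sm_scale.
    by rewrite hlim_add ?hlimZ //; exact: sm_scale.
  have ER : reE (fun t => c * phi t + psi t) = _ := funext Er.
  have EI : imE (fun t => c * phi t + psi t) = _ := funext Ei.
  rewrite !h_distE // ER EI !lin //.
  by apply: eq_complex; case: c {schi Er Ei ER EI} => a b /=; ring.
have [K K0 HK] := lap2_bound R; have p0 := pi_gt0 R.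
(* One factor 2 counts the two [hlim] terms in each of the real and imaginary parts; the other comes
   from [le_normc]. *)
exists 4%N, (2 * (2 * (36 * ((4 * pi + 1) / 2 * K)))) => phi M sphi HM.
have [sr si] := (smoothS2_sm phi).1 sphi.
have Hr x : nsq x = 1 -> `|lap (lap (reE phi)) x| <= K * M.
  move=> x1; apply: HK => // s s4; have [t <-] := S2_surj x1.
  by have [] := normc_le (HM s t s4).
have Hi x : nsq x = 1 -> `|lap (lap (imE phi)) x| <= K * M.
  move=> x1; apply: HK => // s s4; have [t <-] := S2_surj x1.
  by have [] := normc_le (HM s t s4).
set B := 36 * ((4 * pi + 1) / 2 * (K * M)).
have -> : 2 * (2 * (36 * ((4 * pi + 1) / 2 * K))) * M = 2 * (B + B) by rewrite /B; field.
rewrite h_distE //; apply: le_normc => /=.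
  by apply: le_trans (ler_normB _ _) _; apply: lerD; exact: hlim_bound.
by apply: le_trans (ler_normD _ _) _; apply: lerD; exact: hlim_bound.
Qed.

End HDistribution.

(** * Averaging over the rotation group *)

Section RiemannSums.
Variable R : realType.
Implicit Types (f : R -> R) (K T : R).

Definition lips K f := forall a b, `|f a - f b| <= K * `|a - b|.

Lemma lips_ge0 K f : lips K f -> 0 <= K.
Proof.
by move=> /(_ 1 0) H; have {H} := le_trans (normr_ge0 _) H; rewrite subr0 normr1 mulr1.
Qed.

Lemma lips_continuous K f : lips K f -> continuous f.
Proof.
move=> lf x; have K0 := lips_ge0 lf; apply/cvgrPdist_le => e e0.
have K1 : 0 < K + 1 by lra.
near=> y; apply: le_trans (lf x y) _.
have xy : `|x - y| <= e / (K + 1).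
  near: y; apply/nbhs_ballP; exists (e / (K + 1)); first by rewrite /= divr_gt0.
  by move=> y /ltW.
apply: (@le_trans _ _ ((K + 1) * (e / (K + 1)))); last by rewrite mulrC divfK // lt0r_neq0.
by apply: ler_pM => //; lra.
Unshelve. all: by end_near. Qed.

Lemma Int_split a c b f : continuous f -> a <= c -> c <= b ->
  Int a b f = Int a c f + Int c b f.
Proof.
move=> cf ac cb; rewrite addrC; apply/eqP; rewrite -subr_eq !IntE; apply/eqP.
rewrite Rintegral_itvB ?bnd_simp //; last exact: continuous_integrable.
rewrite Rintegral_itv_obnd_cbnd //; apply: integrableS (continuous_integrable c b cf) => //.
exact: subset_itv_oc_cc.
Qed.

(** Each of the n + 1 cells, of length h, costs at most K h^2. *)
Lemma riemann_sum K T f n : 0 <= T -> lips K f ->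
  `|Int 0 T f - \sum_(i < n.+1) T / n.+1%:R * f (T / n.+1%:R * i%:R)| <= K * T ^+ 2 / n.+1%:R.
Proof.
move=> T0 lf; have K0 := lips_ge0 lf; have cf := lips_continuous lf.
have n0 : (0 : R) < n.+1%:R by rewrite ltr0n.
set h := T / n.+1%:R; have h0 : 0 <= h by rewrite divr_ge0.
have Int0 a : Int a a f = 0.
  rewrite (@eq_Int _ _ _ _ (cst (f a))) => [|x ax]; first by rewrite Int_cst // subrr mulr0.
  by rewrite /cst (le_anti ax).
have key k : `|Int 0 (h * k%:R) f - \sum_(i < k) h * f (h * i%:R)| <= k%:R * (K * h * h).
  elim: k => [|k IH]; first by rewrite mulr0 big_ord0 mul0r Int0 subr0 normr0.
  have hk : h * k%:R <= h * k.+1%:R by apply: ler_wpM2l => //; rewrite ler_nat.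
  rewrite (@Int_split _ (h * k%:R)) ?mulr_ge0 // big_ord_recr /= opprD addrACA.
  rewrite -natr1 mulrDl mul1r; apply: le_trans (ler_normD _ _) _; apply: lerD => //.
  have E : h * (k%:R + 1) - h * k%:R = h by ring.
  have := @Int_cst R (h * k%:R) (h * k.+1%:R) (K * h) hk; rewrite -natr1 E => <-.
  have -> : h * f (h * k%:R) = Int (h * k%:R) (h * (k%:R + 1)) (cst (f (h * k%:R))).
    by rewrite Int_cst ?E ?natr1 // mulrC.
  have cc (c : R) : continuous (cst c : R -> R) by move=> ?; exact: cst_continuous.
  rewrite -mulN1r -IntZ // -IntD //; last exact: continuousZ_real.
  apply: le_normr_Int => [|//|x /andP[x1 x2]].
    by move=> x; apply: (@continuousD _ _ _ f (fun x => -1 * _)); [exact: cf|exact: continuousZ_real].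
  rewrite /cst mulN1r; apply: le_trans (lf _ _) _; apply: ler_wpM2l => //.
  rewrite ger0_norm; lra.
have := key n.+1; rewrite {1}/h mulrAC -mulrA divff ?lt0r_neq0 // mulr1.
move=> /le_trans; apply; rewrite le_eqVlt; apply/orP; left; apply/eqP.
by rewrite /h; field; rewrite lt0r_neq0.
Qed.

End RiemannSums.

(** * The Haar integral and its exchange with integrals over an interval *)

Section HaarIntegral.
Variable R : realType.
Variable mu : {measure set (SO3borel R) -> \bar R}.
Hypothesis mu_haar : haar_SO3 mu.
Local Notation V := 'cV[R]_3.
Local Notation G := (SO3borel R).
Implicit Types (f h : G -> R) (g k : SO3 R) (C K T : R).

Lemma sum_continuous_mx (W : normedModType R) (I : finType) (F : I -> 'M[R]_3 -> W) :
  (forall i, continuous (F i)) -> continuous (fun M => \sum_i F i M).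
Proof.
move=> cF; rewrite (_ : (fun M => _) = \sum_i F i); last by apply/funext => N; rewrite fct_sumE.
elim/big_ind : _ => [|u v cu cv N|i _]; [exact: cst_continuous| |exact: cF].
by apply: continuousD; [exact: cu|exact: cv].
Qed.

Lemma entries_continuous m n (F : 'M[R]_3 -> 'M[R]_(m.+1, n.+1)) :
  (forall i j, continuous (fun M => F M i j)) -> continuous F.
Proof.
move=> cF; rewrite (_ : F = fun M => \sum_i \sum_j F M i j *: delta_mx i j); last first.
  by apply/funext => N; exact: matrix_sum_delta.
apply: sum_continuous_mx => i; apply: sum_continuous_mx => j M.
exact: (cvgZr_tmp (cF i j M)).
Qed.

Lemma lin_entry_continuous (c : 'I_3 -> R) (a b : 'I_3 -> 'I_3) :
  continuous (fun M : 'M[R]_3 => \sum_l c l * M (a l) (b l)).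
Proof.
apply: (@sum_continuous_mx R^o) => l M.
exact: (cvgMl_tmp (@coord_continuous _ _ _ (a l) (b l) M)).
Qed.

Lemma mulmx_vec_continuous (y : V) : continuous (fun M : 'M[R]_3 => M *m y).
Proof.
apply: entries_continuous => i j; rewrite (_ : (fun M => _) = fun M : 'M[R]_3 => \sum_l y l j * M i l).
  exact: lin_entry_continuous.
by apply/funext => M; rewrite mxE; apply: eq_bigr => l _; rewrite mulrC.
Qed.

Lemma trmx_vec_continuous (y : V) : continuous (fun M : 'M[R]_3 => M^T *m y).
Proof.
apply: entries_continuous => i j; rewrite (_ : (fun M => _) = fun M : 'M[R]_3 => \sum_l y l j * M l i).
  exact: lin_entry_continuous.
by apply/funext => M; rewrite mxE; apply: eq_bigr => l _; rewrite mulrC mxE.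
Qed.

Lemma mulmx_left_continuous (N : 'M[R]_3) : continuous (fun M : 'M[R]_3 => N *m M).
Proof.
apply: entries_continuous => i j; rewrite (_ : (fun M => _) = fun M : 'M[R]_3 => \sum_l N i l * M l j).
  exact: lin_entry_continuous.
by apply/funext => M; rewrite mxE.
Qed.

Lemma SO3_isSO3 g : isSO3 (SO3val g).
Proof. by have /andP[/eqP ? /eqP ?] := SO3P g. Qed.

Lemma isSO3_surj M : isSO3 M -> exists g, SO3val g = M.
Proof.
move=> [MO dM]; have MP : (M^T *m M == 1%:M) && (\det M == 1) by rewrite MO dM !eqxx.
by exists (MkSO3 MP).
Qed.

Lemma measurable_SO3 (U : 'M[R]_3 -> R) : (forall g, {for SO3val g, continuous U}) ->
  measurable_fun setT (fun g : G => U (SO3val g)).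
Proof.
move=> cU; apply: (measurability _ (RGenOInfty.measurableE R)) => _ [_ [a ->] <-]; rewrite setTI.
(* U is continuous only at points of the group, so the preimage of the half-line is replaced by its
   interior, which has the same trace on the group. *)
rewrite (_ : _ @^-1` _ = @SO3val R @^-1` (interior (U @^-1` `]a, +oo[%classic))).
  by apply: sub_sigma_algebra; exists (interior (U @^-1` `]a, +oo[%classic)) => //=; exact: open_interior.
apply/seteqP; split=> g /=; last first.
  by move=> /interior_subset.
by move=> ag; apply: (cU g); apply: open_nbhs_nbhs; split=> //; exact: interval_open.
Qed.

Lemma measurable_left k : measurable_fun setT (SO3mul k : G -> G).
Proof.
suff S : preimage_set_system setT (SO3mul k : G -> G) (@SO3open R) `<=` (@measurable _ G).
  exact: (@measurability _ _ G G setT (SO3mul k) (@SO3open R) erefl S).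
move=> _ [_ [U oU <-] <-]; rewrite setTI.
apply: sub_sigma_algebra; exists ((fun M : 'M[R]_3 => SO3val k *m M) @^-1` U) => //=.
by move/continuousP : (@mulmx_left_continuous (SO3val k)); apply.
Qed.

Definition haarInt f : R := \int[mu]_(g in setT) f g.
Local Notation H := haarInt.

Definition bmeas f := measurable_fun setT f /\ exists C, forall g, `|f g| <= C.

Lemma haar_fin : (mu setT < +oo)%E.
Proof. by have [-> _] := mu_haar; rewrite ltry. Qed.

Lemma bm_integrable f : bmeas f -> mu.-integrable setT (EFin \o f : G -> \bar R).
Proof.
move=> [mf [C HC]]; apply: measurable_bounded_integrable => //; first exact: haar_fin.
exists C; split => [|M CM g _]; first exact: num_real.
by apply: le_trans (HC g) (ltW CM).
Qed.

Lemma bmD f h : bmeas f -> bmeas h -> bmeas (fun g => f g + h g).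
Proof.
move=> [mf [C HC]] [mh [D HD]]; split; first exact: measurable_funD.
by exists (C + D) => g; apply: le_trans (ler_normD _ _) _; apply: lerD.
Qed.

Lemma bmM f h : bmeas f -> bmeas h -> bmeas (fun g => f g * h g).
Proof.
move=> [mf [C HC]] [mh [D HD]]; split; first exact: measurable_funM.
by exists (C * D) => g; rewrite normrM; apply: ler_pM.
Qed.

Lemma bm_cst (c : R) : bmeas (fun _ => c).
Proof. by split; [exact: measurable_cst|exists `|c|]. Qed.

Lemma bmZ (c : R) f : bmeas f -> bmeas (fun g => c * f g).
Proof. exact/bmM/bm_cst. Qed.

Lemma bm_sum (I : finType) (F : I -> G -> R) : (forall i, bmeas (F i)) -> bmeas (fun g => \sum_i F i g).
Proof.
move=> bF; rewrite (_ : (fun g => _) = \sum_i F i); last by apply/funext => g; rewrite fct_sumE.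
by elim/big_ind : _ => //; [exact: bm_cst|move=> u v bu bv; exact: bmD].
Qed.

Lemma bm_eq f h : bmeas f -> (forall g, f g = h g) -> bmeas h.
Proof. by move=> bf E; rewrite (_ : h = f) //; apply/funext. Qed.

Lemma HD f h : bmeas f -> bmeas h -> H (fun g => f g + h g) = H f + H h.
Proof. by move=> bf bh; rewrite /haarInt RintegralD //; exact: bm_integrable. Qed.

Lemma HZ (c : R) f : bmeas f -> H (fun g => c * f g) = c * H f.
Proof. by move=> bf; rewrite /haarInt RintegralZl //; exact: bm_integrable. Qed.

Lemma H_cst (c : R) : H (fun _ => c) = c * (8 * pi ^+ 2).
Proof. by rewrite /haarInt Rintegral_cst //; have [-> _] := mu_haar. Qed.

Lemma H_sum (I : finType) (F : I -> G -> R) : (forall i, bmeas (F i)) ->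
  H (fun g => \sum_i F i g) = \sum_i H (F i).
Proof.
move=> bF; have : bmeas (fun g => \sum_i F i g) /\ H (fun g => \sum_i F i g) = \sum_i H (F i); last by case.
elim: (index_enum I) => [|i r [IB IH]].
  split; first by under eq_fun do rewrite big_nil; exact: bm_cst.
  by under eq_fun do rewrite big_nil; rewrite H_cst mul0r big_nil.
under eq_fun do rewrite big_cons; split; first exact: bmD.
by rewrite HD // IH big_cons.
Qed.

Lemma H_bound f C : bmeas f -> (forall g, `|f g| <= C) -> `|H f| <= 8 * pi ^+ 2 * C.
Proof.
move=> bf HC; rewrite mulrC -H_cst; apply: le_trans.
  by apply: le_normr_Rintegral => //; exact: bm_integrable.
apply: le_Rintegral => //; last exact: bm_integrable (bm_cst C).
apply: (@bm_integrable (fun g => `|f g|)); split; first exact: measurableT_comp bf.1.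
by exists C => g; rewrite normr_id.
Qed.

Lemma eq_H f h : (forall g, f g = h g) -> H f = H h.
Proof. by move=> E; congr (Rintegral _ _ _); apply/funext. Qed.

(** [haar_SO3] concerns images of sets and the pushforward measure preimages; surjectivity of the
    left translation passes from one to the other. *)
Lemma H_left k f : bmeas f -> H (fun g => f (SO3mul k g)) = H f.
Proof.
move=> [mf [C HC]]; have [_ inv] := mu_haar; have ml := measurable_left k.
have bk : bmeas (fun g => f (SO3mul k g)).
  by split; [exact: measurableT_comp mf ml|exists C => g; exact: HC].
rewrite /haarInt /Rintegral; congr fine.
have mEf : measurable_fun setT (EFin \o f : G -> \bar R) by exact/measurable_EFinP.
have := @integral_pushforward _ _ _ _ _ (SO3mul k : G -> G) ml mu setT (EFin \o f : G -> \bar R) mEf.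
rewrite preimage_setT => /(_ (bm_integrable bk) measurableT) <-.
apply: eq_measure_integral => A mA _.
have mpre : measurable ((SO3mul k : G -> G) @^-1` A).
  by rewrite -[X in measurable X]setTI; exact: ml.
transitivity (mu ((SO3mul k : G -> G) @^-1` A)); first by [].
rewrite -(inv k _ mpre); congr (mu _); apply/seteqP; split=> [g [k' Ak' <-] //|g Ag].
have [k' Ek'] := isSO3_surj (SO3_mul (SO3_tr (SO3_isSO3 k)) (SO3_isSO3 g)).
have E : SO3mul k k' = g.
  apply: val_inj; rewrite /= Ek' mulmxA orth_trmx ?mul1mx //.
  by have [] := SO3_isSO3 k.
by exists k' => //=; rewrite E.
Qed.

(* Fubini for F Lipschitz in the second variable, through Riemann sums. *)
Lemma H_exchange (F : G -> R -> R) T C K : 0 <= T -> (forall a, bmeas (F^~ a)) ->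
  (forall g a, `|F g a| <= C) -> (forall g, lips K (F g)) ->
  bmeas (fun g => Int 0 T (F g)) /\ H (fun g => Int 0 T (F g)) = Int 0 T (fun a => H (F^~ a)).
Proof.
move=> T0 bF FC FK; pose g0 : SO3 R := point; have K0 := lips_ge0 (FK g0).
have p0 : (0 : R) <= 8 * pi ^+ 2 by rewrite mulr_ge0 ?exprn_ge0 ?pi_ge0.
pose S (n : nat) (g : G) := \sum_(i < n.+1) T / n.+1%:R * F g (T / n.+1%:R * i%:R).
have rs n g : `|Int 0 T (F g) - S n g| <= K * T ^+ 2 / n.+1%:R by exact: riemann_sum.
have bS n : bmeas (S n) by apply: bm_sum => i; exact: bmZ.
(* The averaged function is Lipschitz too, with the total mass as a factor, so the same Riemann sums
   approximate both sides. *)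
have lH : lips (8 * pi ^+ 2 * K) (fun a => H (F^~ a)).
  move=> a b; rewrite -mulN1r -HZ // -HD //; last exact: bmZ.
  rewrite -mulrA; apply: H_bound => [|g]; first by apply: bmD => //; exact: bmZ.
  by rewrite mulN1r; exact: FK.
have lim0 D : (fun n => D / n.+1%:R) @ \oo --> (0 : R).
  rewrite -(mulr0 D); apply: cvgMl_tmp; exact: cvg_harmonic.
have mI : measurable_fun setT (fun g : G => Int 0 T (F g)).
  apply: (@measurable_fun_cvg _ G R setT S) => [n|g _]; first by have [] := bS n.
  apply/cvgrPdist_le => e e0; near=> n; apply: le_trans (rs n g) _.
  by near: n; apply: (cvgr_le _ (lim0 _)).
have bI : bmeas (fun g => Int 0 T (F g)).
  split=> //; exists (C * T) => g; have cF := lips_continuous (FK g).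
  have := @Int_cst R 0 T C T0; rewrite subr0 => <-.
  by apply: le_normr_Int => // x; exact: cst_continuous.
split=> //; apply/eqP; rewrite -subr_eq0 -normr_le0 leNgt; apply/negP => d0.
pose D := 2 * (8 * pi ^+ 2 * (K * T ^+ 2)).
have HD' n : `|H (fun g => Int 0 T (F g)) - Int 0 T (fun a => H (F^~ a))| <= D / n.+1%:R.
  have E1 : `|H (fun g => Int 0 T (F g)) - H (S n)| <= 8 * pi ^+ 2 * (K * T ^+ 2 / n.+1%:R).
    rewrite -[H (S n)]mul1r -mulNr -HZ // -HD //; last exact: bmZ.
    apply: H_bound => [|g]; first by apply: bmD => //; exact: bmZ.
    by rewrite mulN1r; exact: rs.
  have E2 : `|Int 0 T (fun a => H (F^~ a)) - H (S n)| <= 8 * pi ^+ 2 * K * T ^+ 2 / n.+1%:R.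
    rewrite /S H_sum => [|i]; last exact: bmZ.
    under [X in _ - X]eq_bigr do rewrite HZ //.
    exact: riemann_sum.
  apply: le_trans (ler_distD (H (S n)) _ _) _; rewrite [X in _ + X]distrC.
  by apply: le_trans (lerD E1 E2) _; rewrite /D le_eqVlt; apply/orP; left; apply/eqP; ring.
have [N _ HN] := cvgr_lt _ (lim0 D) _ d0.
by have := HN N (leqnn N); rewrite /= ltNge HD'.
Unshelve. all: by end_near. Qed.

End HaarIntegral.

(** * Averages over the group of functions on the sphere *)

Section Averages.
Variable R : realType.
Variable mu : {measure set (SO3borel R) -> \bar R}.
Hypothesis mu_haar : haar_SO3 mu.
Local Notation V := 'cV[R]_3.
Local Notation G := (SO3borel R).
Local Notation H := (haarInt mu).
Implicit Types (U W : V -> R) (x y z t : V) (g k : SO3 R) (Q : G -> V -> R).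

Lemma lips_of_derive (f f' : R -> R) (C : R) :
  (forall a : R, is_derive a 1 f (f' a)) -> (forall a, `|f' a| <= C) -> lips C f.
Proof.
move=> df fC a b; wlog ab : a b / a <= b.
  by move=> W; case/orP: (le_total a b) => ab; [|rewrite distrC [X in _ * X]distrC]; exact: W.
have [|c cab E] := @MVT_segment R f f' a b ab.
  by apply: continuous_subspaceT; exact: is_derive_continuous df.
by rewrite distrC E normrM [X in _ * X]distrC; apply: ler_wpM2r => //.
Qed.

Lemma lips_sin : lips 1 (@sin R).
Proof. by apply: (@lips_of_derive _ cos) => a; rewrite ler_norml cos_geN1 cos_le1. Qed.

Lemma lips_cos : lips 1 (@cos R).
Proof. by apply: (@lips_of_derive _ (fun a => - sin a)) => a; rewrite normrN ler_norml sin_geN1 sin_le1. Qed.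

Lemma lipsZ (C c : R) (f : R -> R) : lips C f -> `|c| <= 1 -> lips C (fun a => c * f a).
Proof.
move=> lf c1 a b; rewrite -mulrBr normrM -[leRHS]mul1r; apply: ler_pM => //.
Qed.

(** The l^1 distance, for which Lipschitz estimates add up coordinate by coordinate. *)
Definition dst x y := \sum_i `|x i 0 - y i 0|.

Lemma dst_sph_azimuth b a a' : dst (sph_vec a b) (sph_vec a' b) <= 3 * `|a - a'|.
Proof.
rewrite /dst sum_ord3 !sph_vec0 !sph_vec1 !sph_vec2 subrr normr0 addr0.
have sb : `|sin b| <= 1 by rewrite ler_norml sin_geN1 sin_le1.
have h1 := lipsZ lips_cos sb a a'; have h2 := lipsZ lips_sin sb a a'.
by have := normr_ge0 (a - a'); lra.
Qed.

Lemma dst_sph_polar a b b' : dst (sph_vec a b) (sph_vec a b') <= 3 * `|b - b'|.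
Proof.
rewrite /dst sum_ord3 !sph_vec0 !sph_vec1 !sph_vec2.
have ca : `|cos a| <= 1 by rewrite ler_norml cos_geN1 cos_le1.
have sa : `|sin a| <= 1 by rewrite ler_norml sin_geN1 sin_le1.
have h1 := lipsZ lips_sin ca b b'; have h2 := lipsZ lips_sin sa b b'; have h3 := lips_cos b b'.
have e c : sin b * c - sin b' * c = c * sin b - c * sin b' by ring.
by rewrite !e; move: (normr_ge0 (b - b')) h1 h2 h3; rewrite !mul1r; lra.
Qed.

(** For nearby points [taylor2] gives D + 2 C, as nsq d <= 2 dst on the sphere; for distant ones dst
    >= 1/2 and the sup bound B gives 2 B <= 4 B dst. *)
Lemma sphere_lipschitz W : sm W -> exists2 K : R, 0 <= K &
  forall x y, nsq x = 1 -> nsq y = 1 -> `|W x - W y| <= K * dst x y.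
Proof.
move=> sW; have [C C0 HC] := taylor2 sW; have [B B0 HB] := sphere_bounded (sm_cnz sW).
have [D D0 HD] : exists2 D : R, 0 <= D & forall x, nsq x = 1 -> forall i, `|'D_(basis3 i) W x| <= D.
  have c i : cnz (fun x => `|'D_(basis3 i) W x|) by apply: cnz_norm; exact/sm_cnz/sm_derive.
  have [D D0 HD] := sphere_bounded (cnz_sum (r := index_enum 'I_3) c).
  exists D => // x x1 i; apply: le_trans (HD x x1); rewrite [leRHS]ger0_norm ?sumr_ge0 //.
  by rewrite (bigD1 i) //= lerDl sumr_ge0.
exists (D + 2 * C + 4 * B); first by rewrite !addr_ge0 ?mulr_ge0.
move=> x y x1 y1; set d := x - y.
have dE : dst x y = \sum_i `|d i 0| by apply: eq_bigr => i _; rewrite !mxE.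
have s0 : 0 <= dst x y by apply: sumr_ge0.
have dle i : `|d i 0| <= dst x y by rewrite dE (bigD1 i) //= lerDl sumr_ge0.
have [small|large] := leP (nsq d) (1 / 4).
  have := HC y d y1 small; rewrite [y + d]addrC subrK => H1.
  have H2 : `|'D_d W y| <= D * dst x y.
    rewrite derive_basis; last exact: sm_diff (nsq1_neq0 y1).
    apply: le_trans (ler_norm_sum _ _ _) _; rewrite dE mulr_sumr; apply: ler_sum => i _.
    by rewrite normrM mulrC; apply: ler_wpM2r => //; exact: HD.
  have H3 : nsq d <= 2 * dst x y.
    rewrite /nsq dE mulr_sumr; apply: ler_sum => i _; rewrite -real_normK ?num_real //.
    apply: ler_wpM2r => //; rewrite !mxE; apply: le_trans (ler_normB _ _) _.
    by have := normr_coord_le1 i x1; have := normr_coord_le1 i y1; lra.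
  have H4 : C * nsq d <= C * (2 * dst x y) by exact: ler_wpM2l.
  have H5 : 0 <= B * dst x y by exact: mulr_ge0.
  move: H1 H2; rewrite !ler_norml => /andP[? ?] /andP[? ?]; apply/andP; split; lra.
have H1 : 1 / 2 <= dst x y.
  have : nsq d <= dst x y ^+ 2.
    rewrite [leRHS]expr2 {1}dE mulr_suml; apply: ler_sum => i _; rewrite -real_normK ?num_real //.
    exact: ler_wpM2l.
  move=> h; rewrite leNgt; apply/negP => h2; have := lt_le_trans large h; nra.
have hx := HB x x1; have hy := HB y y1.
apply: le_trans (ler_normB _ _) _.
have h1 : 0 <= (D + 2 * C) * dst x y by rewrite mulr_ge0 ?addr_ge0 ?mulr_ge0.
have h2 : 4 * B * (1 / 2) <= 4 * B * dst x y by apply: ler_wpM2l => //; rewrite mulr_ge0.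
by rewrite mulrDl; lra.
Qed.

(** What [H_exchange] needs in both polar coordinates, in a form stable under products. *)
Definition lipmeas Q := [/\ exists C : R, forall g x, nsq x = 1 -> `|Q g x| <= C,
  exists2 K : R, 0 <= K & forall g x y, nsq x = 1 -> nsq y = 1 -> `|Q g x - Q g y| <= K * dst x y &
  forall x, nsq x = 1 -> measurable_fun setT (fun g : G => Q g x)].

Lemma lipmeas_bm Q x : lipmeas Q -> nsq x = 1 -> bmeas (fun g => Q g x).
Proof. by move=> [[C HC] _ mQ] x1; split; [exact: mQ|exists C => g; exact: HC]. Qed.

Lemma lipmeas_mul Q Q' : lipmeas Q -> lipmeas Q' -> lipmeas (fun g x => Q g x * Q' g x).
Proof.
move=> [[C HC] [K K0 HK] mQ] [[C' HC'] [K' K'0 HK'] mQ'].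
have C0 : 0 <= C by apply: le_trans (HC point _ (nsq_e3 R)).
have C'0 : 0 <= C' by apply: le_trans (HC' point _ (nsq_e3 R)).
split.
- by exists (C * C') => g x x1; rewrite normrM; apply: ler_pM => //; [exact: HC|exact: HC'].
- exists (C * K' + K * C'); first by rewrite addr_ge0 ?mulr_ge0.
  move=> g x y x1 y1.
  have -> : Q g x * Q' g x - Q g y * Q' g y = Q g x * (Q' g x - Q' g y) + (Q g x - Q g y) * Q' g y.
    by ring.
  apply: le_trans (ler_normD _ _) _; rewrite !normrM mulrDl -[C * K' * _]mulrA -[K * C' * _]mulrAC.
  by apply: lerD; apply: ler_pM => //; [exact: HC|exact: HK'|exact: HK|exact: HC'].
- by move=> x x1; apply: measurable_funM; [exact: mQ|exact: mQ'].
Qed.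

Lemma lipmeas_group (f : G -> R) : bmeas f -> lipmeas (fun g _ => f g).
Proof.
move=> [mf [C HC]]; split; [by exists C|exists 0 => // g x y _ _|by []].
by rewrite subrr normr0 mul0r.
Qed.

Lemma lipmeas_sphere U : sm U -> lipmeas (fun _ x => U x).
Proof.
move=> sU; have [C C0 HC] := sphere_bounded (sm_cnz sU); have [K K0 HK] := sphere_lipschitz sU.
by split; [exists C|exists K|move=> x _; exact: measurable_cst].
Qed.

Lemma orth_entry_le1 g i j : `|SO3val g i j| <= 1.
Proof.
have [MO _] := SO3_isSO3 g.
have n1 : nsq (SO3val g *m basis3 j) = 1.
  by rewrite nsq_orth // /nsq (bigD1 j) //= big1 => [|l lj]; rewrite basis3E ?eqxx ?expr1n ?addr0 // (negbTE lj) expr0n.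
by have := normr_coord_le1 i n1; rewrite /basis3 -colE mxE.
Qed.

Lemma dst_tr g x y : dst ((SO3val g)^T *m x) ((SO3val g)^T *m y) <= 3 * dst x y.
Proof.
have H1 i : `|((SO3val g)^T *m x) i 0 - ((SO3val g)^T *m y) i 0| <= dst x y.
  rewrite !mxE -sumrB; apply: le_trans (ler_norm_sum _ _ _) _; apply: ler_sum => j _.
  by rewrite -mulrBr normrM mxE -[leRHS]mul1r; apply: ler_wpM2r => //; exact: orth_entry_le1.
by rewrite {1}/dst sum_ord3; have := H1 o0; have := H1 o1; have := H1 o2; lra.
Qed.

Lemma nsq_tr g x : nsq ((SO3val g)^T *m x) = nsq x.
Proof. by have [MO _] := SO3_tr (SO3_isSO3 g); rewrite nsq_orth. Qed.

Lemma nsq_SO3 g x : nsq (SO3val g *m x) = nsq x.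
Proof. by have [MO _] := SO3_isSO3 g; rewrite nsq_orth. Qed.

Lemma lipmeas_rot W : sm W -> lipmeas (fun g x => W ((SO3val g)^T *m x)).
Proof.
move=> sW; have [C C0 HC] := sphere_bounded (sm_cnz sW); have [K K0 HK] := sphere_lipschitz sW.
split.
- by exists C => g x x1; apply: HC; rewrite nsq_tr.
- exists (K * 3); first by rewrite mulr_ge0.
  move=> g x y x1 y1; apply: le_trans (HK _ _ _ _) _; rewrite ?nsq_tr // -mulrA.
  by apply: ler_wpM2l => //; exact: dst_tr.
move=> x x1; apply: (@measurable_SO3 R (fun M => W (M^T *m x))) => g.
apply: continuous_comp; first exact: trmx_vec_continuous.
by apply: sm_continuous => //; apply: nsq1_neq0; rewrite nsq_tr.
Qed.

Lemma bm_rot W (M : 'M[R]_3) x : sm W -> isSO3 M -> nsq x = 1 -> bmeas (fun g : G => W (M *m (SO3val g *m x))).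
Proof.
move=> sW SM x1; have sWM : sm (fun y => W (M *m y)) by apply: sm_orth => //; case: SM.
have [C C0 HC] := sphere_bounded (sm_cnz sWM).
split; last by exists C => g; apply: HC; rewrite nsq_SO3.
apply: (@measurable_SO3 R (fun N => W (M *m (N *m x)))) => g.
apply: (@continuous_comp _ _ _ (fun N : 'M[R]_3 => N *m x) (fun y => W (M *m y))).
  exact: mulmx_vec_continuous.
by apply: sm_continuous => //; apply: nsq1_neq0; rewrite nsq_SO3.
Qed.

(** [H_exchange] twice, in the polar angle and then in the azimuth; the inner integral inherits the
    Lipschitz bound in a. *)
Lemma H_Isph Q : lipmeas Q -> bmeas (fun g => Isph (Q g)) /\ H (fun g => Isph (Q g)) = Isph (fun x => H (fun g => Q g x)).
Proof.
move=> lQ; have [[C HC] [K K0 HK] mQ] := lQ.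
have C0 : 0 <= C by apply: le_trans (HC point _ (nsq_e3 R)).
have p0 := pi_ge0 R; have s1 a b : nsq (sph_vec a b : V) = 1 by exact: nsq_sph_vec.
have sb b : `|sin b| <= 1 :> R by rewrite ler_norml sin_geN1 sin_le1.
pose F a g b := sin b * Q g (sph_vec a b).
have lF a g : lips (C + K * 3) (F a g).
  move=> b b'; rewrite /F.
  have -> : sin b * Q g (sph_vec a b) - sin b' * Q g (sph_vec a b') =
     (sin b - sin b') * Q g (sph_vec a b) + sin b' * (Q g (sph_vec a b) - Q g (sph_vec a b')) by ring.
  apply: le_trans (ler_normD _ _) _; rewrite !normrM mulrDl; apply: lerD.
    by rewrite mulrC; apply: ler_pM => //; [exact: HC|have := lips_sin b b'; rewrite mul1r].
  rewrite -[leRHS]mul1r; apply: ler_pM => //.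
  apply: le_trans (HK g _ _ (s1 a b) (s1 a b')) _; rewrite -mulrA; apply: ler_wpM2l => //.
  exact: dst_sph_polar.
have bF a b : bmeas (fun g => F a g b) by apply: bmZ; apply: lipmeas_bm.
have FC a g b : `|F a g b| <= C.
  by rewrite /F normrM -[C]mul1r; apply: ler_pM => //; exact: HC.
have E1 a := H_exchange mu_haar p0 (bF a) (FC a) (lF a).
pose F2 g a := Int 0 pi (F a g).
have p2 : 0 <= 2 * pi :> R by rewrite mulr_ge0.
have cF a g := lips_continuous (lF a g).
have FC2 g a : `|F2 g a| <= C * pi.
  have := @Int_cst R 0 pi C p0; rewrite subr0 => <-.
  by apply: le_normr_Int => [|x|b _]; [exact: cF|exact: cst_continuous|exact: FC].
have lF2 g : lips (K * 3 * pi) (F2 g).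
  move=> a a'; rewrite /F2 -mulN1r -IntZ // -IntD //; last exact: continuousZ_real.
  have := @Int_cst R 0 pi (K * 3 * `|a - a'|) p0; rewrite subr0 [RHS]mulrAC => <-.
  apply: le_normr_Int => [b|b|b _]; [|exact: cst_continuous|].
    by apply: (@continuousD _ _ _ (F a g) (fun b => -1 * F a' g b)); [exact: cF|exact: continuousZ_real].
  rewrite mulN1r /F -mulrBr normrM -[leRHS]mul1r; apply: ler_pM => //.
  apply: le_trans (HK g _ _ (s1 a b) (s1 a' b)) _; rewrite -mulrA; apply: ler_wpM2l => //.
  exact: dst_sph_azimuth.
have [b2 E2] := H_exchange mu_haar p2 (fun a => (E1 a).1) FC2 lF2.
have IE g : Isph (Q g) = Int 0 (2 * pi) (F2 g) by rewrite IsphE.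
split; first by rewrite (_ : (fun g => _) = fun g => Int 0 (2 * pi) (F2 g)) //; apply/funext.
rewrite (eq_H _ IE) E2 IsphE; apply: eq_Int => a _; rewrite (E1 a).2.
by apply: eq_Int => b _; rewrite /F HZ //; exact: lipmeas_bm.
Qed.

(* Left invariance makes the left-hand side constant in y; averaging it over the sphere
   evaluates it. *)
Lemma H_average W y : sm W -> nsq y = 1 -> H (fun g => W ((SO3val g)^T *m y)) = 2 * pi * Isph W.
Proof.
move=> sW; have lQ := lipmeas_rot sW.
pose P x := H (fun g => W ((SO3val g)^T *m x)).
have inv k x : nsq x = 1 -> P (SO3val k *m x) = P x.
  move=> x1; rewrite /P -(H_left mu_haar k) => [|]; last by apply: (lipmeas_bm lQ); rewrite nsq_SO3.
  apply: eq_H => g; rewrite /= trmx_mul -mulmxA (mulmxA (SO3val k)^T).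
  by have [-> _] := SO3_isSO3 k; rewrite mul1mx.
have cP x : nsq x = 1 -> P x = P (e3 R).
  move=> /SO3_to_pole [M /isSO3_surj [k <-] ->]; exact: inv (nsq_e3 R).
have [_ E] := H_Isph lQ.
have p0 := pi_gt0 R.
(* Both sides are the integral of the constant function P over the sphere: after the exchange, every
   g contributes [Isph W]. *)
have : 4 * pi * P (e3 R) = Isph W * (8 * pi ^+ 2).
  rewrite -I_cst -(H_cst mu_haar) (@eq_I _ _ P) => [|x /cP ->//].
  rewrite -E; apply: eq_H => g; apply: (I_SO3 (SO3_tr (SO3_isSO3 g)) sW).
move=> E4 /cP; rewrite /P => ->; rewrite -/(P _).
apply: (mulfI (_ : 4 * pi != 0)); first by rewrite mulf_neq0 // lt0r_neq0.
by rewrite E4; ring.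
Qed.

End Averages.

(** * Averaging over the rotations about the axis *)

Section GroupConvolution.
Variable R : realType.
Variable mu : {measure set (SO3borel R) -> \bar R}.
Hypothesis mu_haar : haar_SO3 mu.
Local Notation V := 'cV[R]_3.
Local Notation G := (SO3borel R).
Local Notation H := (haarInt mu).
Implicit Types (U W : V -> R) (x y z t : V) (g k : SO3 R) (Q : G -> V -> R).

Lemma isSO3_rotz c : isSO3 (rotz c : 'M[R]_3).
Proof. exact: SO3_rot3. Qed.

Lemma rotzD a b : rotz a *m rotz b = rotz (a + b) :> 'M[R]_3.
Proof.
apply/matrixP => i j; have E (M N : 'M[R]_3) : (forall x : V, M *m x = N *m x) -> M i j = N i j.
  move=> MN; have /(congr1 (fun x : V => x i 0)) := MN (basis3 j).
  by rewrite /basis3 -!colE !mxE.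
apply: E => x; rewrite -mulmxA; have [a0 a1 a2] := rotz_vec a (rotz b *m x).
have [b0 b1 b2] := rotz_vec b x; have [c0 c1 c2] := rotz_vec (a + b) x.
by apply: vec3P; rewrite ?a0 ?a1 ?a2 ?b0 ?b1 ?b2 ?c0 ?c1 ?c2 // ?cosD ?sinD; ring.
Qed.

Lemma rotz_dst x c c' : nsq x = 1 -> dst (rotz c *m x) (rotz c' *m x) <= 4 * `|c - c'|.
Proof.
move=> x1; rewrite /dst sum_ord3.
have [-> -> ->] := rotz_vec c x; have [-> -> ->] := rotz_vec c' x.
have n0 := normr_coord_le1 o0 x1; have n1 := normr_coord_le1 o1 x1.
have h1 := lipsZ (@lips_cos R) n0 c c'; have h2 := lipsZ (@lips_cos R) n1 c c'.
have h3 := lipsZ (@lips_sin R) n0 c c'; have h4 := lipsZ (@lips_sin R) n1 c c'.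
move: (x o0 0) (x o1 0) h1 h2 h3 h4 => p q h1 h2 h3 h4.
rewrite subrr normr0 addr0.
have -> : cos c * p - sin c * q - (cos c' * p - sin c' * q) = (p * cos c - p * cos c') - (q * sin c - q * sin c') by ring.
have -> : sin c * p + cos c * q - (sin c' * p + cos c' * q) = (p * sin c - p * sin c') + (q * cos c - q * cos c') by ring.
have t1 := ler_normB (p * cos c - p * cos c') (q * sin c - q * sin c').
have t2 := ler_normD (p * sin c - p * sin c') (q * cos c - q * cos c').
by rewrite !mul1r in h1 h2 h3 h4; lra.
Qed.

Lemma lips_rotz W x : sm W -> nsq x = 1 -> exists C : R, lips C (fun c => W (rotz c *m x)).
Proof.
move=> sW x1; have [K K0 HK] := sphere_lipschitz sW; exists (K * 4) => c c'.
have n c0 : nsq (rotz c0 *m x) = 1 by rewrite nsq_orth //; exact: rotz_orth.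
by apply: le_trans (HK _ _ (n c) (n c')) _; rewrite -mulrA; apply: ler_wpM2l => //; exact: rotz_dst.
Qed.

Lemma is_derive_rotz W x (c : R) : sm W -> nsq x = 1 ->
  is_derive c 1 (fun c : R => W (rotz c *m x)) (L o0 o1 W (rotz c *m x)).
Proof.
move=> sW x1; set y := rotz c *m x.
have y0 : y != 0 by apply: nsq1_neq0; rewrite nsq_orth //; exact: rotz_orth.
rewrite -derive_gen; last exact: sm_diff.
apply: (is_derive_path (g := fun c : R => rotz c *m x)) => [i|]; last exact: sm_diff.
have [E0 E1 E2] : [/\ (gen o0 o1 *m y) o0 0 = - y o1 0, (gen o0 o1 *m y) o1 0 = y o0 0
    & (gen o0 o1 *m y) o2 0 = 0].
  by rewrite gen_mul; split; rewrite !mxE /=; ring.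
have [b0 b1 b2] := rotz_vec c x.
case: (ord3P i) => ->; rewrite ?E0 ?E1 ?E2 /y ?b0 ?b1 ?b2.
- rewrite (_ : (fun s => _) = fun s => cos s * x o0 0 - sin s * x o1 0); last first.
    by apply/funext => s; have [] := rotz_vec s x.
  by apply: is_derive_eq; rewrite /GRing.scale /=; ring.
- rewrite (_ : (fun s => _) = fun s => sin s * x o0 0 + cos s * x o1 0); last first.
    by apply/funext => s; have [] := rotz_vec s x.
  by apply: is_derive_eq; rewrite /GRing.scale /=; ring.
rewrite (_ : (fun s => _) = cst (x o2 0)); last first.
  by apply/funext => s; have [] := rotz_vec s x.
exact: is_derive_cst.
Qed.

Lemma rotz_2pi : rotz (2 * pi) = 1%:M :> 'M[R]_3.
Proof.
apply/matrixP => i j; have E (M N : 'M[R]_3) : (forall x : V, M *m x = N *m x) -> M i j = N i j.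
  move=> MN; have /(congr1 (fun x : V => x i 0)) := MN (basis3 j).
  by rewrite /basis3 -!colE !mxE.
apply: E => x; rewrite mul1mx; have [a0 a1 a2] := rotz_vec (2 * pi) x.
by apply: vec3P; rewrite ?a0 ?a1 ?a2 // mulr_natl sin2pi cos2pi; ring.
Qed.

(** The derivative in the shift is the integral of an exact derivative over a full period, hence
    zero. *)
Lemma Int_rotz_shift W x d : sm W -> nsq x = 1 ->
  Int 0 (2 * pi) (fun c => W (rotz c *m (rotz d *m x))) = Int 0 (2 * pi) (fun c => W (rotz c *m x)).
Proof.
move=> sW x1; have sL := sm_L o0 o1 sW; have p2 := pi2_gt0 R.
have [C C0 HC] := sphere_bounded (sm_cnz sL).
have n c : nsq (rotz c *m x) = 1 by rewrite nsq_orth //; exact: rotz_orth.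
pose u (d c : R) := W (rotz (c + d) *m x).
pose u' (d c : R) := L o0 o1 W (rotz (c + d) *m x).
have dsh (e c : R) : is_derive c 1 (fun c : R => c + e) 1.
  by apply: is_derive_eq; rewrite addr0.
have du (c e : R) : is_derive c 1 (u e) (u' e c).
  have := is_derive1_comp (f := fun c => W (rotz c *m x)) (g := fun s => s + e) (is_derive_rotz (c + e) sW x1) (dsh e c).
  by rewrite /GRing.scale /= mulr1 => h; exact: h.
have du2 (c e : R) : is_derive e 1 (u^~ c) (u' e c).
  rewrite (_ : u^~ c = u c); first by rewrite /u' addrC; exact: du.
  by apply/funext => s; rewrite /u addrC.
have cu e : continuous (u e) := @is_derive_continuous R (u e) (u' e) (du^~ e).
have cu' e : continuous (u' e).
  have [K lK] := lips_rotz sL x1.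
  by apply: (@lips_continuous _ K) => a b; have := lK (a + e) (b + e); rewrite opprD addrACA subrr addr0.
have dI (e : R) : is_derive e 1 (fun e : R => Int 0 (2 * pi) (u e)) 0.
  have := @Int_derive_param R u u' 0 (2 * pi) C cu (fun e c => du2 c e) _ e.
  rewrite (_ : Int 0 (2 * pi) (u' e) = 0); first by apply=> *; exact: HC.
  have -> : Int 0 (2 * pi) (u' e) = u e (2 * pi) - u e 0.
    exact: (@Int_FTC R (u e) (u' e) 0 (2 * pi) p2 (du^~ e) (cu' e)).
  rewrite /u add0r (_ : rotz (2 * pi + e) = rotz e) ?subrr //.
  by rewrite addrC -rotzD rotz_2pi mulmx1.
have c0 : lips 0 (fun e => Int 0 (2 * pi) (u e)).
  by apply: (lips_of_derive dI) => a; rewrite normr0.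
have := c0 d 0; rewrite mul0r normr_le0 subr_eq0 => /eqP.
rewrite /u => E; transitivity (Int 0 (2 * pi) (fun c => W (rotz (c + d) *m x))).
  by apply: eq_Int => c _; rewrite mulmxA rotzD.
by rewrite E; apply: eq_Int => c _; rewrite addr0.
Qed.

(** Points with the same third coordinate lie on one parallel and differ by a shift of the
    azimuth. *)
Lemma Int_rotz_zonal W x y : sm W -> nsq x = 1 -> nsq y = 1 -> x o2 0 = y o2 0 ->
  Int 0 (2 * pi) (fun c => W (rotz c *m x)) = Int 0 (2 * pi) (fun c => W (rotz c *m y)).
Proof.
move=> sW /sph_vec_surj [a [b [_ b0 <-]]] /sph_vec_surj [a' [b' [_ b'0 <-]]].
rewrite !sph_vec2 => E; have -> : b = b'.
  by apply: (@cos_inj R) => //; rewrite in_itv.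
have n : nsq (roty b' *m e3 R) = 1 by rewrite nsq_orth ?nsq_e3 //; exact: roty_orth.
have sh d : Int 0 (2 * pi) (fun c => W (rotz c *m sph_vec d b')) =
    Int 0 (2 * pi) (fun c => W (rotz c *m (roty b' *m e3 R))).
  by rewrite sph_vec_rot -mulmxA; exact: Int_rotz_shift.
by rewrite !sh.
Qed.

Lemma e3_third g : (SO3val g *m e3 R) o2 0 = ((SO3val g)^T *m e3 R) o2 0.
Proof. by rewrite /e3 /basis3 -!colE !mxE. Qed.

(* Substituting g -> k rotz(c) g and averaging over c replaces f by a function of the third
   coordinate; this coordinate is the same for g e3 and g^T e3, so H_average applies. *)
Lemma H_zonal f q k : sm f -> sm q ->
  2 * pi * H (fun g => f (SO3val g *m e3 R) * q ((SO3val g)^T *m (SO3val k *m e3 R))) =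
  Int 0 (2 * pi) (fun c => 2 * pi * Isph (fun x => f (SO3val k *m (rotz c *m x)) * q x)).
Proof.
move=> sf sq; have p2 := pi2_gt0 R; have n3 := nsq_e3 R.
have [kO _] := SO3_isSO3 k.
pose W x := f (SO3val k *m x); have sW : sm W by exact: sm_orth.
have [B B0 HB] := sphere_bounded (sm_cnz sW); have [K K0 HK] := sphere_lipschitz sW.
have [D D0 HD'] := sphere_bounded (sm_cnz sq).
have nr (c : R) x : nsq (rotz c *m x) = nsq x by rewrite nsq_orth //; exact: rotz_orth.
have bq : bmeas (fun g : G => q ((SO3val g)^T *m e3 R)) by apply: (lipmeas_bm (lipmeas_rot sq)).
have bf1 (M : 'M[R]_3) : isSO3 M -> bmeas (fun g : G => f (M *m (SO3val g *m e3 R))).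
  by move=> SM; exact: bm_rot.
have bf2 c : bmeas (fun g : G => W (rotz c *m ((SO3val g)^T *m e3 R))).
  have sWr : sm (fun x => W (rotz c *m x)) by apply: sm_orth => //; exact: rotz_orth.
  exact: (lipmeas_bm (lipmeas_rot sWr)).
pose F1 (g : G) c := W (rotz c *m (SO3val g *m e3 R)) * q ((SO3val g)^T *m e3 R).
pose F2 (g : G) c := W (rotz c *m ((SO3val g)^T *m e3 R)) * q ((SO3val g)^T *m e3 R).
have lipF (x y : V) : nsq x = 1 -> nsq y = 1 -> lips (K * 4 * D) (fun c => W (rotz c *m x) * q y).
  move=> x1 y1 c c'; rewrite -mulrBl normrM [leRHS]mulrAC; apply: ler_pM => //; last exact: HD'.
  apply: le_trans (HK _ _ _ _) _; rewrite ?nr // -mulrA; apply: ler_wpM2l => //.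
  exact: rotz_dst.
have bndF (x y : V) c : nsq x = 1 -> nsq y = 1 -> `|W (rotz c *m x) * q y| <= B * D.
  by move=> x1 y1; rewrite normrM; apply: ler_pM => //; [apply: HB; rewrite nr|exact: HD'].
have n1 g : nsq (SO3val g *m e3 R) = 1 by rewrite nsq_SO3.
have n2 g : nsq ((SO3val g)^T *m e3 R) = 1 by rewrite nsq_tr.
have bF1 c : bmeas (F1^~ c).
  apply: bmM => //; apply: (bm_eq (bf1 _ (SO3_mul (SO3_isSO3 k) (isSO3_rotz c)))) => g.
  by rewrite /W !mulmxA.
have bF2 c : bmeas (F2^~ c) by apply: bmM.
have [_ E1] := H_exchange mu_haar (ltW p2) bF1 (fun g c => bndF _ _ c (n1 g) (n2 g)) (fun g => lipF _ _ (n1 g) (n2 g)).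
have [_ E2] := H_exchange mu_haar (ltW p2) bF2 (fun g c => bndF _ _ c (n2 g) (n2 g)) (fun g => lipF _ _ (n2 g) (n2 g)).
(* Left translation by k rotz(c): in the second factor k cancels and rotz(c) disappears because it
   fixes e3. *)
have step1 c : H (F1^~ c) = H (fun g => f (SO3val g *m e3 R) * q ((SO3val g)^T *m (SO3val k *m e3 R))).
  have [r Er] := isSO3_surj (SO3_mul (SO3_isSO3 k) (isSO3_rotz c)).
  rewrite -[RHS](H_left mu_haar r).
    apply: eq_H => g; rewrite /F1 /W /= Er !mulmxA; congr (_ * q _).
    rewrite !trmx_mul -!mulmxA; congr (_ *m _); rewrite (mulmxA (SO3val k)^T) kO mul1mx.
    have [rO _] := isSO3_rotz c; have re : rotz c *m e3 R = e3 R.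
      have [a0 a1 a2] := rotz_vec c (e3 R).
      by apply: vec3P; rewrite ?a0 ?a1 ?a2 !e3E /=; ring.
    by rewrite -[in RHS]re mulmxA rO mul1mx.
  apply: bmM; last by apply: (lipmeas_bm (lipmeas_rot sq)); rewrite nsq_SO3.
  have I1 : isSO3 (1%:M : 'M[R]_3) by split; rewrite ?trmx1 ?mulmx1 ?det1.
  by apply: (bm_eq (bf1 _ I1)) => g; rewrite mul1mx.
transitivity (Int 0 (2 * pi) (fun c => H (F1^~ c))).
  rewrite (@eq_Int _ _ _ _ (cst (H (fun g => f (SO3val g *m e3 R) * q ((SO3val g)^T *m (SO3val k *m e3 R)))))) => [|c _].
    by rewrite Int_cst ?(ltW p2) // subr0 mulrC.
  exact: step1.
rewrite -E1; transitivity (H (fun g => Int 0 (2 * pi) (F2 g))).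
  apply: eq_H => g; rewrite /F1 /F2.
  have cW x : nsq x = 1 -> continuous (fun c => W (rotz c *m x)).
    by move=> x1; have [C lC] := lips_rotz sW x1; exact: lips_continuous lC.
  have pull x : nsq x = 1 -> Int 0 (2 * pi) (fun c => W (rotz c *m x) * q ((SO3val g)^T *m e3 R)) =
      q ((SO3val g)^T *m e3 R) * Int 0 (2 * pi) (fun c => W (rotz c *m x)).
    by move=> x1; rewrite -IntZ //; [apply: eq_Int => c _; rewrite mulrC|exact: cW].
  by rewrite !pull //; congr (_ * _); apply: Int_rotz_zonal => //; exact: e3_third.
rewrite E2; apply: eq_Int => c _.
have sWr : sm (fun x => W (rotz c *m x)) by apply: sm_orth => //; exact: rotz_orth.
by rewrite -(H_average mu_haar (sm_mul sWr sq) n3).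
Qed.

End GroupConvolution.

(** * Convolution with h *)

Section HarmonicConvolution.
Variable R : realType.
Variable mu : {measure set (SO3borel R) -> \bar R}.
Hypothesis mu_haar : haar_SO3 mu.
Local Notation V := 'cV[R]_3.
Local Notation G := (SO3borel R).
Local Notation H := (haarInt mu).
Implicit Types (U W f phi : V -> R) (x y z t : V) (g k : SO3 R) (Y : nat -> int -> V -> R).

Lemma bm_pole f : sm f -> bmeas (fun g : G => f (SO3val g *m e3 R)).
Proof.
move=> sf; have I1 : isSO3 (1%:M : 'M[R]_3) by split; rewrite ?trmx1 ?mulmx1 ?det1.
by apply: (bm_eq (bm_rot sf I1 (nsq_e3 R))) => g; rewrite mul1mx.
Qed.

Lemma I_cst0 : Isph (cst 0 : V -> R) = 0.
Proof. by rewrite I_cst mulr0. Qed.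

Lemma CS_rotz j (c : R) x :
  Cm j (rotz c *m x) = cos (j%:R * c) * Cm j x - sin (j%:R * c) * Sm j x /\
  Sm j (rotz c *m x) = sin (j%:R * c) * Cm j x + cos (j%:R * c) * Sm j x.
Proof.
elim: j => [|j [IC IS]]; first by rewrite /Cm /Sm /= !mul0r cos0 sin0; split; ring.
have [a0 a1 _] := rotz_vec c x.
rewrite /Cm /Sm /= -/(Cm j _) -/(Sm j _) -/(Cm j x) -/(Sm j x) IC IS a0 a1.
have -> : j.+1%:R * c = j%:R * c + c by rewrite -(natr1 j) mulrDl mul1r.
by rewrite sinD cosD; split; ring.
Qed.

Lemma Y_rotz l j (c : R) x :
  YC l j (rotz (- c) *m x) = cos (j%:R * c) * YC l j x + sin (j%:R * c) * YS l j x /\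
  YS l j (rotz (- c) *m x) = - sin (j%:R * c) * YC l j x + cos (j%:R * c) * YS l j x.
Proof.
have [_ _ a2] := rotz_vec (- c) x; have [b1 b2] := CS_rotz j (- c) x.
by rewrite /YC /YS a2 b1 b2 mulrN sinN cosN; split; ring.
Qed.

Lemma trig_2pi j : sin (j%:R * (2 * pi)) = 0 :> R /\ cos (j%:R * (2 * pi)) = 1 :> R.
Proof.
elim: j => [|j [Is Ic]]; first by rewrite mul0r sin0 cos0.
by rewrite -(natr1 j) mulrDl mul1r sinD cosD Is Ic mulr_natl sin2pi cos2pi; split; ring.
Qed.

Lemma Int_cos_sin j : Int 0 (2 * pi) (fun c : R => cos (j%:R * c)) = (j == 0)%:R * (2 * pi) /\
  Int 0 (2 * pi) (fun c : R => sin (j%:R * c)) = 0.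
Proof.
have p2 := pi2_gt0 R.
case: j => [|j].
  split; rewrite /= ?mul1r.
    rewrite (@eq_Int _ _ _ _ (cst 1)) => [|c _]; last by rewrite mul0r cos0.
    by rewrite Int_cst ?(ltW p2) // subr0 mul1r.
  rewrite (@eq_Int _ _ _ _ (cst 0)) => [|c _]; last by rewrite mul0r sin0.
  by rewrite Int_cst ?(ltW p2) // mul0r.
have j0 : (j.+1%:R : R) != 0 by rewrite pnatr_eq0.
have [s2 c2] := trig_2pi j.+1; move: (j.+1%:R : R) j0 s2 c2 => a a0 s2 c2.
have ds (c : R) : is_derive c 1 (fun c : R => sin (a * c)) (a * cos (a * c)).
  have da : is_derive c 1 (fun c : R => a * c) a by apply: is_derive_eq; rewrite /GRing.scale /=; ring.
  have := is_derive1_comp (f := @sin R) (g := fun c => a * c) (is_derive_sin (a * c)) da.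
  by rewrite /GRing.scale /= mulrC => h; exact: h.
have dc (c : R) : is_derive c 1 (fun c : R => cos (a * c)) (- (a * sin (a * c))).
  have da : is_derive c 1 (fun c : R => a * c) a by apply: is_derive_eq; rewrite /GRing.scale /=; ring.
  have := is_derive1_comp (f := @cos R) (g := fun c => a * c) (is_derive_cos (a * c)) da.
  by rewrite /GRing.scale /= mulNr mulrC => h; exact: h.
have cs : continuous (fun c : R => sin (a * c)) := is_derive_continuous ds.
have cc : continuous (fun c : R => cos (a * c)) := is_derive_continuous dc.
split; rewrite /= ?mul0r; apply: (mulfI a0); rewrite mulr0 -IntZ //.
  rewrite (Int_FTC p2 ds) ?s2 ?mulr0 ?sin0 ?subrr //; exact: continuousZ_real.
have dN (c : R) : is_derive c 1 (fun c : R => - cos (a * c)) (a * sin (a * c)).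
  by have := is_deriveN (dc c); rewrite opprK.
rewrite (Int_FTC p2 dN) ?c2 ?mulr0 ?cos0 ?subrr //; exact: continuousZ_real.
Qed.

(** The factor 2 pi is that of [H_average], [Nlm] the ratio of Y_l^0 to P_l, and the last quotient
    undoes the normalization of [proj]. *)
Definition zonmul l : R := 2 * pi * (Nlm R l 0 * (4 * pi / (2 * l + 1)%:R)).

(** [coef_a] and [Nlm] contain the same root of (2l+1)/(4 pi), and its square cancels the remaining
    factors. *)
Lemma coef_h_zonmul l : coef_h R l * zonmul l = qmul R l.
Proof.
have N0 : Nlm R l 0 = Num.sqrt ((2 * l + 1)%:R / (4 * pi)).
  rewrite /Nlm subn0 addn0; congr Num.sqrt.
  have f1 : (l`!%:R : R) != 0 by rewrite pnatr_eq0 -lt0n fact_gt0.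
  have pn := lt0r_neq0 (pi_gt0 R); move: (l`!%:R : R) (pi : R) f1 pn => A P An Pn.
  by field; rewrite ?An ?Pn.
rewrite /coef_h /coef_a /zonmul N0 /qmul /resmul.
have q0 : (0 : R) < (2 * l + 1)%:R by rewrite ltr0n addn1.
have p0 := pi_gt0 R.
set s := Num.sqrt _; have s2 : s * s = (2 * l + 1)%:R / (4 * pi).
  by rewrite -expr2 sqr_sqrtr // divr_ge0 ?(ltW q0) // mulr_ge0 // ltW.
have r0 : (0 : R) < (l * l.+1)%:R + 1 by apply: ltr_wpDl.
rewrite natrD addn1 -[LHS]mulr1.
have qn := lt0r_neq0 q0; have pn := lt0r_neq0 p0; have rn := lt0r_neq0 r0.
move: s2 qn pn rn; move: ((2 * l + 1)%:R : R) ((l * l.+1)%:R : R) (pi : R) => D p P s2 Dn Pn pn.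
transitivity (p / (p + 1) * (s * s) * (4 * P / D)); first by field; rewrite ?Dn ?Pn ?pn.
by rewrite s2; field; rewrite ?Dn ?Pn ?pn.
Qed.

(** In [H_zonal] the rotation by c moves to the harmonic and multiplies it by a phase of frequency
    j, whose integral over a period vanishes unless j = 0. *)
Lemma H_YC f l j t : sm f -> nsq t = 1 ->
  H (fun g => f (SO3val g *m e3 R) * YC l j ((SO3val g)^T *m t)) = (j == 0)%:R * (zonmul l * proj l f t) /\
  H (fun g => f (SO3val g *m e3 R) * YS l j ((SO3val g)^T *m t)) = 0.
Proof.
move=> sf /SO3_to_pole [M SM ->]; have [k kE] := isSO3_surj SM; rewrite -kE.
have [kO _] := SO3_isSO3 k; have p2 := pi2_gt0 R; have p2n := lt0r_neq0 p2.
pose W x := f (SO3val k *m x); have sW : sm W by exact: sm_orth.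
have sC := @sm_YC R l j; have sS := @sm_YS R l j.
pose A := Isph (fun x => W x * YC l j x); pose B := Isph (fun x => W x * YS l j x).
have shift q c : sm q -> Isph (fun x => f (SO3val k *m (rotz c *m x)) * q x) =
    Isph (fun x => W x * q (rotz (- c) *m x)).
  move=> sq; have s1 : sm (fun x => f (SO3val k *m (rotz c *m x)) * q x).
    apply: sm_mul => //; apply: (@sm_orth _ (rotz c) W) => //; exact: rotz_orth.
  rewrite -(I_SO3 (isSO3_rotz (- c)) s1); apply: eq_I => x _.
  rewrite (mulmxA (rotz c)) rotzD subrr.
  have -> : rotz 0 = 1%:M :> 'M[R]_3 by rewrite /rotz /rot3 /rodrigues sin0 cos0 scale0r subrr scale0r !addr0.
  by rewrite mul1mx.
have [ic is_] := Int_cos_sin j.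
have cc : continuous (fun c : R => cos (j%:R * c)).
  by move=> c; apply: (@continuous_comp R R R ( *%R j%:R) (@cos R)); [exact: mulrl_continuous|exact: continuous_cos].
have cs : continuous (fun c : R => sin (j%:R * c)).
  by move=> c; apply: (@continuous_comp R R R ( *%R j%:R) (@sin R)); [exact: mulrl_continuous|exact: continuous_sin].
have lin (a b : R) : Isph (fun x => W x * (a * YC l j x + b * YS l j x)) = a * A + b * B.
  rewrite /A /B -!IZ; try exact/sm_cnz/sm_mul.
  rewrite -ID; try exact/cnzZ/sm_cnz/sm_mul.
  by apply: eq_I => x _; ring.
split; apply: (mulfI p2n); rewrite H_zonal //.
  rewrite (@eq_Int _ _ _ _ (fun c => 2 * pi * A * cos (j%:R * c) + 2 * pi * B * sin (j%:R * c))) => [|c _].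
    rewrite IntD; try exact: continuousZ_real.
    rewrite !IntZ // ic is_ mulr0 addr0.
    case: j {ic is_ cc cs lin sC sS B} @A => [|j] A; last by rewrite mul0r mulr0 !mul0r mulr0.
    rewrite !mul1r -mulrA [A * _]mulrC; congr (_ * _).
    rewrite /zonmul -mulrA; congr (_ * _).
    rewrite -(proj_SO3 l (e3 R) (SO3_isSO3 k) sf) /proj.
    have -> : A = Nlm R l 0 * Isph (fun x => (legendre R l).[dot (e3 R) x] * W x).
      rewrite -IZ; last exact/sm_cnz/sm_mul/sW/sm_zonal.
      by apply: eq_I => x _; rewrite dotC dot_basis /YC /Cm /=; ring.
    have q0 : ((2 * l + 1)%:R : R) != 0 by rewrite pnatr_eq0 addn1.
    have pn := lt0r_neq0 (pi_gt0 R); move: (Isph _) ((2 * l + 1)%:R : R) (pi : R) q0 pn => J D P Dn Pn.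
    by field; rewrite ?Dn ?Pn.
  rewrite shift // (@eq_I _ _ (fun x => W x * (cos (j%:R * c) * YC l j x + sin (j%:R * c) * YS l j x))).
    by rewrite lin; ring.
  by move=> x _; have [-> _] := Y_rotz l j c x.
rewrite (@eq_Int _ _ _ _ (fun c => 2 * pi * B * cos (j%:R * c) + - (2 * pi * A) * sin (j%:R * c))) => [|c _].
  rewrite IntD; try exact: continuousZ_real.
  rewrite !IntZ // ic is_ mulr0 addr0 mulr0.
  case: j {A ic is_ cc cs lin sC sS} @B => [|j] B; last by rewrite mul0r mulr0.
  rewrite /B (@eq_I _ _ (cst 0)) => [|x _]; last by rewrite /YS /Sm /= !mulr0.
  by rewrite I_cst !mulr0 mul0r.
rewrite shift // (@eq_I _ _ (fun x => W x * (- sin (j%:R * c) * YC l j x + cos (j%:R * c) * YS l j x))).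
  by rewrite lin; ring.
by move=> x _; have [_ ->] := Y_rotz l j c x.
Qed.

Lemma H_Yr f l m t : sm f -> nsq t = 1 ->
  H (fun g => f (SO3val g *m e3 R) * Yr l m ((SO3val g)^T *m t)) = (m == 0)%:R * (zonmul l * proj l f t).
Proof.
move=> sf t1; case: m => j /=; first by have [-> _] := H_YC l j sf t1.
have [E _] := H_YC l j.+1 sf t1; have sC := @sm_YC R l j.+1.
transitivity ((-1) ^+ j.+1 * H (fun g => f (SO3val g *m e3 R) * YC l j.+1 ((SO3val g)^T *m t))).
  rewrite -HZ //; first by apply: eq_H => g; rewrite mulrCA.
  by apply: bmM; [exact: bm_pole|exact: lipmeas_bm (lipmeas_rot sC) t1].
by rewrite E !mul0r mulr0.
Qed.

Lemma H_Yi f l m t : sm f -> nsq t = 1 ->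
  H (fun g => f (SO3val g *m e3 R) * Yi l m ((SO3val g)^T *m t)) = 0.
Proof.
move=> sf t1; case: m => j /=; first by have [_ ->] := H_YC l j sf t1.
have [_ E] := H_YC l j.+1 sf t1; have sS := @sm_YS R l j.+1.
transitivity ((-1) ^+ j * H (fun g => f (SO3val g *m e3 R) * YS l j.+1 ((SO3val g)^T *m t))).
  rewrite -HZ //; first by apply: eq_H => g; rewrite mulrCA.
  by apply: bmM; [exact: bm_pole|exact: lipmeas_bm (lipmeas_rot sS) t1].
by rewrite E mulr0.
Qed.

(** The pairing of a convolution with a test function: invariance of the sphere moves g from phi to
    q, and [H_Isph] brings the group integral inside. *)
Lemma H_I_rot f q phi (c : V -> R) : sm f -> sm q -> sm phi ->
  (forall t, nsq t = 1 -> H (fun g => f (SO3val g *m e3 R) * q ((SO3val g)^T *m t)) = c t) ->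
  bmeas (fun g => f (SO3val g *m e3 R) * Isph (fun x => q x * phi (SO3val g *m x))) /\
  H (fun g => f (SO3val g *m e3 R) * Isph (fun x => q x * phi (SO3val g *m x))) =
    Isph (fun x => c x * phi x).
Proof.
move=> sf sq sphi cE.
pose Q g x := f (SO3val g *m e3 R) * (q ((SO3val g)^T *m x) * phi x).
have lq := lipmeas_rot sq; have lphi := lipmeas_sphere sphi; have bf := bm_pole sf.
have lQ : lipmeas Q by apply: lipmeas_mul; [exact: lipmeas_group|exact: lipmeas_mul].
have E g : f (SO3val g *m e3 R) * Isph (fun x => q x * phi (SO3val g *m x)) = Isph (Q g).
  have Sg := SO3_isSO3 g; have [gO _] := Sg; have [gO' _] := SO3_tr Sg.
  have s1 : sm (fun x => q x * phi (SO3val g *m x)) by apply: sm_mul => //; exact: sm_orth.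
  have s2 : sm (fun x => q ((SO3val g)^T *m x)) by apply: (sm_orth gO').
  rewrite -(I_SO3 (SO3_tr Sg) s1) -IZ; last first.
    by apply: sm_cnz; apply: (sm_orth gO' s1).
  by apply: eq_I => x _; rewrite /Q (mulmxA (SO3val g)) (orth_trmx gO) mul1mx.
have [bI EI] := H_Isph mu_haar lQ.
split; first exact: bm_eq bI (fun g => esym (E g)).
rewrite (eq_H _ E) EI; apply: eq_I => x x1; rewrite -(cE x x1).
have b1 : bmeas (fun g : G => f (SO3val g *m e3 R) * q ((SO3val g)^T *m x)).
  by apply: bmM => //; exact: lipmeas_bm lq x1.
rewrite mulrC -HZ //; apply: eq_H => g; rewrite /Q; ring.
Qed.

Lemma H_hT_Yr f phi l : sm f -> sm phi ->
  bmeas (fun g => f (SO3val g *m e3 R) * hT (@Yr R) l (fun x => phi (SO3val g *m x))) /\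
  H (fun g => f (SO3val g *m e3 R) * hT (@Yr R) l (fun x => phi (SO3val g *m x))) =
    qmul R l * Isph (fun x => proj l f x * phi x).
Proof.
move=> sf sphi; pose I g m := Isph (fun x => Yr l m x * phi (SO3val g *m x)).
have sY m : sm (@Yr R l m) by have [] := eigen_Yr R l m.
have key m := H_I_rot sf (sY m) sphi (fun t nt => H_Yr l m sf nt).
pose T (k : 'I_(2 * l).+1) (g : G) := f (SO3val g *m e3 R) * I g (k%:Z - l%:Z).
have E g : f (SO3val g *m e3 R) * hT (@Yr R) l (fun x => phi (SO3val g *m x)) = coef_h R l * \sum_k T k g.
  by rewrite /hT mulrCA [X in _ * X = _]mulr_sumr.
have bT (i : 'I_(2 * l).+1) : bmeas (T i) by have [] := key (i%:Z - l%:Z).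
have bS : bmeas (fun g => \sum_k T k g) by exact: bm_sum.
split; first by apply: (bm_eq (bmZ (coef_h R l) bS)) => g; rewrite E.
rewrite (eq_H _ E) HZ // H_sum // -coef_h_zonmul -mulrA; congr (_ * _).
(* The order m = k - l vanishes only for k = l, the middle index. *)
have ll : (l < (2 * l).+1)%N by rewrite ltnS mul2n -addnn leq_addr.
rewrite (bigD1 (Ordinal ll)) //= [X in _ + X]big1 ?addr0 => [|k kl].
  have [_ ->] := key (l%:Z - l%:Z); rewrite subrr eqxx.
  rewrite -IZ; last by apply/sm_cnz/sm_mul => //; exact: sm_proj.
  by apply: eq_I => x _; rewrite mul1r mulrA.
have [_ ->] := key (k%:Z - l%:Z); rewrite subr_eq0 eqz_nat.
have -> : (k == l :> nat) = false by apply/negbTE; move: kl; rewrite -val_eqE.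
by rewrite -[RHS]I_cst0; apply: eq_I => x _; rewrite !mul0r.
Qed.

Lemma H_hT_Yi f phi l : sm f -> sm phi ->
  bmeas (fun g => f (SO3val g *m e3 R) * hT (@Yi R) l (fun x => phi (SO3val g *m x))) /\
  H (fun g => f (SO3val g *m e3 R) * hT (@Yi R) l (fun x => phi (SO3val g *m x))) = 0.
Proof.
move=> sf sphi; pose I g m := Isph (fun x => Yi l m x * phi (SO3val g *m x)).
have sY m : sm (@Yi R l m) by have [] := eigen_Yi R l m.
have key m := H_I_rot sf (sY m) sphi (fun t nt => H_Yi l m sf nt).
pose T (k : 'I_(2 * l).+1) (g : G) := f (SO3val g *m e3 R) * I g (k%:Z - l%:Z).
have E g : f (SO3val g *m e3 R) * hT (@Yi R) l (fun x => phi (SO3val g *m x)) = coef_h R l * \sum_k T k g.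
  by rewrite /hT mulrCA [X in _ * X = _]mulr_sumr.
have bT (i : 'I_(2 * l).+1) : bmeas (T i) by have [] := key (i%:Z - l%:Z).
have bS : bmeas (fun g => \sum_k T k g) by exact: bm_sum.
split; first by apply: (bm_eq (bmZ (coef_h R l) bS)) => g; rewrite E.
rewrite (eq_H _ E) HZ // H_sum // big1 ?mulr0 // => k _.
have [_ ->] := key (k%:Z - l%:Z).
by rewrite -[RHS]I_cst0; apply: eq_I => x _; rewrite !mul0r.
Qed.

(** The series may be integrated term by term because its tail is uniform in g: by [lap2_SO3] one
    bound S on the double Laplacian of phi holds for all rotates. *)
Lemma H_hlim Y f phi (u : nat -> R) : normalized Y -> sm f -> sm phi -> hom0 phi ->
  (forall l, bmeas (fun g => f (SO3val g *m e3 R) * hT Y l (fun x => phi (SO3val g *m x))) /\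
    H (fun g => f (SO3val g *m e3 R) * hT Y l (fun x => phi (SO3val g *m x))) = u l) ->
  bmeas (fun g => f (SO3val g *m e3 R) * hlim Y (fun x => phi (SO3val g *m x))) /\
  (fun n => \sum_(l < n) u l) @ \oo -->
    H (fun g => f (SO3val g *m e3 R) * hlim Y (fun x => phi (SO3val g *m x))).
Proof.
move=> nY sf sphi hphi Hu.
have [B B0 HB] := sphere_bounded (sm_cnz sf).
have [S S0 HS] := sphere_bounded (sm_cnz (sm_lap (sm_lap sphi))).
set K := 36 * ((4 * pi + 1) / 2 * S).
have fB g : `|f (SO3val g *m e3 R)| <= B by apply: HB; rewrite nsq_SO3 nsq_e3.
have sg g : sm (fun x => phi (SO3val g *m x)) by have [gO _] := SO3_isSO3 g; exact: sm_orth.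
have lg g x : nsq x = 1 -> `|lap (lap (fun x => phi (SO3val g *m x))) x| <= S.
  move=> x1; rewrite lap2_SO3 //; [|exact: SO3_isSO3|exact: nsq1_neq0].
  by apply: HS; rewrite nsq_SO3.
have tail g n := hlim_tail n nY (sg g) (lg g); rewrite -/K in tail.
have K0 : 0 <= K by apply: le_trans (hlim_bound nY (sg point) (lg point)).
pose D (g : G) := f (SO3val g *m e3 R) * hlim Y (fun x => phi (SO3val g *m x)).
pose Dl l (g : G) := f (SO3val g *m e3 R) * hT Y l (fun x => phi (SO3val g *m x)).
pose Dn (n : nat) (g : G) := \sum_(l < n) Dl l g.
have bDn n : bmeas (Dn n) by apply: bm_sum => l; have [] := Hu l.
have err g n : `|D g - Dn n g| <= B * (K * tele R n).
  by rewrite /D /Dn -mulr_sumr -mulrBr normrM; apply: ler_pM.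
have lim0 : (fun n => 8 * pi ^+ 2 * (B * (K * tele R n))) @ \oo --> (0 : R).
  rewrite (_ : (fun n => _) = fun n => (8 * pi ^+ 2 * (B * K)) * tele R n).
    by rewrite -(mulr0 (8 * pi ^+ 2 * (B * K))); apply: cvgMl_tmp; exact: tele_cvg0.
  by apply/funext => n; ring.
have lim1 : (fun n => B * (K * tele R n)) @ \oo --> (0 : R).
  rewrite (_ : (fun n => _) = fun n => (B * K) * tele R n).
    by rewrite -(mulr0 (B * K)); apply: cvgMl_tmp; exact: tele_cvg0.
  by apply/funext => n; ring.
have bD : bmeas D.
  split; last by exists (B * K) => g; rewrite normrM; apply: ler_pM => //; exact: hlim_bound (lg g).
  apply: (@measurable_fun_cvg _ G R setT Dn) => [n|g _]; first by have [] := bDn n.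
  apply/cvgrPdist_le => e e0; near=> n; apply: le_trans (err g n) _.
  by near: n; apply: (cvgr_le _ lim1).
split=> //; apply/cvgrPdist_le => e e0; near=> n.
have -> : \sum_(l < n) u l = H (Dn n).
  rewrite /Dn H_sum // => [|l]; last by have [] := Hu l.
  by apply: eq_bigr => l _; have [_ ->] := Hu l.
rewrite -mulN1r -HZ // -HD //; last exact: bmZ.
apply: le_trans (H_bound mu_haar (C := B * (K * tele R n)) _ _) _.
- by apply: bmD => //; exact: bmZ.
- by move=> g; have := err g n; rewrite /D mulN1r.
by near: n; apply: (cvgr_le _ lim0).
Unshelve. all: by end_near. Qed.

Lemma H_hlim_Yr f phi U : sm f -> sm phi -> hom0 phi -> sm U ->
  (forall l x, nsq x = 1 -> proj l U x = qmul R l * proj l f x) ->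
  bmeas (fun g => f (SO3val g *m e3 R) * hlim (@Yr R) (fun x => phi (SO3val g *m x))) /\
  H (fun g => f (SO3val g *m e3 R) * hlim (@Yr R) (fun x => phi (SO3val g *m x))) =
    Isph (fun x => U x * phi x).
Proof.
move=> sf sphi hphi sU E.
have [b c] := H_hlim (normalized_Yr R) sf sphi hphi (fun l => H_hT_Yr l sf sphi).
split=> //; apply: cvgn_unique c _.
rewrite (_ : (fun n => _) = fun n => \sum_(l < n) Isph (fun x => proj l U x * phi x)).
  exact: I_proj_cvg.
apply/funext => n; apply: eq_bigr => l _; rewrite -IZ; last by apply/sm_cnz/sm_mul => //; exact: sm_proj.
by apply: eq_I => x x1; rewrite E // mulrA.
Qed.

Lemma H_hlim_Yi f phi : sm f -> sm phi -> hom0 phi ->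
  bmeas (fun g => f (SO3val g *m e3 R) * hlim (@Yi R) (fun x => phi (SO3val g *m x))) /\
  H (fun g => f (SO3val g *m e3 R) * hlim (@Yi R) (fun x => phi (SO3val g *m x))) = 0.
Proof.
move=> sf sphi hphi.
have [b c] := H_hlim (normalized_Yi R) sf sphi hphi (fun l => H_hT_Yi l sf sphi).
split=> //; apply: cvgn_unique c _.
by rewrite (_ : (fun n => _) = cst 0); [exact: cvg_cst|apply/funext => n; rewrite big1].
Qed.

End HarmonicConvolution.

(** * Smoothness in the spherical variable at fixed s *)

Section Slices.
Variable R : realType.
Local Notation V := 'cV[R]_3.

Lemma iterD_slice (g : (R^o * V)%type -> R) (s : R^o) (vs : seq V) (x : V) :
  Defs.iterD (map (fun v : V => (0 : R^o, v)) vs) g (s, x) = Defs.iterD vs (fun y => g (s, y)) x.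
Proof.
elim: vs x => [//|v vs IH] x; rewrite /= /derive.
set a := (X in lim (fmap X _) = _); set b := (X in _ = lim (fmap X _)).
suff -> : a = b by [].
apply/funext => h; rewrite /a /b /=.
have -> : h *: ((0 : R^o, v) : (R^o * V)%type) + (s, x) = (s, h *: v + x).
  by congr pair; rewrite /= scaler0 add0r.
by rewrite -!IH.
Qed.

Lemma smoothZ3_slice (F : R -> S2 R -> R[i]) (s : R) : smoothZ3 F -> smoothS2 (F s).
Proof.
move=> sF vs x x0.
have [dr di] := sF (map (fun v : V => (0 : R^o, v)) vs) (s, x) x0.
have dp : differentiable (fun y : V => (s : R^o, y)) x.
  by apply: differentiable_pair.
split.
  rewrite (_ : Defs.iterD vs _ = Defs.iterD (map (fun v : V => (0 : R^o, v)) vs)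
    (reals_of (fun p : (R^o * V)%type => ext0 (F p.1) p.2)) \o (fun y : V => (s : R^o, y))).
    exact: differentiable_comp.
  by apply/funext => y /=; rewrite iterD_slice.
rewrite (_ : Defs.iterD vs _ = Defs.iterD (map (fun v : V => (0 : R^o, v)) vs)
  (imags_of (fun p : (R^o * V)%type => ext0 (F p.1) p.2)) \o (fun y : V => (s : R^o, y))).
  exact: differentiable_comp.
by apply/funext => y /=; rewrite iterD_slice.
Qed.

End Slices.

(** * The convolution identity for one function on the sphere *)

Section Convolution.
Variable R : realType.
Variable mu : {measure set (SO3borel R) -> \bar R}.
Hypothesis mu_haar : haar_SO3 mu.
Local Notation V := 'cV[R]_3.
Local Notation H := (haarInt mu).
Implicit Types (f phi : S2 R -> R[i]) (g : SO3 R) (x : V).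

Lemma unitv_SO3 g x : unitv (SO3val g *m x) = SO3val g *m unitv x.
Proof.
have [gO _] := SO3_isSO3 g.
by rewrite /unitv /enorm -/(nsq _) nsq_orth // scalemxAr.
Qed.

Lemma ext0_rot phi g x : x != 0 -> ext0 (fun t => phi (Defs.rot g t)) x = ext0 phi (SO3val g *m x).
Proof.
move=> x0; have [gO _] := SO3_isSO3 g; congr phi; apply: val_inj; rewrite /=.
rewrite (insubd_unitv x0) -/(unitv (SO3val g *m x)) insubd_unitv ?unitv_SO3 //.
exact: orth_neq0.
Qed.

Lemma north_e3 : S2val (north : S2 R) = e3 R.
Proof. by have [] := sph_vec_pole (0 : R). Qed.

Lemma h_dist_rot phi g : smoothS2 phi -> h_dist (fun t => phi (Defs.rot g t)) = Complex
  (hlim (@Yr R) (fun x => reE phi (SO3val g *m x)) - hlim (@Yi R) (fun x => imE phi (SO3val g *m x)))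
  (hlim (@Yr R) (fun x => imE phi (SO3val g *m x)) + hlim (@Yi R) (fun x => reE phi (SO3val g *m x))).
Proof.
move=> /smoothS2_sm [sr si]; have [gO _] := SO3_isSO3 g.
have Er x : x != 0 -> reE phi (SO3val g *m x) = reE (fun t => phi (Defs.rot g t)) x.
  by move=> x0; rewrite /reE /reals_of ext0_rot.
have Ei x : x != 0 -> imE phi (SO3val g *m x) = imE (fun t => phi (Defs.rot g t)) x.
  by move=> x0; rewrite /imE /imags_of ext0_rot.
rewrite h_distE; last first.
  by apply/smoothS2_sm; split; [exact: sm_eq (sm_orth gO sr) Er|exact: sm_eq (sm_orth gO si) Ei].
have hr Y : hlim Y (reE (fun t => phi (Defs.rot g t))) = hlim Y (fun x => reE phi (SO3val g *m x)).
  by apply: eq_hlim => x /nsq1_neq0 x0; rewrite Er.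
have hi Y : hlim Y (imE (fun t => phi (Defs.rot g t))) = hlim Y (fun x => imE phi (SO3val g *m x)).
  by apply: eq_hlim => x /nsq1_neq0 x0; rewrite Ei.
by rewrite !hr !hi.
Qed.

(** Splitting f, h and phi into real and imaginary parts leaves eight group integrals. Those with
    [Yi] vanish, and the four with [Yr] are the pairings of the parts of Q f with those of phi. *)
Lemma opQ_convolution f : smoothS2 f -> eq_dist (dist_of_fun (opQ f)) (convS2 mu f (@h_dist R)).
Proof.
move=> sf phi sphi; have [U [W [sU sW E EU EW]]] := opQ_parts sf.
have [fr fi] := (smoothS2_sm f).1 sf; have [pr pi_] := (smoothS2_sm phi).1 sphi.
rewrite (dist_of_funE sU sW sphi E).
have hr := @hom0_reE R phi; have hi := @hom0_imE R phi.
have [b1 e1] := H_hlim_Yr mu_haar fr pr hr sU EU.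
have [b2 e2] := H_hlim_Yr mu_haar fr pi_ hi sU EU.
have [b3 e3'] := H_hlim_Yr mu_haar fi pr hr sW EW.
have [b4 e4] := H_hlim_Yr mu_haar fi pi_ hi sW EW.
have [c1 d1] := H_hlim_Yi mu_haar fr pr hr.
have [c2 d2] := H_hlim_Yi mu_haar fr pi_ hi.
have [c3 d3] := H_hlim_Yi mu_haar fi pr hr.
have [c4 d4] := H_hlim_Yi mu_haar fi pi_ hi.
have fE g : f (Defs.rot g north) = Complex (reE f (SO3val g *m e3 R)) (imE f (SO3val g *m e3 R)).
  rewrite -north_e3 -[SO3val g *m _]/(S2val (Defs.rot g north)) reE_S2 imE_S2.
  by case: (f _).
have HB a b : bmeas a -> bmeas b -> H (fun g => a g - b g) = H a - H b.
  move=> ba bb; rewrite -mulN1r -HZ // -HD //; last exact: bmZ.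
  by apply: eq_H => g; rewrite mulN1r.
have bmB a b : bmeas a -> bmeas b -> bmeas (fun g => a g - b g).
  by move=> ba bb; apply: (bm_eq (bmD ba (bmZ (-1) bb))) => g; rewrite mulN1r.
apply: eq_complex => /=.
  transitivity (H (fun g =>
      (reE f (SO3val g *m e3 R) * hlim (@Yr R) (fun x => reE phi (SO3val g *m x))
       - reE f (SO3val g *m e3 R) * hlim (@Yi R) (fun x => imE phi (SO3val g *m x)))
      - (imE f (SO3val g *m e3 R) * hlim (@Yr R) (fun x => imE phi (SO3val g *m x))
       + imE f (SO3val g *m e3 R) * hlim (@Yi R) (fun x => reE phi (SO3val g *m x))))).
    rewrite HB; [|exact: bmB|exact: bmD].
    by rewrite HB // HD // e1 e4 d2 d3 subr0 addr0.
  apply: eq_H => g; rewrite /reals_of fE h_dist_rot //=; ring.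
transitivity (H (fun g =>
    (reE f (SO3val g *m e3 R) * hlim (@Yr R) (fun x => imE phi (SO3val g *m x))
     + reE f (SO3val g *m e3 R) * hlim (@Yi R) (fun x => reE phi (SO3val g *m x)))
    + (imE f (SO3val g *m e3 R) * hlim (@Yr R) (fun x => reE phi (SO3val g *m x))
     - imE f (SO3val g *m e3 R) * hlim (@Yi R) (fun x => imE phi (SO3val g *m x))))).
  rewrite (HD mu_haar (bmD b2 c1) (bmB _ _ b3 c4)).
  by rewrite (HD mu_haar b2 c1) (HB _ _ b3 c4) e2 e3' d1 d4 subr0 addr0.
apply: eq_H => g; rewrite /imags_of fE h_dist_rot //=; ring.
Qed.

End Convolution.

Theorem theorem7 (R : realType)
    (mu : {measure set (SO3borel R) -> \bar R}) (mu_haar : haar_SO3 mu)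
    (F : R -> S2 R -> R[i]) (F_Ccoo : CcooZ3 F) :
  is_distribution (@h_dist R) /\
  (forall phi : S2 R -> R[i], smoothS2 phi ->
     ccvg (fun n : nat => dist_of_fun (h_partial (R:=R) n) phi) (h_dist phi)) /\
  (forall s : R, eq_dist (dist_of_fun (opQ (F s))) (convS2 mu (F s) (@h_dist R))).
Proof.
split; first exact: h_dist_is_distribution.
split=> [phi sphi|s]; first by rewrite h_distE //; exact: h_dist_ccvg.
by apply: opQ_convolution => //; apply: smoothZ3_slice; case: F_Ccoo.
Qed.
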